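(* Let $k$ be an algebraically closed field, $n\ge2$, and $\Pi$ the complete preprojective algebra of type $\widetilde{\mathbb{A}}_{n-1}$ with vertices $1,\ldots,n$. Let $H=\{\theta\in K_0(\operatorname{proj}\Pi)_\mathbb{R}\mid\theta(h)=0\}$ where $h=\sum_{i=1}^n[S(i)]$. Then $$H=\bigsqcup_{J\subseteq\{1,\ldots,n-1\},\ w\in W'/W'_J}w\bigl(\operatorname{cone}^\circ\{[P(j)]-[P(n)]\mid j\in J\}\bigr)=\bigsqcup_{U\in\operatorname{2\text{-}presilt}\Pi'}\iota(C^\circ(U)),$$ and this is the decomposition of $H$ into TF equivalence classes (each displayed piece is a TF equivalence class, depending only on the coset $wW'_J$, and distinct pieces are disjoint).
   Context: $\Pi$ is the completion of the path algebra of the double of the cyclic quiver with $n$ vertices modulo the preprojective relations; $P(i)=e_i\Pi$, $S(i)$ its simple top. $\operatorname{fl}\Pi$ is the category of finite dimensional $\Pi$-modules. $K_0(\operatorname{proj}\Pi)_\mathbb{R}$ has basis $[P(i)]$ and $\theta(X)=\langle\theta,[X]\rangle$ with $\langle[P(i)],[S(j)]\rangle=\delta_{ij}$ for $X\in\operatorname{fl}\Pi$. For $\theta\in K_0(\operatorname{proj}\Pi)_\mathbb{R}$: $\overline{\mathcal{T}}_\theta=\{X\in\operatorname{fl}\Pi\mid\theta(X')\ge0$ for all factor modules $X'\}$, $\overline{\mathcal{F}}_\theta=\{X\in\operatorname{fl}\Pi\mid\theta(X')\le0$ for all submodules $X'\}$; $\theta,\eta$ are TF equivalent if $\overline{\mathcal{T}}_\theta=\overline{\mathcal{T}}_\eta$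 and $\overline{\mathcal{F}}_\theta=\overline{\mathcal{F}}_\eta$. $W$ is the affine Coxeter group of type $\widetilde{\mathbb{A}}_{n-1}$ with generators $s_1,\dots,s_n$, acting on $K_0(\operatorname{proj}\Pi)_\mathbb{R}$ by $s_j[P(j)]=-[P(j)]+[P(j-1)]+[P(j+1)]$ (indices mod $n$) and $s_j[P(i)]=[P(i)]$ for $i\ne j$. $W'=\langle s_1,\ldots,s_{n-1}\rangle$ and, for $J\subseteq\{1,\ldots,n-1\}$, $W'_J=\langle s_j\mid j\in\{1,\dots,n-1\}\setminus J\rangle$. $\operatorname{cone}^\circ\emptyset=\{0\}$, $\operatorname{cone}^\circ X=\sum_{x\in X}\mathbb{R}_{>0}x$. $\Pi'=\Pi/\langle e_n\rangle$ (preprojective algebra of type $\mathbb{A}_{n-1}$) with indecomposable projectives $P'(1),\dots,P'(n-1)$; $\operatorname{2\text{-}presilt}\Pi'$ is the set of basic 2-term presilting complexes $U$ in $\mathsf{K}^b(\operatorname{proj}\Pi')$ (i.e. $\operatorname{Hom}(U,U[1])=0$); for $U=\bigoplus U_i$ with $U_i$ indecomposable, $C^\circ(U)=\operatorname{cone}^\circ\{[U_i]\}$; $\iota\colon K_0(\operatorname{proj}\Pi')_\mathbb{R}\to H$ is the linear isomorphism $[P'(i)]\mapsto[P(i)]-[P(n)]$. *)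

(* Defs.v *)
From HB Require Import structures.
From mathcomp Require Import all_boot all_order all_algebra.
From mathcomp Require Import reals.
Set Implicit Arguments. Unset Strict Implicit. Unset Printing Implicit Defensive.
Import Order.TTheory GRing.Theory Num.Theory.
Local Open Scope ring_scope.

(* Vertices 1..n of the cyclic quiver are the ordinals 0..n-1 of 'I_n;
   vertex n is the ordinal with value n.-1.  Arrows: a_i : i -> i+1 and
   b_i : i+1 -> i (indices mod n, via ordS). *)

Definition is_last (n : nat) (i : 'I_n) : bool := (i : nat) == n.-1.

(* Finite dimensional right modules over the complete preprojective
   algebra Pi: a vector space k^d (row vectors, acting on the right) with
   the action of the vertex idempotents e_i and of the arrows a_i, b_i,
   satisfying the preprojective relation, on which the arrow ideal acts
   nilpotently (= continuous f.d. modules over the completion).          *)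
Record rep (k : fieldType) (n : nat) := Rep {
  rd : nat;
  idem : 'I_n -> 'M[k]_rd;
  amx : 'I_n -> 'M[k]_rd;
  bmx : 'I_n -> 'M[k]_rd }.

Section Modules.
Variables (k : fieldType) (n : nat).
Local Notation rep := (rep k n).

Definition arr (X : rep) (x : 'I_n * bool) : 'M[k]_(rd X) :=
  if x.2 then amx X x.1 else bmx X x.1.

Definition is_mod (X : rep) : Prop :=
  [/\ \sum_i idem X i = 1%:M,
      forall i j, idem X i *m idem X j = (if i == j then idem X i else 0),
      forall i, idem X i *m amx X i *m idem X (ordS i) = amx X i,
      forall i, idem X (ordS i) *m bmx X i *m idem X i = bmx X i
    & \sum_i (amx X i *m bmx X i - bmx X i *m amx X i) = 0] /\
    (exists N : nat, forall s : seq ('I_n * bool), size s = N ->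
        foldr (fun x M => arr X x *m M) 1%:M s = 0).

(* modules over Pi' = Pi / <e_n> *)
Definition is_mod' (X : rep) : Prop :=
  is_mod X /\ forall i, is_last i -> idem X i = 0.

Definition is_submod (X : rep) (U : 'M[k]_(rd X)) : Prop :=
  (forall i, (U *m idem X i <= U)%MS) /\ (forall x, (U *m arr X x <= U)%MS).

Definition subdim (X : rep) (U : 'M[k]_(rd X)) (i : 'I_n) : nat :=
  \rank (U *m idem X i).

Definition is_hom (X Y : rep) (f : 'M[k]_(rd X, rd Y)) : Prop :=
  forall i, [/\ idem X i *m f = f *m idem Y i,
                amx X i *m f = f *m amx Y i &
                bmx X i *m f = f *m bmx Y i].

Definition is_proj' (P : rep) : Prop :=
  is_mod' P /\
  forall (M N : rep) (g : 'M[k]_(rd M, rd N)) (f : 'M[k]_(rd P, rd N)),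
    is_mod' M -> is_mod' N -> is_hom g -> row_full g -> is_hom f ->
    exists2 h : 'M[k]_(rd P, rd M), is_hom h & h *m g = f.

Definition radsp' (X : rep) : 'M[k]_(rd X) :=
  (\sum_(x : 'I_n * bool) <<arr X x>>)%MS.

(* multiplicity of P'(i) in a projective P = dim of (top P) e_i *)
Definition topmult (X : rep) (i : 'I_n) : nat :=
  (\rank (idem X i) - \rank (radsp' X *m idem X i))%N.

Definition rsum (X Y : rep) : rep :=
  @Rep k n (rd X + rd Y)
    (fun i => block_mx (idem X i) 0 0 (idem Y i))
    (fun i => block_mx (amx X i) 0 0 (amx Y i))
    (fun i => block_mx (bmx X i) 0 0 (bmx Y i)).

Definition rzero : rep := @Rep k n 0 (fun _ => 0) (fun _ => 0) (fun _ => 0).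

(* 2-term complexes  U^{-1} --d--> U^0  of projective Pi'-modules.
   Maps are written in diagrammatic order (right action): f then g = f *m g. *)
Record cx := Cx { c1 : rep; c0 : rep; cd : 'M[k]_(rd c1, rd c0) }.

Definition valid_cx (U : cx) : Prop :=
  [/\ is_proj' (c1 U), is_proj' (c0 U) & is_hom (cd U)].

Definition is_chain (U V : cx) (a1 : 'M[k]_(rd (c1 U), rd (c1 V)))
  (a0 : 'M[k]_(rd (c0 U), rd (c0 V))) : Prop :=
  [/\ is_hom a1, is_hom a0 & cd U *m a0 = a1 *m cd V].

Definition htpic (U V : cx) (a1 b1 : 'M[k]_(rd (c1 U), rd (c1 V)))
  (a0 b0 : 'M[k]_(rd (c0 U), rd (c0 V))) : Prop :=
  exists2 h : 'M[k]_(rd (c0 U), rd (c1 V)), is_hom h &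
    a1 - b1 = cd U *m h /\ a0 - b0 = h *m cd V.

Definition cxiso (U V : cx) : Prop :=
  exists a1 a0 b1 b0,
    [/\ @is_chain U V a1 a0, @is_chain V U b1 b0,
        htpic (a1 *m b1) 1%:M (a0 *m b0) 1%:M &
        htpic (b1 *m a1) 1%:M (b0 *m a0) 1%:M].

Definition cxzero : cx := @Cx rzero rzero 0.

Definition cxsum (U V : cx) : cx :=
  @Cx (rsum (c1 U) (c1 V)) (rsum (c0 U) (c0 V)) (block_mx (cd U) 0 0 (cd V)).

Definition cx_is_zero (U : cx) : Prop := cxiso U cxzero.

Definition cx_indec (U : cx) : Prop :=
  ~ cx_is_zero U /\
  forall V W : cx, valid_cx V -> valid_cx W -> cxiso U (cxsum V W) ->
    cx_is_zero V \/ cx_is_zero W.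

Definition hom_shift_zero (U V : cx) : Prop :=
  forall phi : 'M[k]_(rd (c1 U), rd (c0 V)), is_hom phi ->
    exists h0 : 'M[k]_(rd (c0 U), rd (c0 V)),
    exists h1 : 'M[k]_(rd (c1 U), rd (c1 V)),
      [/\ is_hom h0, is_hom h1 & phi = cd U *m h0 + h1 *m cd V].

Definition cx_decomp (U : cx) (Us : seq cx) : Prop :=
  (forall i, (i < size Us)%N -> valid_cx (nth cxzero Us i) /\
                                cx_indec (nth cxzero Us i)) /\
  cxiso U (foldr cxsum cxzero Us).

Definition basic_cx (U : cx) : Prop :=
  exists Us, cx_decomp U Us /\
    forall i j, (i < size Us)%N -> (j < size Us)%N -> i <> j ->
      ~ cxiso (nth cxzero Us i) (nth cxzero Us j).

Definition presilt (U : cx) : Prop :=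
  [/\ valid_cx U, hom_shift_zero U U & basic_cx U].

End Modules.

(* K_0(proj Pi)_R = 'rV[R]_n, coordinates w.r.t. the basis [P(1)],...,[P(n)] *)
Section Grothendieck.
Variables (R : realType) (n : nat).

Definition ev (j : 'I_n) : 'rV[R]_n := \row_i (i == j)%:R.
Definition evlast : 'rV[R]_n := \row_i (is_last i)%:R.

Definition pair (th : 'rV[R]_n) (v : 'I_n -> nat) : R :=
  \sum_i th 0 i * (v i)%:R.

Definition inH (th : 'rV[R]_n) : Prop := \sum_i th 0 i = 0.

(* Weyl group action: s_j [P(j)] = -[P(j)] + [P(j-1)] + [P(j+1)] *)
Definition alpha (j : 'I_n) : 'rV[R]_n :=
  2%:R *: ev j - ev (ord_pred j) - ev (ordS j).
Definition refl (j : 'I_n) (th : 'rV[R]_n) : 'rV[R]_n :=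
  th - th 0 j *: alpha j.
(* a word [:: j1; ...; jm] represents s_{j1} ... s_{jm} *)
Definition wact (w : seq 'I_n) (th : 'rV[R]_n) : 'rV[R]_n := foldr refl th w.

Definition admJ (J : {set 'I_n}) : Prop := forall j, j \in J -> ~~ is_last j.
Definition wordW' (w : seq 'I_n) : Prop := all (fun j => ~~ is_last j) w.
Definition wordWJ (J : {set 'I_n}) (w : seq 'I_n) : Prop :=
  all (fun j => ~~ is_last j && (j \notin J)) w.
Definition sameCoset (J : {set 'I_n}) (w w' : seq 'I_n) : Prop :=
  exists2 u, wordWJ J u & forall th, wact w' th = wact (w ++ u) th.

Definition coneJ (J : {set 'I_n}) (th : 'rV[R]_n) : Prop :=
  exists c : 'I_n -> R, (forall j, j \in J -> 0 < c j) /\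
    th = \sum_(j in J) c j *: (ev j - evlast).

Definition piece (J : {set 'I_n}) (w : seq 'I_n) (th : 'rV[R]_n) : Prop :=
  exists2 th0, coneJ J th0 & th = wact w th0.

Definition cone_seq (vs : seq 'rV[R]_n) (th : 'rV[R]_n) : Prop :=
  exists c : 'I_(size vs) -> R, (forall i, 0 < c i) /\
    th = \sum_i c i *: nth 0 vs i.

(* iota : [P'(i)] |-> [P(i)] - [P(n)]; K_0(proj Pi') is embedded in the
   coordinates 1..n-1 (last coordinate 0) *)
Definition iota (v : 'rV[R]_n) : 'rV[R]_n := v - (\sum_i v 0 i) *: evlast.

End Grothendieck.

Section TF.
Variables (k : fieldType) (R : realType) (n : nat).

Definition Tbar (th : 'rV[R]_n) (X : rep k n) : Prop :=
  is_mod X /\ forall U : 'M[k]_(rd X), is_submod U ->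
    0 <= pair th (fun i => @subdim _ _ X 1%:M i - subdim U i)%N.
Definition Fbar (th : 'rV[R]_n) (X : rep k n) : Prop :=
  is_mod X /\ forall U : 'M[k]_(rd X), is_submod U -> pair th (subdim U) <= 0.
Definition TFeq (th eta : 'rV[R]_n) : Prop :=
  (forall X, Tbar th X <-> Tbar eta X) /\ (forall X, Fbar th X <-> Fbar eta X).

Definition pclass (P : rep k n) : 'rV[R]_n := \row_i (topmult P i)%:R.
Definition cxclass (U : cx k n) : 'rV[R]_n := pclass (c0 U) - pclass (c1 U).

Definition inCi (U : cx k n) (th : 'rV[R]_n) : Prop :=
  exists Us, cx_decomp U Us /\
    exists2 v, cone_seq (map cxclass Us) v & th = iota v.
End TF.

(* Main.v *)
(* Write an element of H as the cyclic differences of a function x on the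
   vertices, unique up to constants.  The group W' permutes the values of x, so
   the pieces w(cone°) are the sets of x inducing a given weak ordering of the
   vertices.  The TF class of x is determined by this ordering and determines
   it: the thin modules supported on intervals detect the sign of x_j - x_i,
   while torsion classes are governed by bricks, and counting the maps that
   commute with both arrows bounds the Euler form of a brick, so that its
   dimension vector is a constant plus or minus the indicator of an interval
   and x pairs with it to a difference x_j - x_i.

   A presilting complex U determines the torsion pairs of all theta in its cone:
   a Pi'-module X is in Tbar iff Hom(U, X[1]) = 0 and in Fbar iff Hom(U, X) = 0.
   Each proper nonempty set S of vertices yields an indecomposable two-term
   complex U_S with class x = 1_S, and Hom(U_S, U_T[1]) = 0 when S and T are
   comparable; the superlevel sets of x therefore give a presilting complex
   whose cone contains x.  Two basic presilting complexes with the same torsion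
   pair are isomorphic, by approximations and Krull-Schmidt. *)

Require Import Defs.
From HB Require Import structures.
From mathcomp Require Import all_boot all_order all_algebra.
From mathcomp Require Import fingroup perm reals boolp zify lra ring.
Import Order.TTheory GRing.Theory Num.Theory.
Set Implicit Arguments. Unset Strict Implicit. Unset Printing Implicit Defensive.
Local Open Scope ring_scope.
(** * Modules and homomorphisms *)

(** Complexes over Pi' only see Pi'-modules, while TF equivalence quantifies over all Pi-modules.
    The bridge: for [i < j] the interval [[i, j)] omits the last vertex, so the thin modules that
    detect the ordering of [x] are already Pi'-modules, and on H equivalence tested on Pi'-modules
    implies TF equivalence. The bound for bricks works because, on a cycle, sum d_i^2 - sum d_i
    d_(i+1) is half the sum of squares of the cyclic differences of d. A brick makes it at most 1,
    so these integers, of sum zero, all vanish or are one 1, one -1 and zeros. Algebraic closedness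
    enters through an eigenvalue: a non-scalar endomorphism yields a non-zero singular one, which
    cuts the module into smaller pieces. Indecomposability of U_S is not read off its endomorphisms.
    A decomposition would split 1_S into two functions all of whose positive combinations order the
    vertices as 1_S does; integrality makes one of the two classes zero, and a rigid complex of
    class zero is contractible. *)

Section Reps.
Variables (k : fieldType) (n : nat).
Implicit Types X Y Z : rep k n.

(** Idempotents recover the single arrows from [fwd] and [bwd], so a module is a graded space with
    two operators of degrees 1 and -1, and the preprojective relation says that they commute. *)
Definition fwd X := \sum_i amx X i.
Definition bwd X := \sum_i bmx X i.
Definition dimv X i := \rank (idem X i).
Definition wordmx X (s : seq ('I_n * bool)) :=
  foldr (fun x M => arr X x *m M) 1%:M s.

(** Any number of generating rows is allowed, so that a homomorphism or a kernel can itself serve as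
    the submodule. *)
Definition stab X m (U : 'M[k]_(m, rd X)) :=
  (forall i, (U *m idem X i <= U)%MS) /\ forall x, (U *m arr X x <= U)%MS.

Lemma is_homE X Y (f : 'M[k]_(rd X, rd Y)) : is_hom f ->
  (forall i, idem X i *m f = f *m idem Y i) /\
  (forall x, arr X x *m f = f *m arr Y x).
Proof.
move=> hf; split=> [i|[i []]]; rewrite /arr /=; by have [] := hf i.
Qed.

Lemma is_homI X Y (f : 'M[k]_(rd X, rd Y)) :
  (forall i, idem X i *m f = f *m idem Y i) ->
  (forall x, arr X x *m f = f *m arr Y x) -> is_hom f.
Proof. by move=> h1 h2 i; split=> //; [have := h2 (i, true)|have := h2 (i, false)]. Qed.

Lemma hom_comp X Y Z (f : 'M[k]_(rd X, rd Y)) (g : 'M[k]_(rd Y, rd Z)) :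
  is_hom f -> is_hom g -> is_hom (f *m g).
Proof.
move=> /is_homE[f1 f2] /is_homE[g1 g2].
by apply: is_homI => x; rewrite mulmxA ?f1 ?f2 -mulmxA ?g1 ?g2 mulmxA.
Qed.

Lemma hom0 X Y : is_hom (0 : 'M[k]_(rd X, rd Y)).
Proof. by apply: is_homI => x; rewrite mulmx0 mul0mx. Qed.

Lemma hom1 X : is_hom (1%:M : 'M[k]_(rd X)).
Proof. by apply: is_homI => x; rewrite mulmx1 mul1mx. Qed.

Lemma homD X Y (f g : 'M[k]_(rd X, rd Y)) : is_hom f -> is_hom g -> is_hom (f + g).
Proof.
move=> /is_homE[f1 f2] /is_homE[g1 g2].
by apply: is_homI => x; rewrite mulmxDr mulmxDl ?f1 ?f2 ?g1 ?g2.
Qed.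

Lemma homZ X Y (a : k) (f : 'M[k]_(rd X, rd Y)) : is_hom f -> is_hom (a *: f).
Proof.
move=> /is_homE[f1 f2].
by apply: is_homI => x; rewrite -scalemxAr -scalemxAl ?f1 ?f2.
Qed.

Lemma homN X Y (f : 'M[k]_(rd X, rd Y)) : is_hom f -> is_hom (- f).
Proof. by move=> hf; rewrite -scaleN1r; apply: homZ. Qed.

Lemma homB X Y (f g : 'M[k]_(rd X, rd Y)) : is_hom f -> is_hom g -> is_hom (f - g).
Proof. by move=> hf hg; apply: homD => //; apply: homN. Qed.

Lemma hom_sum X Y (I : Type) (r : seq I) (F : I -> 'M[k]_(rd X, rd Y)) :
  (forall i, is_hom (F i)) -> is_hom (\sum_(i <- r) F i).
Proof.
move=> hF; elim/big_ind: _ => //; [exact: hom0 | exact: homD].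
Qed.

Lemma word_hom X Y (f : 'M[k]_(rd X, rd Y)) s : is_hom f ->
  wordmx X s *m f = f *m wordmx Y s.
Proof.
move=> /is_homE[_ h]; elim: s => [|x s IH] /=; first by rewrite mul1mx mulmx1.
by rewrite -mulmxA IH mulmxA h mulmxA.
Qed.

Lemma wordmx_cat X s t : wordmx X (s ++ t) = wordmx X s *m wordmx X t.
Proof. by elim: s => [|x s IH] /=; rewrite ?mul1mx // IH mulmxA. Qed.

Lemma word_long X N M : (N <= M)%N ->
  (forall s, size s = N -> wordmx X s = 0) -> forall s, size s = M -> wordmx X s = 0.
Proof.
move=> le h s hs; rewrite -(cat_take_drop N s) wordmx_cat h ?mul0mx //.
by rewrite size_takel ?hs.
Qed.

Lemma is_mod_inj X Y (f : 'M[k]_(rd X, rd Y)) :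
  is_hom f -> row_free f -> is_mod Y -> is_mod X.
Proof.
move=> hf ff [[y1 y2 y3 y4 y5] [N y6]]; have [h1 _] := is_homE hf.
have ha i : amx X i *m f = f *m amx Y i by have [] := hf i.
have hb i : bmx X i *m f = f *m bmx Y i by have [] := hf i.
have inj := row_free_inj ff.
split; first split.
- apply: inj; rewrite mulmx_suml mul1mx (eq_bigr _ (fun i _ => h1 i)).
  by rewrite -mulmx_sumr y1 mulmx1.
- move=> i j; apply: inj; rewrite -mulmxA h1 mulmxA h1 -mulmxA y2.
  by case: eqP => // _; rewrite ?h1 // mulmx0 mul0mx.
- by move=> i; apply: inj; rewrite -!mulmxA h1 (mulmxA (amx X i)) ha !mulmxA h1 -!mulmxA
    (mulmxA (idem Y i)) y3.
- by move=> i; apply: inj; rewrite -!mulmxA h1 (mulmxA (bmx X i)) hb !mulmxA h1 -!mulmxA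
    (mulmxA (idem Y _)) y4.
- apply: inj; rewrite mul0mx mulmx_suml -[RHS](mulmx0 _ f) -y5 mulmx_sumr.
  apply: eq_bigr => i _; rewrite mulmxBl mulmxBr -!mulmxA hb ha !mulmxA ha hb.
  by rewrite -!mulmxA.
exists N => s hs; apply: inj; rewrite mul0mx [LHS](word_hom s hf) /wordmx y6 //.
by rewrite mulmx0.
Qed.

(** Two jointly surjective maps serve both quotients ([f1 = f2]) and direct sums (the two
    inclusions). *)
Lemma is_mod_surj2 X1 X2 Y (f1 : 'M[k]_(rd X1, rd Y)) (f2 : 'M[k]_(rd X2, rd Y)) :
  is_hom f1 -> is_hom f2 -> row_full (col_mx f1 f2) -> is_mod X1 -> is_mod X2 -> is_mod Y.
Proof.
move=> hf hg ff [[x1 x2 x3 x4 x5] [N x6]] [[z1 z2 z3 z4 z5] [M z6]].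
have [h1 _] := is_homE hf; have [g1 _] := is_homE hg.
have ha i : amx X1 i *m f1 = f1 *m amx Y i by have [] := hf i.
have hb i : bmx X1 i *m f1 = f1 *m bmx Y i by have [] := hf i.
have ga i : amx X2 i *m f2 = f2 *m amx Y i by have [] := hg i.
have gb i : bmx X2 i *m f2 = f2 *m bmx Y i by have [] := hg i.
have inj p (A B : 'M[k]_(rd Y, p)) : f1 *m A = f1 *m B -> f2 *m A = f2 *m B -> A = B.
  by move=> e1 e2; apply: (row_full_inj ff); rewrite !mul_col_mx e1 e2.
split; first split.
- apply: inj; rewrite mulmx_sumr mulmx1.
    by rewrite -(eq_bigr _ (fun i _ => h1 i)) -mulmx_suml x1 mul1mx.
  by rewrite -(eq_bigr _ (fun i _ => g1 i)) -mulmx_suml z1 mul1mx.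
- move=> i j; apply: inj.
    rewrite mulmxA -h1 -mulmxA -h1 mulmxA x2.
    by case: eqP => // _; rewrite ?h1 // mulmx0 mul0mx.
  rewrite mulmxA -g1 -mulmxA -g1 mulmxA z2.
  by case: eqP => // _; rewrite ?g1 // mulmx0 mul0mx.
- move=> i; apply: inj.
    by rewrite !mulmxA -h1 -(mulmxA _ f1) -ha mulmxA -mulmxA -h1 mulmxA x3 ha.
  by rewrite !mulmxA -g1 -(mulmxA _ f2) -ga mulmxA -mulmxA -g1 mulmxA z3 ga.
- move=> i; apply: inj.
    by rewrite !mulmxA -h1 -(mulmxA _ f1) -hb mulmxA -mulmxA -h1 mulmxA x4 hb.
  by rewrite !mulmxA -g1 -(mulmxA _ f2) -gb mulmxA -mulmxA -g1 mulmxA z4 gb.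
- apply: inj; rewrite mulmx0 mulmx_sumr.
    rewrite -[RHS](mul0mx _ f1) -x5 mulmx_suml.
    by apply: eq_bigr => i _; rewrite mulmxBl mulmxBr -!mulmxA hb ha !mulmxA ha hb.
  rewrite -[RHS](mul0mx _ f2) -z5 mulmx_suml.
  by apply: eq_bigr => i _; rewrite mulmxBl mulmxBr -!mulmxA gb ga !mulmxA ga gb.
exists (maxn N M) => s hs; apply: inj; rewrite mulmx0 -[LHS]word_hom //.
  by rewrite (word_long (leq_maxl N M)) ?mul0mx.
by rewrite (word_long (leq_maxr N M)) ?mul0mx.
Qed.

Lemma is_mod_surj X Y (f : 'M[k]_(rd X, rd Y)) :
  is_hom f -> row_full f -> is_mod X -> is_mod Y.
Proof.
move=> hf ff hX; apply: (is_mod_surj2 hf hf _ hX hX).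
by rewrite -sub1mx -addsmxE (submx_trans _ (addsmxSl f f)) // sub1mx.
Qed.

Lemma is_mod'_inj X Y (f : 'M[k]_(rd X, rd Y)) :
  is_hom f -> row_free f -> is_mod' Y -> is_mod' X.
Proof.
move=> hf ff [h1 h2]; split; first exact: is_mod_inj hf ff h1.
have [h _] := is_homE hf.
by move=> i /h2 e; apply: (row_free_inj ff); rewrite h e mulmx0 mul0mx.
Qed.

Lemma is_mod'_surj X Y (f : 'M[k]_(rd X, rd Y)) :
  is_hom f -> row_full f -> is_mod' X -> is_mod' Y.
Proof.
move=> hf ff [h1 h2]; split; first exact: is_mod_surj hf ff h1.
have [h _] := is_homE hf.
by move=> i /h2 e; apply: (row_full_inj ff); rewrite -h e mulmx0 mul0mx.
Qed.

Lemma stab_hom X Y (f : 'M[k]_(rd X, rd Y)) : is_hom f -> stab f.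
Proof. by move=> /is_homE[h1 h2]; split=> x; rewrite -?h1 -?h2 submxMl. Qed.

Lemma stab_ker X Y (f : 'M[k]_(rd X, rd Y)) : is_hom f -> stab (kermx f).
Proof.
move=> /is_homE[h1 h2].
by split=> x; apply/sub_kermxP; rewrite -mulmxA ?h1 ?h2 mulmxA mulmx_ker mul0mx.
Qed.

Lemma stab_eq X m m' (U : 'M[k]_(m, rd X)) (V : 'M[k]_(m', rd X)) :
  (U :=: V)%MS -> stab U -> stab V.
Proof.
by move=> e [h1 h2]; split=> x; rewrite -e -(eqmxMr _ e).
Qed.

Lemma sub_exists X m (U : 'M[k]_(m, rd X)) : stab U ->
  exists Y, exists f : 'M[k]_(rd Y, rd X), [/\ is_hom f, row_free f & (f :=: U)%MS].
Proof.
move=> sU; have eB := eq_row_base U.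
have [s1 s2] := stab_eq (eqmx_sym eB) sU.
set B := row_base U in eB s1 s2 *.
pose c M := B *m M *m pinvmx B.
exists (@Rep k n _ (fun i => c (idem X i)) (fun i => c (amx X i)) (fun i => c (bmx X i))).
exists B; split=> //; last exact: row_base_free.
by move=> i; split; rewrite /c /= mulmxKpV //; [have := s2 (i, true) | have := s2 (i, false)].
Qed.

(** The column basis of the cokernel matrix is a surjection with kernel [U]; a one-sided inverse of
    it transports the action. *)
Lemma quot_exists X m (U : 'M[k]_(m, rd X)) : stab U ->
  exists Y, exists g : 'M[k]_(rd X, rd Y),
    [/\ is_hom g, row_full g & (kermx g :=: U)%MS].
Proof.
move=> [s1 s2]; pose C := cokermx U; pose g := col_base C.
have fg : row_full g by apply: col_base_full.
have kg p (W : 'M_(p, _)) : (W <= U)%MS = (W *m g == 0).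
  rewrite submxE -/C -{1}(mulmx_base C) mulmxA.
  by rewrite -[_ == 0 in RHS](inj_eq (row_free_inj (row_base_free C))) mul0mx.
have Vg : pinvmx g *m g = 1%:M by apply: mulVpmx.
pose c M := pinvmx g *m M *m g.
have hc M : (U *m M <= U)%MS -> M *m g = g *m c M.
  move=> hM; apply/eqP; rewrite -subr_eq0; apply/eqP.
  have -> : M *m g - g *m c M = (1%:M - g *m pinvmx g) *m M *m g.
    by rewrite !mulmxBl mul1mx /c !mulmxA.
  apply/eqP; rewrite -kg (submx_trans _ hM) // submxMr //.
  by rewrite kg mulmxBl mul1mx -mulmxA Vg mulmx1 subrr.
exists (@Rep k n _ (fun i => c (idem X i)) (fun i => c (amx X i)) (fun i => c (bmx X i))).
exists g; split=> //.
  move=> i; split; rewrite -hc //; [exact: (s2 (i, true)) | exact: (s2 (i, false))].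
apply/eqmxP/andP; split; first by rewrite kg mulmx_ker.
by apply/sub_kermxP/eqP; rewrite -kg.
Qed.

Lemma factor_inj X Y Z m (g : 'M[k]_(rd Y, rd Z)) (f : 'M[k]_(rd X, rd Z))
  (U : 'M[k]_(m, rd Z)) :
  is_hom g -> row_free g -> is_hom f -> (f <= U)%MS -> (g :=: U)%MS ->
  exists2 h : 'M[k]_(rd X, rd Y), is_hom h & h *m g = f.
Proof.
move=> hg fg hf; move=> /[swap] <- le; have hE := mulmxKpV le.
exists (f *m pinvmx g) => //.
have [h1 h2] := is_homE hf; have [g1 g2] := is_homE hg.
apply: is_homI => x; apply: (row_free_inj fg).
  by rewrite -mulmxA hE -[RHS]mulmxA g1 mulmxA hE h1.
by rewrite -mulmxA hE -[RHS]mulmxA g2 mulmxA hE h2.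
Qed.

Lemma factor_surj X Y Z (g : 'M[k]_(rd X, rd Y)) (f : 'M[k]_(rd X, rd Z)) :
  is_hom g -> row_full g -> is_hom f -> kermx g *m f = 0 ->
  exists2 h : 'M[k]_(rd Y, rd Z), is_hom h & f = g *m h.
Proof.
move=> hg fg hf kf.
have e : f = g *m (pinvmx g *m f).
  apply/eqP; rewrite -subr_eq0 mulmxA -[X in X - _]mul1mx -mulmxBl.
  have : ((1%:M - g *m pinvmx g) <= kermx g)%MS.
    by apply/sub_kermxP; rewrite mulmxBl mul1mx -mulmxA mulVpmx // mulmx1 subrr.
  by case/submxP=> D ->; rewrite -mulmxA kf mulmx0.
exists (pinvmx g *m f) => //.
have [h1 h2] := is_homE hf; have [g1 g2] := is_homE hg.
apply: is_homI => x; apply: (row_full_inj fg); rewrite mulmxA.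
  by rewrite -g1 -mulmxA -e h1 mulmxA -e.
by rewrite -g2 -mulmxA -e h2 mulmxA -e.
Qed.

Lemma stab_mulE X m (U : 'M[k]_(m, rd X)) i : is_mod X -> stab U ->
  (U *m idem X i :=: idem X i :&: U)%MS.
Proof.
move=> [[_ h _ _ _] _] [s _]; apply/eqmxP/andP; split.
  by rewrite sub_capmx s submxMl.
have /submxP[D eD] := capmxSl (idem X i) U.
rewrite -{1}[(_ :&: _)%MS]mulmx1.
have -> : (idem X i :&: U)%MS *m 1%:M = (idem X i :&: U)%MS *m idem X i.
  by rewrite mulmx1 {2}eD -mulmxA h eqxx.
by rewrite submxMr // capmxSr.
Qed.

Lemma dimv_quot X Y (g : 'M[k]_(rd X, rd Y)) i : is_mod X -> is_hom g -> row_full g ->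
  dimv X i = (\rank (kermx g *m idem X i) + dimv Y i)%N.
Proof.
move=> hX hg fg; have [h _] := is_homE hg.
rewrite /dimv -(mxrank_mul_ker (idem X i) g) addnC.
by rewrite (stab_mulE i hX (stab_ker hg)) h eqmxMfull.
Qed.

Lemma dimv_sub X Y (f : 'M[k]_(rd Y, rd X)) i : is_hom f -> row_free f ->
  dimv Y i = \rank (f *m idem X i).
Proof.
by move=> hf ff; have [h _] := is_homE hf; rewrite -h mxrankMfree.
Qed.

Lemma dimv_exact X Y Z (f : 'M[k]_(rd Z, rd X)) (g : 'M[k]_(rd X, rd Y)) i :
  is_mod X -> is_hom f -> row_free f -> is_hom g -> row_full g -> (f :=: kermx g)%MS ->
  dimv X i = (dimv Z i + dimv Y i)%N.
Proof.
move=> hX hf ff hg fg e.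
by rewrite (dimv_quot i hX hg fg) (dimv_sub i hf ff) (eqmxMr _ e).
Qed.

Lemma rd_exact X Y Z (f : 'M[k]_(rd Z, rd X)) (g : 'M[k]_(rd X, rd Y)) :
  row_free f -> row_full g -> (f :=: kermx g)%MS -> rd X = (rd Z + rd Y)%N.
Proof.
move=> ff fg e; have := e.1; rewrite mxrank_ker.
have /eqP -> := ff; have /eqP -> := fg => ->; rewrite subnK //.
by have /eqP <- := fg; apply: rank_leq_row.
Qed.

Lemma dimv_iso X Y (f : 'M[k]_(rd X, rd Y)) i : is_hom f -> row_free f -> row_full f ->
  dimv X i = dimv Y i.
Proof. by move=> hf ff fu; rewrite (dimv_sub i hf ff) eqmxMfull. Qed.

Lemma hom_rsumr X Y Z (f : 'M[k]_(rd Z, rd X)) (g : 'M[k]_(rd Z, rd Y)) :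
  is_hom f -> is_hom g -> @is_hom _ _ Z (rsum X Y) (row_mx f g).
Proof.
move=> hf hg i; have [f1 f2 f3] := hf i; have [g1 g2 g3] := hg i.
by split; rewrite /= mul_mx_row mul_row_block !mulmx0 addr0 add0r ?f1 ?f2 ?f3 ?g1 ?g2 ?g3.
Qed.

Lemma hom_rsuml X Y Z (f : 'M[k]_(rd X, rd Z)) (g : 'M[k]_(rd Y, rd Z)) :
  is_hom f -> is_hom g -> @is_hom _ _ (rsum X Y) Z (col_mx f g).
Proof.
move=> hf hg i; have [f1 f2 f3] := hf i; have [g1 g2 g3] := hg i.
by split; rewrite /= mul_block_col mul_col_mx !mul0mx addr0 add0r ?f1 ?f2 ?f3 ?g1 ?g2 ?g3.
Qed.

Definition rin1 X Y : 'M[k]_(rd X, rd (rsum X Y)) := row_mx 1%:M 0.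
Definition rin2 X Y : 'M[k]_(rd Y, rd (rsum X Y)) := row_mx 0 1%:M.
Definition rpr1 X Y : 'M[k]_(rd (rsum X Y), rd X) := col_mx 1%:M 0.
Definition rpr2 X Y : 'M[k]_(rd (rsum X Y), rd Y) := col_mx 0 1%:M.

Lemma hom_rin1 X Y : is_hom (rin1 X Y). Proof. exact: hom_rsumr (hom1 _) (hom0 _ _). Qed.
Lemma hom_rin2 X Y : is_hom (rin2 X Y). Proof. exact: hom_rsumr (hom0 _ _) (hom1 _). Qed.
Lemma hom_rpr1 X Y : is_hom (rpr1 X Y). Proof. exact: hom_rsuml (hom1 _) (hom0 _ _). Qed.
Lemma hom_rpr2 X Y : is_hom (rpr2 X Y). Proof. exact: hom_rsuml (hom0 _ _) (hom1 _). Qed.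

Lemma col_rin X Y : col_mx (rin1 X Y) (rin2 X Y) = 1%:M.
Proof. exact: esym (scalar_mx_block _ _ _). Qed.

Lemma is_mod_rsum X Y : is_mod X -> is_mod Y -> is_mod (rsum X Y).
Proof.
apply: (is_mod_surj2 (hom_rin1 X Y) (hom_rin2 X Y)).
by rewrite col_rin -sub1mx.
Qed.

Lemma is_mod'_rsum X Y : is_mod' X -> is_mod' Y -> is_mod' (rsum X Y).
Proof.
move=> [hX x] [hY y]; split; first exact: is_mod_rsum.
by move=> i hi; rewrite /= x ?y // block_mx0.
Qed.

End Reps.

(** A subspace of maximal dimension inside [P] must be all of [P]. Hom spaces and spaces of chain
    maps become [{vspace}]s in this way and can be counted. *)
Lemma subspace_exists (K : fieldType) (vT : vectType K) (P : vT -> Prop) :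
  P 0 -> (forall a u v, P u -> P v -> P (a *: u + v)) ->
  exists V : {vspace vT}, forall v, v \in V <-> P v.
Proof.
move=> P0 PD.
pose good d := `[< exists2 V : {vspace vT}, (forall v, v \in V -> P v) & \dim V = d >].
have ex : exists d, good d.
  by exists 0%N; apply/asboolP; exists 0%VS => [v|]; rewrite ?dimv0 // memv0 => /eqP ->.
have ub d : good d -> (d <= \dim {:vT})%N.
  by move/asboolP => [V _ <-]; apply/dimvS/subvf.
case: (ex_maxnP ex ub) => d /asboolP[V hV dV] dmax.
exists V => v; split=> [/hV //|Pv]; apply/idPn => nv.
suff : good (\dim (V + <[v]>)%VS).
  move/dmax; rewrite -dV leqNgt => /negP; apply.
  by rewrite (ltnNge (\dim V)) (geq_leqif (dimv_leqif_sup (addvSl V <[v]>%VS)))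
     subv_add subvv /= -memvE.
apply/asboolP; exists (V + <[v]>)%VS => // w /memv_addP[u /hV Pu [_ /vlineP[a ->] ->]].
by rewrite addrC; apply: PD.
Qed.

(** * Dimension of Hom from a projective module *)

Section HomDim.
Variables (k : fieldType) (n : nat).
Implicit Types X Y Z P : rep k n.

Lemma homsp_exists X Y : exists V : {vspace 'M[k]_(rd X, rd Y)},
  forall f, f \in V <-> is_hom f.
Proof.
apply: subspace_exists; first exact: hom0.
by move=> a u v hu hv; apply: homD => //; apply: homZ.
Qed.

Definition homsp X Y := projT1 (cid (homsp_exists X Y)).

Lemma homspP X Y f : f \in homsp X Y <-> is_hom f.
Proof. exact: (projT2 (cid (homsp_exists X Y))). Qed.

Lemma arr_idem X x i : is_mod X ->
  arr X x *m idem X i = if (if x.2 then ordS x.1 else x.1) == i then arr X x else 0.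
Proof.
case=> [[_ h ha hb _] _]; case: x => j [] /=; rewrite /arr /=.
  rewrite -ha -!mulmxA h; case: eqP => [->|_]; rewrite ?mulmx0 //.
rewrite -hb -!mulmxA h; case: eqP => [->|_]; rewrite ?mulmx0 //.
Qed.

Lemma idem_arr X x i : is_mod X ->
  idem X i *m arr X x = if i == (if x.2 then x.1 else ordS x.1) then arr X x else 0.
Proof.
case=> [[_ h ha hb _] _]; case: x => j [] /=; rewrite /arr /=.
  rewrite -ha !mulmxA h; case: eqP => [->|_]; rewrite ?mul0mx //.
rewrite -hb !mulmxA h; case: eqP => [->|_]; rewrite ?mul0mx //.
Qed.

(** By nilpotency there is a non-zero word that every further arrow kills. A non-zero row of it lies
    in the socle, and so does its component at some vertex. *)
Lemma socle_vector X : is_mod X -> (0 < rd X)%N ->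
  exists i, exists v : 'rV[k]_(rd X),
    [/\ v != 0, v *m idem X i = v & forall x, v *m arr X x = 0].
Proof.
move=> hX d0; have [[h1 h2 _ _ _] [N hN]] := hX.
have [s ns hs] : exists2 s, wordmx X s != 0 & forall x, wordmx X (rcons s x) = 0.
  elim: N hN => [|N IH] hN.
    have e1 : (1%:M : 'M[k]_(rd X)) = 0 by rewrite -(hN [::]).
    by have := mxrank1 k (rd X); rewrite e1 mxrank0 => e; rewrite -e in d0.
  have [h|] := EM (forall s, size s = N -> wordmx X s = 0); first exact: IH h.
  move/existsNP=> [s /not_implyP[ss /eqP ns]]; exists s => // x.
  by apply: hN; rewrite size_rcons ss.
have [u nu hu] : exists2 u : 'rV[k]_(rd X), u != 0 & forall x, u *m arr X x = 0.
  have [i ni] : exists i, row i (wordmx X s) != 0.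
    apply/existsP; apply: contra_neqT ns; rewrite negb_exists => /forallP h.
    by apply/row_matrixP => i; rewrite row0; apply/eqP; move: (h i); rewrite negbK.
  exists (row i (wordmx X s)) => // x.
  by rewrite -row_mul; have := hs x; rewrite -cats1 wordmx_cat /= mulmx1 => ->; rewrite row0.
have [i ni] : exists i, u *m idem X i != 0.
  apply/existsP; apply: contra_neqT nu; rewrite negb_exists => /forallP h.
  rewrite -[u]mulmx1 -h1 mulmx_sumr big1 // => i _.
  by apply/eqP; move: (h i); rewrite negbK.
exists i, (u *m idem X i); split=> //; first by rewrite -mulmxA h2 eqxx.
move=> x; rewrite -mulmxA idem_arr //; case: eqP; rewrite ?mulmx0 //.
Qed.

Lemma dim_colker m d (C : 'M[k]_(m, d)) (V : {vspace 'cV[k]_d}) :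
  (forall f, f \in V <-> C *m f = 0) -> \dim V = (d - \rank C)%N.
Proof.
move=> hV; pose B := row_base (kermx C^T).
pose g : 'Hom('rV[k]_(\rank (kermx C^T)), 'cV[k]_d) := linfun (trmx \o mulmxr B).
have gE y : g y = (y *m B)^T by rewrite lfunE.
have -> : V = limg g.
  apply/vspaceP => f; apply/idP/memv_imgP.
    move/hV => e; have : (f^T <= B)%MS.
      by rewrite eq_row_base; apply/sub_kermxP; rewrite -trmx_mul e trmx0.
    by case/submxP => y ey; exists y; rewrite ?memvf // gE -ey trmxK.
  case=> y _ ->; apply/hV; rewrite gE; apply: trmx_inj; rewrite trmx_mul trmxK trmx0.
  apply/sub_kermxP; apply: (submx_trans (submxMl y B)); by rewrite eq_row_base.
have /eqP kg : lker g == 0%VS.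
  apply/lker0P => y y'; rewrite !gE => /trmx_inj.
  exact: (row_free_inj (row_base_free _)).
have := limg_ker_dim g fullv; rewrite kg capv0 dimv0 add0n => ->.
by rewrite dimvf /dim /= mul1n mxrank_ker mxrank_tr.
Qed.

Lemma rank_compl d (e : 'M[k]_d) : e *m e = e -> \rank (1%:M - e) = (d - \rank e)%N.
Proof.
move=> ee; rewrite -mxrank_ker; apply/eqmx_rank/andP; split.
  by apply/sub_kermxP; rewrite mulmxBl mul1mx ee subrr.
have h : kermx e *m e = 0 by apply: mulmx_ker.
by rewrite -[kermx e](subr0) -h -{1}[kermx e]mulmx1 -mulmxBr submxMl.
Qed.

Lemma rad_mul0 X m (f : 'M[k]_(rd X, m)) :
  radsp' X *m f = 0 <-> forall x, arr X x *m f = 0.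
Proof.
split=> [h x|h].
  have : (arr X x <= radsp' X)%MS by rewrite (sumsmx_sup x) // genmxE.
  by case/submxP=> D ->; rewrite -mulmxA h mulmx0.
apply/sub_kermxP/sumsmx_subP => x _; rewrite genmxE; exact/sub_kermxP.
Qed.

Lemma rad_idem X i : is_mod X -> (radsp' X *m idem X i <= radsp' X)%MS.
Proof.
move=> hX; rewrite /radsp' sumsmxMr; apply/sumsmx_subP => x _.
rewrite (eqmxMr _ (genmxE _)) arr_idem //; case: eqP => _; last exact: sub0mx.
by rewrite (sumsmx_sup x) // genmxE.
Qed.

(** A map to the simple module at [i] is a column killed by [1 - e_i] and by the radical; these two
    row spaces, the radical cut down to the vertex [i], are independent, so their ranks add. *)
Lemma dim_hom_simple X W i : is_mod X -> rd W = 1%N ->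
  (forall j, idem W j = (i == j)%:R%:M) -> (forall x, arr W x = 0) ->
  \dim (homsp X W) = topmult X i.
Proof.
case: W => d e a b hX /= ed; subst d => /= he harr.
have [[hX1 hX2 _ _ _] _] := hX.
set W := Rep _ _ _ in harr *.
pose C := col_mx (1%:M - idem X i) (radsp' X).
have -> : topmult X i = (rd X - \rank C)%N.
  pose E := 1%:M - idem X i; pose Q := radsp' X *m idem X i.
  have ii : idem X i *m idem X i = idem X i by rewrite hX2 eqxx.
  have -> : \rank C = (\rank E + \rank Q)%N.
    rewrite -mxrank_disjoint_sum.
      rewrite /C -addsmxE; apply/eqmx_rank/andP; split.
        rewrite addsmx_sub addsmxSl /= -{1}[radsp' X]mulmx1.
        have -> : 1%:M = E + idem X i by rewrite /E subrK.
        rewrite mulmxDr; apply/addmx_sub_adds => //; exact: submxMl.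
      by rewrite addsmx_sub addsmxSl /= (submx_trans (rad_idem i hX)) // addsmxSr.
    apply/eqP; rewrite -submx0; set M := capmx _ _.
    have /submxP[A eA] : (M <= E)%MS by apply: capmxSl.
    have /submxP[B eB] : (M <= idem X i)%MS.
      by apply: submx_trans (capmxSr _ _) _; apply: submxMl.
    suff -> : M = 0 by rewrite sub0mx.
    by rewrite eB -ii mulmxA -eB eA -mulmxA mulmxBl mul1mx ii subrr mulmx0.
  by rewrite rank_compl // /topmult subnDA subKn // rank_leq_row.
apply: dim_colker => f; rewrite mul_col_mx; split.
  move/(@homspP X W f) => hf; have [h1 h2] := is_homE hf.
  have -> : radsp' X *m f = 0 by apply/rad_mul0 => x; rewrite h2 harr mulmx0.
  by rewrite mulmxBl mul1mx h1 /= he eqxx mulmx1 subrr col_mx0.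
move/eqP; rewrite col_mx_eq0 => /andP[/eqP h1 /eqP h2].
have fe : f = idem X i *m f by apply/eqP; rewrite -subr_eq0 -{1}[f]mul1mx -mulmxBl h1.
apply/(@homspP X W f)/is_homI => x; last by rewrite harr mulmx0; exact: (@rad_mul0 X _ f).1 h2 x.
rewrite /= he; have [->|ne] := eqVneq x i; first by rewrite ?eqxx -fe mulmx1.
by rewrite ?(eq_sym i) ?(negbTE ne) {1}fe mulmxA hX2 ?(negbTE ne) mul0mx mul_mx_scalar scale0r.
Qed.

(** Replacing [Y] by the image of [g] makes [g] surjective, and the image is again a Pi'-module. *)
Lemma proj_lift P X Y (g : 'M[k]_(rd X, rd Y)) (f : 'M[k]_(rd P, rd Y)) :
  is_proj' P -> is_mod' X -> is_mod' Y -> is_hom g -> is_hom f -> (f <= g)%MS ->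
  exists2 h : 'M[k]_(rd P, rd X), is_hom h & h *m g = f.
Proof.
move=> [hP lift] hX hY hg hf le.
have [I [i [hi fi ei]]] := sub_exists (stab_hom hg).
have hI : is_mod' I := is_mod'_inj hi fi hY.
have [g' hg' eg] := factor_inj hi fi hg (submx_refl g) ei.
have [f' hf' ef] := factor_inj hi fi hf le ei.
have fg' : row_full g'.
  rewrite -sub1mx; have /submxP[D eD] : (i <= g)%MS by rewrite ei.
  apply/submxP; exists D; apply: (row_free_inj fi).
  by rewrite mul1mx -mulmxA eg.
have [h hh eh] := lift _ _ g' f' hX hI hg' fg' hf'.
by exists h => //; rewrite -eg mulmxA eh.
Qed.

Definition hd P X := (\sum_i topmult P i * dimv X i)%N.

(** Induction along a simple submodule [W] with quotient [Y]: Hom(P, -) is exact on Pi'-modules,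
    both sides are additive, and for [W] the count is the multiplicity in the top of [P]. *)
Lemma dim_homsp P X : is_proj' P -> is_mod' X -> \dim (homsp P X) = hd P X.
Proof.
move=> hP; have [N le] := ubnP (rd X); elim: N X le => // N IH X le hX.
have [d0|d0] := posnP (rd X).
  rewrite /hd big1 => [|i _]; last first.
    suff -> : dimv X i = 0%N by rewrite muln0.
    by apply/eqP; rewrite -leqn0; apply: leq_trans (rank_leq_row _) _; rewrite d0.
  apply/eqP; rewrite -leqn0 (leq_trans (dimvS (subvf _))) //.
  by rewrite dimvf /dim /= d0 muln0.
have [hXm hX'] := hX.
have [i [v [nv ve va]]] := socle_vector hXm d0.
have [[_ hid _ _ _] _] := hXm.
have ve' j : v *m idem X j = (i == j)%:R *: v.
  have [<-|ne] := eqVneq i j; first by rewrite scale1r.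
  by rewrite -{1}ve -mulmxA hid (negbTE ne) mulmx0 scale0r.
have sv : stab v.
  split=> x; last by rewrite va sub0mx.
  by rewrite ve' scalemx_sub.
have [W [f [hf ff ef]]] := sub_exists sv.
have hW : is_mod' W := is_mod'_inj hf ff hX.
have [Y [g [hg fg eg]]] := quot_exists sv.
have hY : is_mod' Y := is_mod'_surj hg fg hX.
have efg : (f :=: kermx g)%MS := eqmx_trans ef (eqmx_sym eg).
have rW : rd W = 1%N.
  have /eqP <- := ff; rewrite ef; apply/eqP; rewrite eqn_leq rank_leq_row /=.
  by rewrite lt0n mxrank_eq0.
have /submxP[D eD] : (f <= v)%MS by rewrite ef.
have [f1 f2] := is_homE hf.
have We j : idem W j = (i == j)%:R%:M.
  apply: (row_free_inj ff); rewrite f1 {1}eD -mulmxA ve' -scalemxAr -eD.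
  by rewrite mul_scalar_mx.
have Wa x : arr W x = 0.
  by apply: (row_free_inj ff); rewrite f2 {1}eD -mulmxA va mulmx0 mul0mx.
have dY : \dim (homsp P Y) = hd P Y.
  apply: IH hY; move: le; rewrite (rd_exact ff fg efg) rW; lia.
have dW : \dim (homsp P W) = hd P W.
  have [hPm _] := hP; rewrite (dim_hom_simple hPm.1 rW We Wa).
  have dW j : dimv W j = (i == j).
    rewrite /dimv We; case: eqP => _; last by rewrite raddf0 mxrank0.
    by rewrite (mxrank1 k (rd W)).
  rewrite /hd (bigD1 i) //= dW eqxx muln1 big1 ?addn0 // => j ne.
  by rewrite dW eq_sym (negbTE ne) muln0.
have -> : hd P X = (hd P W + hd P Y)%N.
  rewrite /hd -big_split; apply: eq_bigr => j _ /=.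
  by rewrite (dimv_exact j hXm hf ff hg fg efg) mulnDr.
rewrite -dW -dY -(limg_ker_dim (linfun (mulmxr g)) (homsp P X)).
congr (_ + _)%N.
  have k0 : (homsp P W :&: lker (linfun (mulmxr f)))%VS = 0%VS.
    apply/eqP; rewrite -subv0; apply/subvP => u; rewrite memv_cap memv0 => /andP[_].
    by rewrite memv_ker lfunE /= => /eqP e; apply/eqP/(row_free_inj ff); rewrite mul0mx.
  rewrite -(limg_dim_eq k0); congr (\dim _); apply/vspaceP => u.
  rewrite memv_cap memv_ker lfunE /=; apply/andP/memv_imgP.
    case=> /homspP hu /eqP e.
    have le' : (u <= v)%MS by rewrite -eg; apply/sub_kermxP.
    have [h hh eh] := factor_inj hf ff hu le' ef.
    by exists h; rewrite ?lfunE //=; apply/homspP.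
  case=> w /homspP hw ->; rewrite lfunE /=; split; first exact/homspP/hom_comp.
  by rewrite -mulmxA (_ : f *m g = 0) ?mulmx0 //; apply/sub_kermxP; rewrite efg.
congr (\dim _); apply/vspaceP => u; apply/memv_imgP/idP.
  by case=> w /homspP hw ->; rewrite lfunE /=; apply/homspP/hom_comp.
move/homspP=> hu; have le' : (u <= g)%MS by rewrite submx_full.
have [h hh eh] := proj_lift hP hX hY hg hu le'.
by exists h; rewrite ?lfunE //=; apply/homspP.
Qed.

End HomDim.

(** * Torsion pairs of two-term complexes *)

Section TwoTermHom.
Variables (k : fieldType) (n : nat).
Implicit Types (X Y Z P : rep k n) (U V : cx k n).

(** Vanishing of Hom(U, X[1]), and below of Hom(U, X), with [X] placed in degree 0. *)
Definition Hom1zero U X := forall phi : 'M[k]_(rd (c1 U), rd X), is_hom phi ->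
  exists2 psi : 'M[k]_(rd (c0 U), rd X), is_hom psi & phi = cd U *m psi.
Definition Hom0zero U X := forall psi : 'M[k]_(rd (c0 U), rd X), is_hom psi ->
  cd U *m psi = 0 -> psi = 0.

Lemma Hom1zero_quot U X Y (g : 'M[k]_(rd X, rd Y)) : valid_cx U -> is_mod' X ->
  is_hom g -> row_full g -> Hom1zero U X -> Hom1zero U Y.
Proof.
move=> [v1 v0 vd] hX hg fg h phi hphi.
have [f hf <-] := proj_lift v1 hX (is_mod'_surj hg fg hX) hg hphi (submx_full _ fg).
by have [psi hpsi ->] := h f hf; exists (psi *m g); rewrite ?mulmxA //; apply: hom_comp.
Qed.

Lemma Hom0zero_sub U X Y (f : 'M[k]_(rd Y, rd X)) :
  is_hom f -> row_free f -> Hom0zero U X -> Hom0zero U Y.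
Proof.
move=> hf ff h psi hpsi e; apply: (row_free_inj ff); rewrite mul0mx; apply: h.
  exact: hom_comp.
by rewrite mulmxA e mul0mx.
Qed.

Lemma imgD U X : is_hom (cd U) ->
  (linfun (mulmx (cd U)) @: homsp (c0 U) X <= homsp (c1 U) X)%VS.
Proof.
move=> hd; apply/subvP => _ /memv_imgP[f /homspP hf ->].
by rewrite lfunE; apply/homspP/hom_comp.
Qed.

Lemma Hom1zeroP U X : is_hom (cd U) ->
  Hom1zero U X <-> (linfun (mulmx (cd U)) @: homsp (c0 U) X)%VS = homsp (c1 U) X.
Proof.
move=> hd; split=> [h|e].
  apply/eqP; rewrite eqEsubv imgD //=; apply/subvP => f /homspP /h[g hg ->].
  by apply/memv_imgP; exists g; rewrite ?lfunE //; apply/homspP.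
move=> f /homspP; rewrite -e => /memv_imgP[g /homspP hg ->].
by exists g; rewrite ?lfunE.
Qed.

Lemma Hom0zeroP U X : is_hom (cd U) ->
  Hom0zero U X <-> (homsp (c0 U) X :&: lker (linfun (mulmx (cd U))))%VS = 0%VS.
Proof.
move=> hd; split=> [h|e].
  apply/eqP; rewrite -subv0; apply/subvP => f; rewrite memv_cap memv_ker lfunE /=.
  by case/andP=> /homspP hf /eqP /(h _ hf) ->; rewrite memv0.
move=> f hf e0; apply/eqP; rewrite -memv0 -e memv_cap memv_ker lfunE /= e0 eqxx andbT.
exact/homspP.
Qed.

Lemma euler_dim U X : valid_cx U -> is_mod' X ->
  hd (c0 U) X = (\dim (homsp (c0 U) X :&: lker (linfun (mulmx (cd U)))) +
                 \dim (linfun (mulmx (cd U)) @: homsp (c0 U) X))%N.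
Proof. by move=> [v1 v0 vd] hX; rewrite limg_ker_dim dim_homsp. Qed.

(** The difference [hd (c0 U) X - hd (c1 U) X] is dim Hom(U, X) - dim Hom(U, X[1]). If the second
    term vanishes the difference is nonnegative, and it is zero only if the first term vanishes
    too. *)
Lemma euler1 U X : valid_cx U -> is_mod' X -> Hom1zero U X ->
  (hd (c1 U) X <= hd (c0 U) X)%N /\ (hd (c0 U) X = hd (c1 U) X -> Hom0zero U X).
Proof.
move=> vU hX; have [v1 v0 vd] := vU => /(Hom1zeroP _ vd) e.
have := euler_dim vU hX; rewrite e dim_homsp // => e2; split; first by rewrite e2 leq_addl.
move=> e3; apply/(Hom0zeroP _ vd)/eqP; rewrite -dimv_eq0; apply/eqP; lia.
Qed.

Lemma euler0 U X : valid_cx U -> is_mod' X -> Hom0zero U X ->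
  (hd (c0 U) X <= hd (c1 U) X)%N /\ (hd (c0 U) X = hd (c1 U) X -> Hom1zero U X).
Proof.
move=> vU hX; have [v1 v0 vd] := vU => /(Hom0zeroP _ vd) e.
have := euler_dim vU hX; rewrite e dimv0 add0n => e2.
have le := imgD X vd.
split; first by rewrite e2 -dim_homsp // dimvS.
move=> e3; apply/(Hom1zeroP _ vd)/eqP; rewrite -(geq_leqif (dimv_leqif_eq le)).
by rewrite -e2 e3 dim_homsp.
Qed.

(* Successively kill the images of the maps from [c0 U] that vanish on [c1 U]. *)
Lemma torsion_quotient U X : valid_cx U -> hom_shift_zero U U -> is_mod' X ->
  exists Y, exists g : 'M[k]_(rd X, rd Y),
    [/\ is_hom g, row_full g, Hom0zero U Y &
     forall phi : 'M[k]_(rd (c1 U), rd X), is_hom phi -> phi *m g = 0 ->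
      exists psi : 'M[k]_(rd (c0 U), rd X),
        [/\ is_hom psi, psi *m g = 0 & phi = cd U *m psi]].
Proof.
move=> vU hU; have [v1 v0 vd] := vU.
have [N le] := ubnP (rd X); elim: N X le => // N IH X le hX.
have [h|] := EM (Hom0zero U X).
  exists X, 1%:M; split; [exact: hom1 | by rewrite -sub1mx | done |].
  move=> phi _; rewrite mulmx1 => ->; exists 0; split; rewrite ?mul0mx ?mulmx0 //.
  exact: hom0.
move/existsNP=> [psi0 /not_implyP[hpsi0 /not_implyP[e0 /eqP n0]]].
have [Q [p [hp fp kp]]] := quot_exists (stab_hom hpsi0).
have hQ : is_mod' Q := is_mod'_surj hp fp hX.
have lt : (rd Q < rd X)%N.
  have := kp.1; rewrite mxrank_ker; have /eqP -> := fp => e.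
  have : (0 < \rank psi0)%N by rewrite lt0n mxrank_eq0.
  by rewrite -e subn_gt0.
have [Y [g' [hg' fg' Y0 lift]]] := IH Q (leq_trans lt le) hQ.
exists Y, (p *m g'); split=> //; first exact: hom_comp.
  by rewrite -sub1mx; apply: submx_full; rewrite /row_full eqmxMfull.
move=> phi hphi ephi.
have [||chi [hchi chig echi]] := lift (phi *m p); rewrite -?mulmxA //; first exact: hom_comp.
have [chi' hchi' echi'] := proj_lift v0 hX hQ hp hchi (submx_full _ fp).
have hr : is_hom (phi - cd U *m chi') by apply: homB => //; apply: hom_comp.
have ler : (phi - cd U *m chi' <= psi0)%MS.
  rewrite -kp; apply/sub_kermxP.
  by rewrite mulmxBl echi -mulmxA echi' subrr.
have [f hf ef] := proj_lift v1 v0.1 hX hpsi0 hr ler.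
(* The remainder is [f] followed by [psi0]. Rigidity writes [f] as [cd U *m h0 + h1 *m cd U], and
   the second summand dies because [cd U *m psi0 = 0]. *)
have [h0 [h1 [hh0 hh1 eh]]] := hU f hf.
have kp0 : psi0 *m p = 0 by apply/sub_kermxP; rewrite kp.
exists (chi' + h0 *m psi0); split.
- by apply: homD => //; apply: hom_comp.
- by rewrite mulmxDl !mulmxA -(mulmxA h0) kp0 mulmx0 mul0mx addr0 echi' chig.
- rewrite mulmxDr mulmxA; apply/eqP; rewrite addrC -subr_eq -ef eh mulmxDl -!mulmxA e0.
  by rewrite mulmx0 addr0.
Qed.

End TwoTermHom.

Section TFmod.
Variables (k : fieldType) (R : realType) (n : nat).
Implicit Types (X Y Z P : rep k n) (U V : cx k n) (th : 'rV[R]_n).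

Lemma pair_eq th (u v : 'I_n -> nat) : u =1 v -> pair th u = pair th v.
Proof. by move=> e; apply: eq_bigr => i _; rewrite e. Qed.

Lemma pairD th (u v : 'I_n -> nat) :
  pair th (fun i => u i + v i)%N = pair th u + pair th v.
Proof. by rewrite /pair -big_split; apply: eq_bigr => i _ /=; rewrite natrD mulrDr. Qed.

Lemma TbarP th X : Tbar th X <-> is_mod X /\
  forall Y (g : 'M[k]_(rd X, rd Y)), is_hom g -> row_full g -> 0 <= pair th (dimv Y).
Proof.
split=> -[hX h]; split=> //.
  move=> Y g hg fg; have := h (kermx g) (stab_ker hg).
  rewrite (@pair_eq _ _ (dimv Y)) // => i.
  by rewrite /subdim mul1mx -/(dimv X i) (dimv_quot i hX hg fg) addKn.
move=> U sU; have [Y [g [hg fg eg]]] := quot_exists sU.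
have := h Y g hg fg; rewrite (@pair_eq _ (dimv Y) (fun i => @subdim _ _ X 1%:M i - subdim U i)%N) // => i.
by rewrite /subdim mul1mx -/(dimv X i) (dimv_quot i hX hg fg) (eqmxMr _ eg) addKn.
Qed.

Lemma FbarP th X : Fbar th X <-> is_mod X /\
  forall Y (f : 'M[k]_(rd Y, rd X)), is_hom f -> row_free f -> pair th (dimv Y) <= 0.
Proof.
split=> -[hX h]; split=> //.
  move=> Y f hf ff.
  have [s1 s2] := stab_hom hf.
  have := h <<f>>%MS (stab_eq (eqmx_sym (genmxE f)) (stab_hom hf)).
  rewrite (@pair_eq _ _ (dimv Y)) // => i.
  by rewrite /subdim (eqmxMr _ (genmxE f)) (dimv_sub i hf ff).
move=> U sU; have [Y [f [hf ff ef]]] := sub_exists sU.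
have := h Y f hf ff; rewrite (@pair_eq _ (dimv Y) (subdim U)) // => i.
by rewrite /subdim (dimv_sub i hf ff) (eqmxMr _ ef).
Qed.

Definition euler U X : R := (hd (c0 U) X)%:R - (hd (c1 U) X)%:R.

(** All that the comparison with torsion pairs needs from a decomposition of [U]: both vanishing
    conditions can be tested on the summands. *)
Definition splits_homs U m (F : 'I_m -> cx k n) := [/\ forall i, valid_cx (F i),
  forall X, is_mod' X -> Hom1zero U X <-> (forall i, Hom1zero (F i) X) &
  forall X, is_mod' X -> Hom0zero U X <-> (forall i, Hom0zero (F i) X)].

Section Tchar.
Variables (U : cx k n) (m : nat) (F : 'I_m -> cx k n) (c : 'I_m -> R) (th : 'rV[R]_n).
Hypotheses (vU : valid_cx U) (hU : hom_shift_zero U U) (hF : splits_homs U F).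
Hypothesis c_gt0 : forall i, 0 < c i.
Hypothesis th_euler : forall X, is_mod' X -> pair th (dimv X) = \sum_i c i * euler (F i) X.

Let euler_ge0 i X : is_mod' X -> Hom1zero (F i) X -> 0 <= euler (F i) X.
Proof.
move=> hX h; rewrite subr_ge0 ler_nat; have [vF _ _] := hF.
exact: (euler1 (vF i) hX h).1.
Qed.

Let euler_le0 i X : is_mod' X -> Hom0zero (F i) X -> euler (F i) X <= 0.
Proof.
move=> hX h; rewrite subr_le0 ler_nat; have [vF _ _] := hF.
exact: (euler0 (vF i) hX h).1.
Qed.

(** Let [Y] be the torsionfree quotient of [X]. Then theta(Y) is nonnegative since [X] is in Tbar,
    and nonpositive since every Euler form on [Y] is. So all Euler forms vanish, Hom(U, Y[1]) = 0,
    and factorizations over [Y] lift to [X]. *)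
Lemma Tbar_presilt X : is_mod' X -> Tbar th X <-> Hom1zero U X.
Proof.
move=> hX; have [vF F1 F0] := hF; have [v1 v0 vd] := vU; split; last first.
  move=> h; apply/TbarP; split; first exact: hX.1.
  move=> Y g hg fg; have hY := is_mod'_surj hg fg hX.
  rewrite th_euler //; apply: sumr_ge0 => i _; apply: mulr_ge0; first exact: ltW.
  apply: euler_ge0 => //; have /(F1 _ hY) := Hom1zero_quot vU hX hg fg h; exact.
move=> /TbarP[_ h]; have [Y [g [hg fg Y0 lift]]] := torsion_quotient vU hU hX.
have hY := is_mod'_surj hg fg hX.
have Y0' : forall i, Hom0zero (F i) Y by apply/(F0 _ hY).
have pY : pair th (dimv Y) = 0.
  apply/eqP; rewrite eq_le (h _ g) // andbT th_euler //; apply: sumr_le0 => i _.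
  by rewrite pmulr_rle0 //; apply: euler_le0.
have Y1 : Hom1zero U Y.
  apply/(F1 _ hY) => i; apply: (euler0 (vF i) hY (Y0' i)).2.
  move/eqP: pY; rewrite th_euler // -oppr_eq0 -sumrN psumr_eq0 => [|j _]; last first.
    by rewrite oppr_ge0 pmulr_rle0 //; apply: euler_le0.
  move/allP => /(_ i (mem_index_enum _)) /=; rewrite oppr_eq0 mulf_eq0 gt_eqF //=.
  by rewrite subr_eq0 eqr_nat => /eqP.
move=> phi hphi; have [|chi hchi echi] := Y1 (phi *m g); first exact: hom_comp.
have [chi' hchi' echi'] := proj_lift v0 hX hY hg hchi (submx_full _ fg).
have [||psi [hpsi _ epsi]] := lift (phi - cd U *m chi').
- by apply: homB => //; apply: hom_comp.
- by rewrite mulmxBl -mulmxA echi' echi subrr.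
exists (chi' + psi); first exact: homD.
by rewrite mulmxDr -epsi addrC subrK.
Qed.

(** Dual argument with the kernel [W] of the map to the torsionfree quotient: it is torsion, so
    theta(W) = 0 and Hom(U, W) = 0, while every map from [U] to [X] lands in [W]. *)
Lemma Fbar_presilt X : is_mod' X -> Fbar th X <-> Hom0zero U X.
Proof.
move=> hX; have [vF F1 F0] := hF; have [v1 v0 vd] := vU; split; last first.
  move=> h; apply/FbarP; split; first exact: hX.1.
  move=> Y f hf ff; have hY := is_mod'_inj hf ff hX.
  rewrite th_euler //; apply: sumr_le0 => i _; rewrite pmulr_rle0 //.
  apply: euler_le0 => //; have /(F0 _ hY) := Hom0zero_sub hf ff h; exact.
move=> /FbarP[_ h]; have [Y [g [hg fg Y0 lift]]] := torsion_quotient vU hU hX.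
have [W [f [hf ff ef]]] := sub_exists (stab_ker hg).
have hW := is_mod'_inj hf ff hX.
have W1 : Hom1zero U W.
  move=> phi hphi; have [||psi [hpsi psig epsi]] := lift (phi *m f).
  - exact: hom_comp.
  - by rewrite -mulmxA (_ : f *m g = 0) ?mulmx0 //; apply/sub_kermxP; rewrite ef.
  have le : (psi <= kermx g)%MS by apply/sub_kermxP.
  have [psi' hpsi' epsi'] := factor_inj hf ff hpsi le ef.
  by exists psi' => //; apply: (row_free_inj ff); rewrite -mulmxA epsi'.
have W1' : forall i, Hom1zero (F i) W by apply/(F1 _ hW).
have pW : pair th (dimv W) = 0.
  apply/eqP; rewrite eq_le (h _ f) //= th_euler //; apply: sumr_ge0 => i _.
  by rewrite pmulr_rge0 //; apply: euler_ge0.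
have W0 : Hom0zero U W.
  apply/(F0 _ hW) => i; apply: (euler1 (vF i) hW (W1' i)).2.
  move/eqP: pW; rewrite th_euler // psumr_eq0 => [|j _]; last first.
    by rewrite pmulr_rge0 //; apply: euler_ge0.
  move/allP => /(_ i (mem_index_enum _)) /=; rewrite mulf_eq0 gt_eqF //=.
  by rewrite subr_eq0 eqr_nat => /eqP.
move=> psi hpsi e; have e1 : psi *m g = 0.
  by apply: Y0; [exact: hom_comp | rewrite mulmxA e mul0mx].
have le : (psi <= kermx g)%MS by apply/sub_kermxP.
have [psi' hpsi' epsi'] := factor_inj hf ff hpsi le ef.
rewrite -epsi' (W0 psi') ?mul0mx //; apply: (row_free_inj ff).
by rewrite mul0mx -mulmxA epsi'.
Qed.

End Tchar.

Lemma pair_iota X (v : 'rV[R]_n) : is_mod' X ->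
  pair (Defs.iota v) (dimv X) = \sum_i v 0 i * (dimv X i)%:R.
Proof.
move=> [_ h]; apply: eq_bigr => i _; rewrite /Defs.iota !mxE.
case: (boolP (is_last i)) => hi; last by rewrite mulr0 subr0.
by rewrite /dimv h // mxrank0 !mulr0.
Qed.

Lemma pair_cxclass X U : \sum_i (cxclass R U) 0 i * (dimv X i)%:R = euler U X.
Proof.
rewrite /euler /hd !natr_sum -sumrB; apply: eq_bigr => i _.
by rewrite /cxclass /pclass !mxE mulrBl !natrM.
Qed.

End TFmod.

(** * The homotopy category of two-term complexes *)

Section Homotopy.
Variables (k : fieldType) (n : nat).
Implicit Types (X Y : rep k n) (U V W T : cx k n).

Local Notation cmap U V :=
  ('M[k]_(rd (c1 U), rd (c1 V)) * 'M[k]_(rd (c0 U), rd (c0 V)))%type.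

Definition ccomp U V W (a : cmap U V) (b : cmap V W) : cmap U W :=
  (a.1 *m b.1, a.2 *m b.2).
Definition chain_id U : cmap U U := (1%:M, 1%:M).
Definition chain U V (a : cmap U V) := is_chain a.1 a.2.
Definition nullh U V (a : cmap U V) :=
  exists2 h : 'M[k]_(rd (c0 U), rd (c1 V)), is_hom h &
    a.1 = cd U *m h /\ a.2 = h *m cd V.
Definition heq U V (a b : cmap U V) := nullh (a - b).

Lemma ccompA U V W T (a : cmap U V) (b : cmap V W) (c : cmap W T) :
  ccomp a (ccomp b c) = ccomp (ccomp a b) c.
Proof. by rewrite /ccomp /= !mulmxA. Qed.

Lemma ccompDl U V W (a a' : cmap U V) (b : cmap V W) :
  ccomp (a + a') b = ccomp a b + ccomp a' b.
Proof. by rewrite /ccomp /= !mulmxDl. Qed.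

Lemma ccompDr U V W (a : cmap U V) (b b' : cmap V W) :
  ccomp a (b + b') = ccomp a b + ccomp a b'.
Proof. by rewrite /ccomp /= !mulmxDr. Qed.

Lemma ccompNl U V W (a : cmap U V) (b : cmap V W) : ccomp (- a) b = - ccomp a b.
Proof. by rewrite /ccomp /= !mulNmx. Qed.

Lemma ccompNr U V W (a : cmap U V) (b : cmap V W) : ccomp a (- b) = - ccomp a b.
Proof. by rewrite /ccomp /= !mulmxN. Qed.

Lemma ccompBl U V W (a a' : cmap U V) (b : cmap V W) :
  ccomp (a - a') b = ccomp a b - ccomp a' b.
Proof. by rewrite ccompDl ccompNl. Qed.

Lemma ccompBr U V W (a : cmap U V) (b b' : cmap V W) :
  ccomp a (b - b') = ccomp a b - ccomp a b'.
Proof. by rewrite ccompDr ccompNr. Qed.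

Lemma ccomp0l U V W (b : cmap V W) : ccomp (0 : cmap U V) b = 0.
Proof. by rewrite /ccomp /= !mul0mx. Qed.

Lemma ccomp0r U V W (a : cmap U V) : ccomp a (0 : cmap V W) = 0.
Proof. by rewrite /ccomp /= !mulmx0. Qed.

Lemma ccomp1l U V (a : cmap U V) : ccomp (chain_id U) a = a.
Proof. by case: a => a b; rewrite /ccomp /= !mul1mx. Qed.

Lemma ccomp1r U V (a : cmap U V) : ccomp a (chain_id V) = a.
Proof. by case: a => a b; rewrite /ccomp /= !mulmx1. Qed.

Lemma ccomp_suml U V W (I : Type) (r : seq I) (F : I -> cmap U V) (b : cmap V W) :
  ccomp (\sum_(i <- r) F i) b = \sum_(i <- r) ccomp (F i) b.
Proof.
by apply: (big_morph (fun a => ccomp a b)); [move=> x y; apply: ccompDl | apply: ccomp0l].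
Qed.

Lemma ccomp_sumr U V W (I : Type) (r : seq I) (a : cmap U V) (F : I -> cmap V W) :
  ccomp a (\sum_(i <- r) F i) = \sum_(i <- r) ccomp a (F i).
Proof. by apply: (big_morph (ccomp a)); [move=> x y; apply: ccompDr | apply: ccomp0r]. Qed.

Lemma chain0 U V : chain (0 : cmap U V).
Proof. by split; rewrite /= ?mulmx0 ?mul0mx //; apply: hom0. Qed.

Lemma chain1 U : chain (chain_id U).
Proof. by split; rewrite /= ?mulmx1 ?mul1mx //; apply: hom1. Qed.

Lemma chainD U V (a b : cmap U V) : chain a -> chain b -> chain (a + b).
Proof.
case=> a1 a0 ac [b1 b0 bc]; split; [exact: homD | exact: homD |].
by rewrite /= mulmxDl mulmxDr ac bc.
Qed.

Lemma chainZ U V (x : k) (a : cmap U V) : chain a -> chain (x *: a).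
Proof.
case=> a1 a0 ac; split; [exact: homZ | exact: homZ |].
by rewrite /= -scalemxAl -scalemxAr ac.
Qed.

Lemma chainN U V (a : cmap U V) : chain a -> chain (- a).
Proof. by move=> h; rewrite -scaleN1r; apply: chainZ. Qed.

Lemma chainB U V (a b : cmap U V) : chain a -> chain b -> chain (a - b).
Proof. by move=> ha hb; apply: chainD => //; apply: chainN. Qed.

Lemma chain_sum U V (I : Type) (r : seq I) (F : I -> cmap U V) :
  (forall i, chain (F i)) -> chain (\sum_(i <- r) F i).
Proof. by move=> h; elim/big_ind: _ => //; [exact: chain0 | exact: chainD]. Qed.

Lemma chain_comp U V W (a : cmap U V) (b : cmap V W) :
  chain a -> chain b -> chain (ccomp a b).
Proof.
case=> a1 a0 ac [b1 b0 bc]; split; [exact: hom_comp | exact: hom_comp |].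
by rewrite /= mulmxA ac -mulmxA bc mulmxA.
Qed.

Lemma null0 U V : nullh (0 : cmap U V).
Proof. by exists 0; rewrite /= ?mulmx0 ?mul0mx //; apply: hom0. Qed.

Lemma nullD U V (a b : cmap U V) : nullh a -> nullh b -> nullh (a + b).
Proof.
case=> h hh [ha1 ha0] [g hg [hb1 hb0]]; exists (h + g); first exact: homD.
by rewrite /= mulmxDl mulmxDr ha1 ha0 hb1 hb0.
Qed.

Lemma nullN U V (a : cmap U V) : nullh a -> nullh (- a).
Proof.
case=> h hh [ha1 ha0]; exists (- h); first exact: homN.
by rewrite /= mulmxN mulNmx ha1 ha0.
Qed.

Lemma null_sum U V (I : eqType) (r : seq I) (P : pred I) (F : I -> cmap U V) :
  (forall i, P i -> nullh (F i)) -> nullh (\sum_(i <- r | P i) F i).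
Proof. by move=> h; elim/big_ind: _ => //; [exact: null0 | exact: nullD]. Qed.

Lemma null_compl U V W (a : cmap U V) (b : cmap V W) :
  chain a -> nullh b -> nullh (ccomp a b).
Proof.
case=> a1 a0 ac [h hh [b1 b0]]; exists (a.2 *m h); first exact: hom_comp.
by rewrite /= b1 b0 !mulmxA ac.
Qed.

Lemma null_compr U V W (a : cmap U V) (b : cmap V W) :
  nullh a -> chain b -> nullh (ccomp a b).
Proof.
case=> h hh [a1 a0] [b1 b0 bc]; exists (h *m b.1); first exact: hom_comp.
by rewrite /= a1 a0 -!mulmxA bc.
Qed.

Lemma heq_refl U V (a : cmap U V) : heq a a.
Proof. by rewrite /heq subrr; apply: null0. Qed.

Lemma heq_sym U V (a b : cmap U V) : heq a b -> heq b a.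
Proof. by move=> h; rewrite /heq -opprB; apply: nullN. Qed.

Lemma heq_trans U V (a b c : cmap U V) : heq a b -> heq b c -> heq a c.
Proof. by move=> h g; rewrite /heq -(subrK b a) -addrA; apply: nullD. Qed.

Lemma heq_compl U V W (a : cmap U V) (b b' : cmap V W) :
  chain a -> heq b b' -> heq (ccomp a b) (ccomp a b').
Proof. by move=> ha h; rewrite /heq -ccompBr; apply: null_compl. Qed.

Lemma heq_compr U V W (a a' : cmap U V) (b : cmap V W) :
  chain b -> heq a a' -> heq (ccomp a b) (ccomp a' b).
Proof. by move=> hb h; rewrite /heq -ccompBl; apply: null_compr. Qed.

Lemma heq0 U V (a : cmap U V) : nullh a <-> heq a 0.
Proof. by rewrite /heq subr0. Qed.

Lemma heq_null U V (a b : cmap U V) : heq a b -> nullh b -> nullh a.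
Proof. by move=> h /heq0 g; apply/heq0; apply: heq_trans h g. Qed.

Lemma cxisoP U V : cxiso U V <-> exists a : cmap U V, exists b : cmap V U,
  [/\ chain a, chain b, heq (ccomp a b) (chain_id U) & heq (ccomp b a) (chain_id V)].
Proof.
split=> [[a1 [a0 [b1 [b0 [h1 h2 h3 h4]]]]]|[a [b [h1 h2 h3 h4]]]].
  by exists (a1, a0), (b1, b0).
by exists a.1, a.2, b.1, b.2.
Qed.

Lemma cxiso_refl U : cxiso U U.
Proof.
apply/cxisoP; exists (chain_id U), (chain_id U).
by split; rewrite ?ccomp1l //; [exact: chain1 | exact: chain1 | exact: heq_refl..].
Qed.

Lemma cxiso_sym U V : cxiso U V -> cxiso V U.
Proof. by move=> /cxisoP[a [b [h1 h2 h3 h4]]]; apply/cxisoP; exists b, a. Qed.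

Lemma ccomp_inv U V W (a : cmap U V) (b : cmap V U) (c : cmap V W) (d : cmap W V) :
  chain a -> chain b -> heq (ccomp a b) (chain_id U) -> heq (ccomp c d) (chain_id V) ->
  heq (ccomp (ccomp a c) (ccomp d b)) (chain_id U).
Proof.
move=> ha hb e1 e2; rewrite -ccompA (ccompA c).
apply: heq_trans e1; apply: heq_compl => //.
rewrite -[X in heq _ X]ccomp1l; exact: heq_compr.
Qed.

Lemma cxiso_trans U V W : cxiso U V -> cxiso V W -> cxiso U W.
Proof.
move=> /cxisoP[a [b [h1 h2 h3 h4]]] /cxisoP[c [d [g1 g2 g3 g4]]].
apply/cxisoP; exists (ccomp a c), (ccomp d b); split; try exact: chain_comp.
  exact: ccomp_inv.
exact: ccomp_inv.
Qed.

Definition retract V U := exists a : cmap V U, exists b : cmap U V,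
  [/\ chain a, chain b & heq (ccomp a b) (chain_id V)].

Lemma retract_iso U V : cxiso U V -> retract U V.
Proof. by move=> /cxisoP[a [b [h1 h2 h3 h4]]]; exists a, b. Qed.

Lemma retract_trans U V W : retract U V -> retract V W -> retract U W.
Proof.
move=> [a [b [h1 h2 h3]]] [c [d [g1 g2 g3]]].
by exists (ccomp a c), (ccomp d b); split; try exact: chain_comp; apply: ccomp_inv.
Qed.

Lemma Hom1zero_retract U V X : retract V U -> valid_cx V -> Hom1zero U X -> Hom1zero V X.
Proof.
move=> [a [b [[a1 a0 ac] [b1 b0 bc] [h hh [e1 e0]]]]] vV H phi hphi.
have [|psi hpsi e] := H (b.1 *m phi); first exact: hom_comp.
exists (a.2 *m psi - h *m phi); first by apply: homB; apply: hom_comp.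
have := congr1 (mulmx^~ phi) e1; rewrite /= mulmxBl mul1mx => e2.
rewrite mulmxBr !mulmxA ac -[_ *m cd U *m psi]mulmxA -e mulmxA -e2.
by rewrite opprB addrC subrK.
Qed.

Lemma Hom0zero_retract U V X : retract V U -> Hom0zero U X -> Hom0zero V X.
Proof.
move=> [a [b [[a1 a0 ac] [b1 b0 bc] [h hh [e1 e0]]]]] H psi hpsi e.
have z : b.2 *m psi = 0.
  by apply: H; [exact: hom_comp | rewrite mulmxA bc -mulmxA e mulmx0].
have : (a.2 *m b.2 - 1%:M) *m psi = 0.
  by rewrite [X in X *m _]e0 -mulmxA e mulmx0.
by rewrite mulmxBl mul1mx -mulmxA z mulmx0 sub0r => /eqP; rewrite oppr_eq0 => /eqP.
Qed.

(** The biproduct identities are required only up to homotopy, so that they pass along [cxiso]. *)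
Definition biproduct U m (F : 'I_m -> cx k n) :=
  exists (a : forall i, cmap (F i) U) (b : forall i, cmap U (F i)),
  [/\ (forall i, chain (a i)), (forall i, chain (b i)),
      (forall i, heq (ccomp (a i) (b i)) (chain_id (F i))),
      (forall i j, i != j -> nullh (ccomp (a i) (b j))) &
      heq (\sum_i ccomp (b i) (a i)) (chain_id U)].

Lemma biproduct_iso U V m (F : 'I_m -> cx k n) :
  cxiso U V -> biproduct V F -> biproduct U F.
Proof.
move=> /cxisoP[f [g [h1 h2 h3 h4]]] [a [b [a1 b1 ab1 ab0 ba]]].
exists (fun i => ccomp (a i) g), (fun i => ccomp f (b i)); split.
- by move=> i; apply: chain_comp.
- by move=> i; apply: chain_comp.
- by move=> i; apply: ccomp_inv.
- move=> i j ne; rewrite -ccompA (ccompA g); apply: heq_null (ab0 i j ne).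
  apply: heq_compl => //; rewrite -[X in heq _ X]ccomp1l; exact: heq_compr.
- rewrite (eq_bigr (fun i => ccomp f (ccomp (ccomp (b i) (a i)) g))); last first.
    by move=> i _; rewrite !ccompA.
  rewrite -ccomp_sumr -ccomp_suml; apply: heq_trans h3; apply: heq_compl => //.
  by rewrite -[X in heq _ X]ccomp1l; apply: heq_compr.
Qed.

Lemma biproduct_retract U m (F : 'I_m -> cx k n) i : biproduct U F -> retract (F i) U.
Proof. by move=> [a [b [a1 b1 ab1 _ _]]]; exists (a i), (b i). Qed.

Lemma biproduct_splits U m (F : 'I_m -> cx k n) :
  valid_cx U -> (forall i, valid_cx (F i)) -> biproduct U F -> splits_homs U F.
Proof.
move=> vU vF bU; have [a [b [a1 b1 ab1 _ [h hh [e1 e0]]]]] := bU.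
have sum1 (I : Type) (r : seq I) (G : I -> cmap U U) : (\sum_(i <- r) G i).1 = \sum_(i <- r) (G i).1.
  exact: (big_morph fst).
have sum2 (I : Type) (r : seq I) (G : I -> cmap U U) : (\sum_(i <- r) G i).2 = \sum_(i <- r) (G i).2.
  exact: (big_morph snd).
split=> // X hX; split=> H.
- by move=> i; apply: Hom1zero_retract (biproduct_retract i bU) (vF i) H.
- move=> phi hphi.
  have /fin_all_exists2[psi hpsi epsi] : forall i, exists2 psi : 'M[k]_(rd (c0 (F i)), rd X),
      is_hom psi & (a i).1 *m phi = cd (F i) *m psi.
    by move=> i; apply: H; apply: hom_comp => //; have [] := a1 i.
  exists (\sum_i (b i).2 *m psi i - h *m phi).
    apply: homB; last exact: hom_comp.
    by apply: hom_sum => i; apply: hom_comp => //; have [] := b1 i.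
  rewrite mulmxBr mulmxA -e1 /= sum1 mulmxBl mul1mx mulmx_sumr mulmx_suml opprB addrC.
  rewrite -[LHS]addr0 -[X in _ = _ - X + _]subr0 -addrA; congr (_ + _).
  rewrite subr0 addrC; apply/esym/eqP; rewrite subr_eq0; apply/eqP/eq_bigr => i _ /=.
  by rewrite -mulmxA epsi !mulmxA; have [_ _ ->] := b1 i.
- by move=> i; apply: Hom0zero_retract (biproduct_retract i bU) H.
move=> psi hpsi e.
have z i : (a i).2 *m psi = 0.
  have [c1 c0 c] := a1 i; apply: H; first exact: hom_comp.
  by rewrite mulmxA c -mulmxA e mulmx0.
have : ((\sum_i ccomp (b i) (a i)).2 - 1%:M) *m psi = 0.
  by rewrite [X in X *m _]e0 -mulmxA e mulmx0.
rewrite sum2 mulmxBl mul1mx mulmx_suml big1 => [|i _]; last by rewrite /= -mulmxA z mulmx0.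
by rewrite sub0r => /eqP; rewrite oppr_eq0 => /eqP.
Qed.

(** Pairwise non-isomorphic summands make the matching [s] a bijection, and the isomorphisms between
    matched summands add up to one of [U] with [V]. *)
Lemma biproduct_match U V m p (F : 'I_m -> cx k n) (G : 'I_p -> cx k n) :
  biproduct U F -> biproduct V G ->
  (forall i, exists j, cxiso (F i) (G j)) -> (forall j, exists i, cxiso (G j) (F i)) ->
  (forall i i', i <> i' -> ~ cxiso (F i) (F i')) ->
  (forall j j', j <> j' -> ~ cxiso (G j) (G j')) -> cxiso U V.
Proof.
move=> [a [b [a1 b1 ab1 ab0 ba]]] [c [d [hc hd cd1 cd0 dc]]].
move=> /fin_all_exists[s hs] FG nF nG.
have si : injective s.
  move=> i i' e; case: (eqVneq i i') => // /eqP /nF[].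
  by apply: cxiso_trans (hs i) _; rewrite e; apply/cxiso_sym.
have /fin_all_exists[r hr] j : exists i, s i = j.
  have [i hi] := FG j; exists i; case: (eqVneq (s i) j) => // /eqP /nG[].
  by apply: cxiso_sym; apply: cxiso_trans hi (hs i).
have /fin_all_exists[f hf] : forall i, exists f : cmap (F i) (G (s i)),
    exists g : cmap (G (s i)) (F i),
    [/\ chain f, chain g, heq (ccomp f g) (chain_id _) & heq (ccomp g f) (chain_id _)].
  by move=> i; apply/cxisoP.
have /fin_all_exists[g hg] := hf.
have chb i : chain (ccomp (b i) (f i)) by apply: chain_comp => //; have [] := hg i.
have chc i : chain (ccomp (f i) (c (s i))) by apply: chain_comp => //; have [] := hg i.
have chd i : chain (ccomp (d (s i)) (g i)) by apply: chain_comp => //; have [] := hg i.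
apply/cxisoP; exists (\sum_i ccomp (b i) (ccomp (f i) (c (s i)))).
exists (\sum_i ccomp (d (s i)) (ccomp (g i) (a i))); split.
- by apply: chain_sum => i; apply: chain_comp.
- by apply: chain_sum => i; rewrite ccompA; apply: chain_comp.
- apply: heq_trans ba; rewrite ccomp_suml /heq -sumrB; apply: null_sum => i _.
  rewrite ccomp_sumr (bigD1 i) //= addrAC; apply: nullD.
    rewrite -/(heq _ _) -!ccompA; apply: heq_compl => //.
    rewrite -[X in heq _ X]ccomp1l !ccompA; apply: heq_compr => //.
    have [h1 h2 h3 h4] := hg i.
    rewrite -(ccompA (f i)) -[X in heq X _]ccompA; apply: heq_trans h3.
    apply: heq_compl => //; rewrite -[X in heq _ X]ccomp1l.
    exact: heq_compr.
  apply: null_sum => j ne; rewrite -!ccompA; apply: null_compl => //.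
  have [h1 h2 h3 h4] := hg i; apply: null_compl => //.
  rewrite ccompA; apply: null_compr; last first.
    by apply: chain_comp => //; have [] := hg j.
  by apply: cd0; apply: contra_neq ne => /si.
apply: heq_trans dc.
rewrite [X in heq _ X](reindex s) /=; last first.
  by apply: onW_bij; exists r => // i; apply: si; rewrite hr.
rewrite ccomp_suml /heq -sumrB; apply: null_sum => i _.
rewrite ccomp_sumr (bigD1 i) //= addrAC; have [h1 h2 h3 h4] := hg i; apply: nullD.
  rewrite -/(heq _ _) -!ccompA; apply: heq_compl => //.
  rewrite -[X in heq _ X]ccomp1l !ccompA; apply: heq_compr => //.
  rewrite -(ccompA (g i)) -[X in heq X _]ccompA; apply: heq_trans h4.
  apply: heq_compl => //; rewrite -[X in heq _ X]ccomp1l.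
  exact: heq_compr.
apply: null_sum => j ne; rewrite -!ccompA; apply: null_compl => //.
apply: null_compl => //; rewrite ccompA; apply: null_compr => //.
by apply: ab0; rewrite eq_sym.
Qed.

Definition cin1 U V : cmap U (cxsum U V) := (rin1 _ _, rin1 _ _).
Definition cin2 U V : cmap V (cxsum U V) := (rin2 _ _, rin2 _ _).
Definition cpr1 U V : cmap (cxsum U V) U := (rpr1 _ _, rpr1 _ _).
Definition cpr2 U V : cmap (cxsum U V) V := (rpr2 _ _, rpr2 _ _).

Lemma chain_in1 U V : chain (cin1 U V).
Proof.
split; [exact: hom_rin1 | exact: hom_rin1 |].
by rewrite /= /rin1 /= mul_row_block mul_mx_row !mulmx0 !mul0mx !mul1mx mulmx1 !addr0.
Qed.

Lemma chain_in2 U V : chain (cin2 U V).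
Proof.
split; [exact: hom_rin2 | exact: hom_rin2 |].
by rewrite /= /rin2 /= mul_row_block mul_mx_row !mulmx0 !mul0mx !mul1mx mulmx1 !add0r.
Qed.

Lemma chain_pr1 U V : chain (cpr1 U V).
Proof.
split; [exact: hom_rpr1 | exact: hom_rpr1 |].
by rewrite /= /rpr1 /= mul_block_col mul_col_mx !mulmx0 ?mul0mx mul1mx mulmx1 !addr0 ?mul0mx.
Qed.

Lemma chain_pr2 U V : chain (cpr2 U V).
Proof.
split; [exact: hom_rpr2 | exact: hom_rpr2 |].
by rewrite /= /rpr2 /= mul_block_col mul_col_mx !mulmx0 ?mul0mx mul1mx mulmx1 !add0r ?mul0mx.
Qed.

Lemma cin_pr U V : [/\ ccomp (cin1 U V) (cpr1 U V) = chain_id U,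
  ccomp (cin2 U V) (cpr2 U V) = chain_id V, ccomp (cin1 U V) (cpr2 U V) = 0,
  ccomp (cin2 U V) (cpr1 U V) = 0 &
  ccomp (cpr1 U V) (cin1 U V) + ccomp (cpr2 U V) (cin2 U V) = chain_id (cxsum U V)].
Proof.
split; rewrite /ccomp /= /rin1 /rin2 /rpr1 /rpr2 /=.
- by rewrite !mul_row_col !mulmx1 !mulmx0 !addr0.
- by rewrite !mul_row_col !mulmx1 !mulmx0 !add0r.
- by rewrite !mul_row_col !mulmx0 !mul0mx !add0r.
- by rewrite !mul_row_col !mulmx0 !mul0mx !add0r.
congr (_, _) => /=.
  by rewrite !mul_col_row !mulmx1 !mulmx0 ?mul0mx add_block_mx !addr0 !add0r -scalar_mx_block.
by rewrite !mul_col_row !mulmx1 !mulmx0 ?mul0mx add_block_mx !addr0 !add0r -scalar_mx_block.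
Qed.

Notation cxsums := (foldr (@cxsum k n) (cxzero k n)).

Fixpoint sin Us i : cmap (nth (cxzero k n) Us i) (cxsums Us) :=
  match Us return cmap (nth (cxzero k n) Us i) (cxsums Us) with
  | [::] => 0
  | U :: Us' => match i return cmap (nth (cxzero k n) (U :: Us') i) _ with
    | 0 => cin1 U (cxsums Us')
    | i'.+1 => ccomp (sin Us' i') (cin2 U (cxsums Us'))
    end
  end.

Fixpoint spr Us i : cmap (cxsums Us) (nth (cxzero k n) Us i) :=
  match Us return cmap (cxsums Us) (nth (cxzero k n) Us i) with
  | [::] => 0
  | U :: Us' => match i return cmap _ (nth (cxzero k n) (U :: Us') i) with
    | 0 => cpr1 U (cxsums Us')
    | i'.+1 => ccomp (cpr2 U (cxsums Us')) (spr Us' i')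
    end
  end.

Lemma biproduct_cxsums Us : biproduct (cxsums Us) (fun i : 'I_(size Us) => nth (cxzero k n) Us i).
Proof.
exists (fun i : 'I_(size Us) => sin Us i), (fun i : 'I_(size Us) => spr Us i); split.
- move=> [i /= _]; elim: Us i => [|U Us IH] [|i] /=; try exact: chain0; first exact: chain_in1.
  by apply: chain_comp; [apply: IH | apply: chain_in2].
- move=> [i /= _]; elim: Us i => [|U Us IH] [|i] /=; try exact: chain0; first exact: chain_pr1.
  by apply: chain_comp; [apply: chain_pr2 | apply: IH].
- move=> [i /= le]; suff -> : ccomp (sin Us i) (spr Us i) = chain_id _ by apply: heq_refl.
  elim: Us i le => [|U Us IH] [|i] //= le; have [e1 e2 _ _ _] := cin_pr U (cxsums Us) => //.
  by rewrite -ccompA (ccompA (cin2 _ _)) e2 ccomp1l IH.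
- move=> [i /= lei] [j /= lej]; rewrite -val_eqE /= => ne.
  suff -> : ccomp (sin Us i) (spr Us j) = 0 by apply: null0.
  elim: Us i j lei lej ne => [|U Us IH] [|i] [|j] //= lei lej ne;
    have [e1 e2 e3 e4 _] := cin_pr U (cxsums Us).
  + by rewrite ccompA e3 ccomp0l.
  + by rewrite -ccompA e4 ccomp0r.
  by rewrite -ccompA (ccompA (cin2 _ _)) e2 ccomp1l IH.
suff -> : \sum_(i < size Us) ccomp (spr Us i) (sin Us i) = chain_id (cxsums Us) by apply: heq_refl.
elim: Us => [|U Us IH] /=; first by rewrite big_ord0; congr (_, _); rewrite flatmx0; apply: flatmx0.
rewrite big_ord_recl /=; have [_ _ _ _ <-] := cin_pr U (cxsums Us); congr (_ + _).
rewrite -[in RHS](ccomp1l (cin2 _ _)) -IH ccomp_suml ccomp_sumr; apply: eq_bigr => i _.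
by rewrite !ccompA.
Qed.

Lemma cx_decomp_biproduct U Us : cx_decomp U Us ->
  biproduct U (fun i : 'I_(size Us) => nth (cxzero k n) Us i).
Proof. by case=> _ e; apply: biproduct_iso e (biproduct_cxsums Us). Qed.

Lemma cx_decomp_iso U V Us : cxiso U V -> cx_decomp V Us -> cx_decomp U Us.
Proof. by move=> e [h e']; split=> //; apply: cxiso_trans e e'. Qed.

End Homotopy.

(** * Approximations, Fitting's lemma and Krull-Schmidt *)

Section Uniqueness.
Variables (k : fieldType) (n : nat).
Implicit Types (X Y P Q : rep k n) (U V W G : cx k n).

Local Notation cmap U V :=
  ('M[k]_(rd (c1 U), rd (c1 V)) * 'M[k]_(rd (c0 U), rd (c0 V)))%type.

Lemma is_proj'_rsum P Q : is_proj' P -> is_proj' Q -> is_proj' (rsum P Q).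
Proof.
move=> [hP lP] [hQ lQ]; split; first exact: is_mod'_rsum.
move=> M N g f hM hN hg fg hf.
have [u hu eu] := lP M N g (rin1 P Q *m f) hM hN hg fg (hom_comp (hom_rin1 P Q) hf).
have [v hv ev] := lQ M N g (rin2 P Q *m f) hM hN hg fg (hom_comp (hom_rin2 P Q) hf).
exists (col_mx u v); first exact: hom_rsuml.
by rewrite mul_col_mx eu ev -mul_col_mx col_rin mul1mx.
Qed.

Lemma is_mod'_rzero : is_mod' (rzero k n).
Proof.
split=> [|i _]; last exact: flatmx0.
split; first by split=> *; rewrite [LHS]flatmx0 ?[RHS]flatmx0.
by exists 0%N => s _; apply: flatmx0.
Qed.

Lemma is_proj'_rzero : is_proj' (rzero k n).
Proof.
split; first exact: is_mod'_rzero.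
move=> M N g f _ _ _ _ _; exists 0; first exact: hom0.
by rewrite mul0mx (flatmx0 f).
Qed.

Lemma is_proj'_retract P Q (u : 'M[k]_(rd Q, rd P)) (v : 'M[k]_(rd P, rd Q)) :
  is_proj' P -> is_hom u -> is_hom v -> u *m v = 1%:M -> is_proj' Q.
Proof.
move=> [hP lP] hu hv uv; split.
  by apply: is_mod'_inj hu _ hP; apply/row_freeP; exists v.
move=> M N g f hM hN hg fg hf.
have [h hh eh] := lP M N g (v *m f) hM hN hg fg (hom_comp hv hf).
exists (u *m h); first exact: hom_comp.
by rewrite -mulmxA eh mulmxA uv mul1mx.
Qed.

Lemma valid_cxzero : valid_cx (cxzero k n).
Proof. by split; [exact: is_proj'_rzero | exact: is_proj'_rzero | exact: hom0]. Qed.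

Lemma valid_cxsum U V : valid_cx U -> valid_cx V -> valid_cx (cxsum U V).
Proof.
move=> [u1 u0 ud] [v1 v0 vd]; split; [exact: is_proj'_rsum | exact: is_proj'_rsum |].
have := @hom_rsuml _ _ (c1 U) (c1 V) (rsum (c0 U) (c0 V)) _ _
  (hom_comp ud (hom_rin1 _ _)) (hom_comp vd (hom_rin2 _ _)).
by rewrite /rin1 /rin2 !mul_mx_row !mulmx1 !mulmx0 .
Qed.

Lemma row_rpr X P Q (e : 'M[k]_(rd X, rd (rsum P Q))) :
  e = row_mx (e *m rpr1 P Q) (e *m rpr2 P Q).
Proof.
rewrite -mul_mx_row (_ : row_mx _ _ = 1%:M) ?mulmx1 //.
have := @hsubmxK k (rd P + rd Q) (rd P) (rd Q) 1%:M.
by rewrite /rpr1 /rpr2 scalar_mx_block block_mxEh row_mxKl row_mxKr.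
Qed.

Lemma hom_shift_zero_sumr U V W :
  hom_shift_zero U V -> hom_shift_zero U W -> hom_shift_zero U (cxsum V W).
Proof.
move=> hV hW phi hphi.
have [a0 [a1 [ha0 ha1 ea]]] := hV _ (hom_comp hphi (hom_rpr1 (c0 V) (c0 W))).
have [b0 [b1 [hb0 hb1 eb]]] := hW _ (hom_comp hphi (hom_rpr2 (c0 V) (c0 W))).
exists (row_mx a0 b0), (row_mx a1 b1); split; [exact: hom_rsumr | exact: hom_rsumr |].
rewrite [LHS]row_rpr ea eb /= mul_mx_row mul_row_block !mulmx0 addr0 add0r.
by rewrite add_row_mx.
Qed.

Lemma hom_shift_zero_suml U V W :
  hom_shift_zero V U -> hom_shift_zero W U -> hom_shift_zero (cxsum V W) U.
Proof.
move=> hV hW phi hphi.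
have [a0 [a1 [ha0 ha1 ea]]] := hV _ (hom_comp (hom_rin1 (c1 V) (c1 W)) hphi).
have [b0 [b1 [hb0 hb1 eb]]] := hW _ (hom_comp (hom_rin2 (c1 V) (c1 W)) hphi).
exists (col_mx a0 b0), (col_mx a1 b1); split; [exact: hom_rsuml | exact: hom_rsuml |].
rewrite -[LHS]mul1mx -col_rin mul_col_mx ea eb /= mul_block_col !mul0mx addr0 add0r.
by rewrite mul_col_mx add_col_mx.
Qed.

Lemma hom_shift_zero_0l U : hom_shift_zero (cxzero k n) U.
Proof.
move=> phi _; exists 0, 0; split; [exact: hom0 | exact: hom0 |].
by rewrite [LHS]flatmx0 [RHS]flatmx0.
Qed.

Lemma hom_shift_zero_0r U : hom_shift_zero U (cxzero k n).
Proof.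
move=> phi _; exists 0, 0; split; [exact: hom0 | exact: hom0 |].
by rewrite [LHS]thinmx0 [RHS]thinmx0.
Qed.

(** [G] is the direct sum of copies of [U] indexed by [fs]. The list [l] of projections and
    inclusions, which writes the identity of [G] as a sum of maps through [U], records that [G] lies
    in add(U). *)
Lemma list_approximation U V (fs : seq (cmap U V)) :
  valid_cx U -> hom_shift_zero U U -> (forall f, f \in fs -> chain f) ->
  exists G (g : cmap G V) (l : seq (cmap G U * cmap U G)),
  [/\ [/\ valid_cx G, hom_shift_zero U G & chain g],
      (forall f, f \in fs -> exists2 psi : cmap U G, chain psi & f = ccomp psi g),
      (forall x, x \in l -> chain x.1 /\ chain x.2) &
      \sum_(x <- l) ccomp x.1 x.2 = chain_id G].
Proof.
move=> vU hU; elim: fs => [|f fs IH] hfs.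
  exists (cxzero k n), 0, [::]; split=> //.
    by split; [exact: valid_cxzero | exact: hom_shift_zero_0r | exact: chain0].
  by rewrite big_nil; congr (_, _); rewrite [LHS]flatmx0 [RHS]flatmx0.
have [x xfs|G [g [l [[vG hG cg] hl cl el]]]] := IH.
  by apply: hfs; rewrite inE xfs orbT.
have cf : chain f by apply: hfs; rewrite mem_head.
have [e1 e2 e3 e4 e5] := cin_pr U G.
exists (cxsum U G), (ccomp (cpr1 U G) f + ccomp (cpr2 U G) g).
exists ((cpr1 U G, cin1 U G) :: [seq (ccomp (cpr2 U G) x.1, ccomp x.2 (cin2 U G)) | x <- l]).
split.
- split; [exact: valid_cxsum | exact: hom_shift_zero_sumr |].
  by apply: chainD; apply: chain_comp => //; [exact: chain_pr1 | exact: chain_pr2].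
- move=> x; rewrite inE => /predU1P[->|/hl[psi hpsi ->]].
    exists (cin1 U G); first exact: chain_in1.
    by rewrite ccompDr !ccompA e1 e3 ccomp1l ccomp0l addr0.
  exists (ccomp psi (cin2 U G)); first by apply: chain_comp => //; apply: chain_in2.
  by rewrite -ccompA ccompDr !(ccompA (cin2 _ _)) e2 e4 ccomp1l ccomp0l add0r.
- move=> x; rewrite inE => /predU1P[-> /=|/mapP[y /cl[y1 y2] -> /=]].
    by split; [exact: chain_pr1 | exact: chain_in1].
  by split; apply: chain_comp => //; [exact: chain_pr2 | exact: chain_in2].
rewrite big_cons big_map /= -e5; congr (_ + _).
rewrite -[in RHS](ccomp1l (cin2 _ _)) -el ccomp_suml ccomp_sumr; apply: eq_bigr => i _.
by rewrite !ccompA.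
Qed.

Lemma approximation U V : valid_cx U -> hom_shift_zero U U ->
  exists G (g : cmap G V) (l : seq (cmap G U * cmap U G)),
  [/\ [/\ valid_cx G, hom_shift_zero U G & chain g],
      (forall f, chain f -> exists2 psi : cmap U G, chain psi & f = ccomp psi g),
      (forall x, x \in l -> chain x.1 /\ chain x.2) &
      \sum_(x <- l) ccomp x.1 x.2 = chain_id G].
Proof.
move=> vU hU.
have [S hS] : exists S : {vspace (cmap U V)}, forall f, f \in S <-> chain f.
  apply: subspace_exists; first exact: chain0.
  by move=> a u v hu hv; apply: chainD => //; apply: chainZ.
have [f /vbasis_mem/hS //|G [g [l [hG hg hl el]]]] := @list_approximation U V (vbasis S) vU hU.
exists G, g, l; split=> // f /hS/coord_vbasis ->.
have /fin_all_exists2[psi hpsi epsi] (i : 'I_(\dim S)) :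
    exists2 psi : cmap U G, chain psi & (vbasis S)`_i = ccomp psi g.
  by apply: hg; apply: mem_nth; rewrite size_tuple.
exists (\sum_i coord (vbasis S) i f *: psi i).
  by apply: chain_sum => i; apply: chainZ.
rewrite ccomp_suml; apply: eq_bigr => i _; rewrite epsi /ccomp /=.
by rewrite -!scalemxAl.
Qed.

(* With g : G -> V a right add(U)-approximation, the cohomology of its cone in
   degrees 0 and -1 (Y and X below) lies in the torsionfree, resp. torsion,
   class of U.  If V has the same classes then Hom(V, cone g) = 0, so the
   identity of V factors through g. *)
Lemma retract_of_sum U V : valid_cx U -> valid_cx V -> hom_shift_zero U U ->
  (forall X, is_mod' X -> Hom1zero U X -> Hom1zero V X) ->
  (forall X, is_mod' X -> Hom0zero U X -> Hom0zero V X) ->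
  exists l : seq (cmap V U * cmap U V),
    (forall x, x \in l -> chain x.1 /\ chain x.2) /\
    heq (\sum_(x <- l) ccomp x.1 x.2) (chain_id V).
Proof.
move=> vU vV hU UV1 UV0; have [u1 u0 ud] := vU; have [v1 v0 vd] := vV.
have [G [g [l [[[G1 G0 Gd] hG [hg1 hg0 hg]] appr hl el]]]] := @approximation U V vU hU.
suff [phi cphi ephi] : exists2 phi : cmap V G, chain phi & heq (ccomp phi g) (chain_id V).
  exists [seq (ccomp phi x.1, ccomp x.2 g) | x <- l]; split.
    by move=> x /mapP[y /hl[y1 y2] ->]; split; apply: chain_comp.
  rewrite big_map (eq_bigr (fun x => ccomp phi (ccomp (ccomp x.1 x.2) g))); last first.
    by move=> x _; rewrite /= !ccompA.
  by rewrite -ccomp_sumr -ccomp_suml el ccomp1l.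
(* The cone of [g] is c1 G --ga--> E --c--> c0 V, with [ga] defined below. *)
pose E := rsum (c0 G) (c1 V).
pose c : 'M[k]_(rd E, rd (c0 V)) := col_mx g.2 (cd V).
have hc : is_hom c by apply: hom_rsuml.
have hE : is_mod' E by apply: is_mod'_rsum; [exact: G0.1 | exact: v1.1].
have cE X (e : 'M[k]_(rd X, rd E)) : e *m c = e *m rpr1 _ _ *m g.2 + e *m rpr2 _ _ *m cd V.
  by rewrite {1}(row_rpr e) mul_row_col.
(* The cokernel [Y] of [c] is torsionfree for [U], hence for [V]; but the projection of c0 V onto
   [Y] is a map from [V] to [Y], so [Y] is zero. *)
have fc : row_full c.
  have [Y [p [hp fp kp]]] := quot_exists (stab_hom hc).
  have hY := is_mod'_surj hp fp v0.1.
  have cp : c *m p = 0 by apply/sub_kermxP; rewrite kp.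
  have /eqP : col_mx (g.2 *m p) (cd V *m p) = 0 by rewrite -mul_col_mx.
  rewrite col_mx_eq0 => /andP[/eqP gp /eqP dp].
  have Y0 : Hom0zero U Y.
    move=> psi hpsi epsi.
    have [f hf ef] := proj_lift u0 v0.1 hY hp hpsi (submx_full _ fp).
    have hdf : is_hom (cd U *m f) by apply: hom_comp.
    have le : (cd U *m f <= c)%MS by rewrite -kp; apply/sub_kermxP; rewrite -mulmxA ef.
    have [e he ee] := proj_lift u1 hE v0.1 hc hdf le.
    have [h0 [h1 [hh0 hh1 eh]]] := hG _ (hom_comp he (hom_rpr1 _ _)).
    have [|psi' [p1 p0 pc] /(congr1 snd) /= e2] :=
        appr (h1 *m g.1 + e *m rpr2 _ _, f - h0 *m g.2).
      split=> /=.
      - exact: homD (hom_comp hh1 hg1) (hom_comp he (hom_rpr2 _ _)).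
      - exact: homB hf (hom_comp hh0 hg0).
      rewrite mulmxBr mulmxDl -ee cE eh mulmxDl !mulmxA -[h1 *m cd G *m _]mulmxA hg.
      by rewrite !mulmxA [LHS]addrC addrA addrA addNr add0r.
    have -> : psi = (psi'.2 *m g.2 + h0 *m g.2) *m p by rewrite -e2 subrK ef.
    by rewrite mulmxDl -!mulmxA gp !mulmx0 addr0.
  have p0 := UV0 Y hY Y0 p hp dp.
  by rewrite -sub1mx -kp; apply/sub_kermxP; rewrite p0 mulmx0.
pose ga : 'M[k]_(rd (c1 G), rd E) := row_mx (cd G) (- g.1).
have hga : is_hom ga by apply: hom_rsumr => //; apply: homN.
have gac : ga *m c = 0 by rewrite mul_row_col hg mulNmx subrr.
have [E' [p [hp fp kp]]] := quot_exists (stab_hom hga).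
have hE' := is_mod'_surj hp fp hE.
have gap : ga *m p = 0 by apply/sub_kermxP; rewrite kp.
have [|c' hc' ec'] := factor_surj hp fp hc.
  by have /submxP[D ->] : (kermx p <= ga)%MS by [rewrite kp]; rewrite -mulmxA gac mulmx0.
have [X [z [hz fz ez]]] := sub_exists (stab_ker hc').
have hX := is_mod'_inj hz fz hE'.
have zc : z *m c' = 0 by apply/sub_kermxP; rewrite ez.
(* A map from c1 U to [X] lifts to [E]. Rigidity turns the component in c0 G into a boundary, and
   the approximation property absorbs the component in c1 V. *)
have X1 : Hom1zero U X.
  move=> phi hphi.
  have [f hf ef] := proj_lift u1 hE hE' hp (hom_comp hphi hz) (submx_full _ fp).
  have fc0 : f *m rpr1 _ _ *m g.2 + f *m rpr2 _ _ *m cd V = 0.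
    by rewrite -cE ec' mulmxA ef -mulmxA zc mulmx0.
  have [h0 [h1 [hh0 hh1 eh]]] := hG _ (hom_comp hf (hom_rpr1 _ _)).
  pose f1 := f *m rpr2 _ _ + h1 *m g.1.
  have [|psi [p1 p0 pc] epsi] := appr (- f1, h0 *m g.2).
    split=> /=.
    - exact: homN (homD (hom_comp hf (hom_rpr2 _ _)) (hom_comp hh1 hg1)).
    - exact: hom_comp hh0 hg0.
    apply/eqP; rewrite mulNmx -addr_eq0 /f1 mulmxDl -[_ *m g.1 *m cd V]mulmxA -hg !mulmxA.
    by rewrite addrCA -mulmxDl -eh addrC fc0.
  have e1 : psi.1 *m g.1 = - f1 by have := congr1 fst epsi.
  have e2 : psi.2 *m g.2 = h0 *m g.2 by have := congr1 snd epsi.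
  pose w : 'M[k]_(rd (c0 U), rd E) := row_mx (h0 - psi.2) 0.
  have hw : is_hom w by apply: hom_rsumr; [apply: homB | apply: hom0].
  have ew : f = (h1 + psi.1) *m ga + cd U *m w.
    rewrite [LHS]row_rpr eh /ga /w !mul_mx_row add_row_mx mulmx0 addr0; congr row_mx.
      by rewrite mulmxBr mulmxDl pc addrC addrA addrAC addrK addrC.
    by rewrite mulmxN mulmxDl e1 /f1 opprB addrK.
  have wp : (w *m p <= kermx c')%MS.
    apply/sub_kermxP; rewrite -mulmxA -ec' mul_row_col mul0mx addr0 mulmxBl e2.
    by rewrite subrr.
  have [w' hw' ew'] := factor_inj hz fz (hom_comp hw hp) wp ez.
  exists w' => //; apply: (row_free_inj fz).
  by rewrite -ef ew mulmxDl -!mulmxA gap mulmx0 add0r -ew'.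
have V1 := UV1 X hX X1.
(* [s] splits [c], but it fails to contract the map from [V] to the cone by [u], which has values in
   the kernel of [c]. Since Hom(V, X[1]) = 0, the correction [t'] removes this defect modulo the
   image of [ga]. *)
have [s hs es] := proj_lift v0 hE v0.1 hc (hom1 _) (submx_full _ fc).
pose u := cd V *m s - rin2 (c0 G) (c1 V).
have hu : is_hom u by apply: homB; [apply: hom_comp | apply: hom_rin2].
have uc : u *m c = 0.
  by rewrite mulmxBl -mulmxA es mulmx1 /rin2 mul_row_col mul0mx mul1mx add0r subrr.
have upc : (u *m p <= kermx c')%MS by apply/sub_kermxP; rewrite -mulmxA -ec'.
have [u' hu' eu'] := factor_inj hz fz (hom_comp hu hp) upc ez.
have [t ht et] := V1 u' hu'.
have [t' ht' et'] := proj_lift v0 hE hE' hp (hom_comp ht hz) (submx_full _ fp).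
have hr : is_hom (u - cd V *m t') by apply: homB => //; apply: hom_comp.
have le : (u - cd V *m t' <= ga)%MS.
  rewrite -kp; apply/sub_kermxP.
  by rewrite mulmxBl -eu' et -[X in _ - X]mulmxA et' mulmxA subrr.
have [phi1 hphi1 ephi1] := proj_lift v1 G1.1 hE hga hr le.
pose s' := s - t'.
have hs' : is_hom s' by apply: homB.
have ephi : phi1 *m ga = cd V *m s' - rin2 (c0 G) (c1 V).
  by rewrite ephi1 /u mulmxBr addrAC.
have [ea eb] : phi1 *m cd G = cd V *m (s' *m rpr1 _ _) /\
               - (phi1 *m g.1) = cd V *m (s' *m rpr2 _ _) - 1%:M.
  move: ephi; rewrite {1}(row_rpr s') /ga /rin2 !mul_mx_row opp_row_mx add_row_mx.
  by rewrite subr0 mulmxN => /eq_row_mx.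
exists (phi1, s' *m rpr1 _ _).
  by split=> //=; apply: hom_comp hs' (hom_rpr1 _ _).
exists (- (s' *m rpr2 _ _)); first exact: homN (hom_comp hs' (hom_rpr2 _ _)).
split; rewrite /=.
  rewrite mulmxN (_ : cd V *m (s' *m rpr2 _ _) = 1%:M - phi1 *m g.1) ?opprB //.
  by rewrite addrC eb subrK.
have : s' *m c = 1%:M by rewrite mulmxBl es ec' mulmxA et' -mulmxA zc mulmx0 subr0.
by rewrite cE mulNmx => <-; rewrite opprD addrA subrr add0r.
Qed.

Lemma hom_inv X Y (f : 'M[k]_(rd X, rd Y)) : is_hom f -> row_free f -> row_full f ->
  exists g : 'M[k]_(rd Y, rd X), [/\ is_hom g, f *m g = 1%:M & g *m f = 1%:M].
Proof.
move=> hf ff fu; have e1 := mulmxVp ff; have e2 := mulVpmx fu.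
exists (pinvmx f); split=> //; move: (pinvmx f) e1 e2 => p e1 e2.
have [h1 h2] := is_homE hf.
apply: is_homI => x; apply: (row_free_inj ff).
  by rewrite -!mulmxA e2 mulmx1 h1 mulmxA e2 mul1mx.
by rewrite -!mulmxA e2 mulmx1 h2 mulmxA e2 mul1mx.
Qed.

Definition is_iso V (f : cmap V V) := exists g : cmap V V,
  [/\ chain g, heq (ccomp f g) (chain_id V) & heq (ccomp g f) (chain_id V)].

Fixpoint cpow V (f : cmap V V) N := if N is N'.+1 then ccomp f (cpow f N') else chain_id V.

Lemma chain_pow V (f : cmap V V) N : chain f -> chain (cpow f N).
Proof. by move=> hf; elim: N => [|N IH] /=; [exact: chain1 | exact: chain_comp]. Qed.

Lemma cpowD V (f : cmap V V) N M : cpow f (N + M) = ccomp (cpow f N) (cpow f M).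
Proof. by elim: N => [|N IH]; rewrite ?ccomp1l //= IH ccompA. Qed.

Lemma cx_is_zeroP V : cx_is_zero V <-> nullh (chain_id V).
Proof.
split.
  move=> /cxisoP[a [b [ha hb /heq_sym e _]]]; apply: heq_null e _.
  have -> : a = 0; last by rewrite ccomp0l; apply: null0.
  by case: a {ha} => a1 a0; congr (_, _); apply: thinmx0.
move=> h; apply/cxisoP; exists 0, 0; split; try exact: chain0.
  by rewrite ccomp0l; apply: heq_sym; rewrite /heq subr0.
have -> : ccomp (0 : cmap (cxzero k n) V) 0 = chain_id (cxzero k n); last exact: heq_refl.
by rewrite /ccomp /chain_id; congr (_, _); rewrite [LHS]flatmx0 [RHS]flatmx0.
Qed.

(* rank h = rank h^2, so the module is the direct sum of image and kernel. *)
Lemma image_kernel_split X (h : 'M[k]_(rd X)) : is_hom h -> \rank (h *m h) = \rank h ->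
  exists I (i : 'M[k]_(rd I, rd X)) K (j : 'M[k]_(rd K, rd X)),
  [/\ [/\ is_hom i, row_free i & (i :=: h)%MS], [/\ is_hom j, row_free j & (j :=: kermx h)%MS],
      row_free (col_mx i j) & row_full (col_mx i j)].
Proof.
move=> hh rh; have [I [i [hi fi ei]]] := sub_exists (stab_hom hh).
have [K [j [hj fj ej]]] := sub_exists (stab_ker hh).
have rij : \rank (col_mx i j) = rd X.
  rewrite -addsmxE (adds_eqmx ei ej) mxrank_disjoint_sum.
    by rewrite mxrank_ker subnKC ?rank_leq_row.
  apply/eqP; rewrite -mxrank_eq0; have := mxrank_mul_ker h h; rewrite rh; lia.
exists I, i, K, j; split=> //; last by rewrite /row_full rij.
rewrite /row_free rij; have /eqP <- := fi; have /eqP <- := fj.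
by rewrite ei ej mxrank_ker subnKC ?rank_leq_row.
Qed.

(** Image and kernel of [h], taken in both degrees, are subcomplexes with direct sum [V], and their
    terms are projective as retracts. One of them is contractible: if the image, [h] is null; if the
    kernel, [h] is invertible because it is so on its image. *)
Lemma fitting_iso_or_null V (h : cmap V V) : valid_cx V -> cx_indec V -> chain h ->
  \rank (h.1 *m h.1) = \rank h.1 -> \rank (h.2 *m h.2) = \rank h.2 ->
  is_iso h \/ nullh h.
Proof.
move=> [v1 v0 vd] [_ indec] [h1 h0 hc] r1 r0.
have [I1 [i1 [K1 [j1 [[hi1 fi1 ei1] [hj1 fj1 ej1] fr1 fu1]]]]] := image_kernel_split h1 r1.
have [I0 [i0 [K0 [j0 [[hi0 fi0 ei0] [hj0 fj0 ej0] fr0 fu0]]]]] := image_kernel_split h0 r0.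
have [|dI hdI edI] := factor_inj hi0 fi0 (hom_comp hi1 vd) _ ei0.
  have le1 : (i1 *m cd V <= h.1 *m cd V)%MS by rewrite submxMr // ei1.
  by apply: submx_trans le1 _; rewrite -hc submxMl.
have [|dK hdK edK] := factor_inj hj0 fj0 (hom_comp hj1 vd) _ ej0.
  apply/sub_kermxP; rewrite -mulmxA hc mulmxA (_ : j1 *m h.1 = 0) ?mul0mx //.
  by apply/sub_kermxP; rewrite ej1.
have [a1 [ha1 ba1 ab1]] := hom_inv (hom_rsuml hi1 hj1) fr1 fu1.
have [a0 [ha0 ba0 ab0]] := hom_inv (hom_rsuml hi0 hj0) fr0 fu0.
pose CI := @Cx k n I1 I0 dI; pose CK := @Cx k n K1 K0 dK.
pose b : cmap (cxsum CI CK) V := (col_mx i1 j1, col_mx i0 j0).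
pose a : cmap V (cxsum CI CK) := (a1, a0).
have cb : chain b.
  split; [exact: hom_rsuml | exact: hom_rsuml |].
  by rewrite /= mul_block_col mul_col_mx !mul0mx addr0 add0r edI edK.
have ca : chain a.
  split=> //=; rewrite -[LHS]mul1mx -[1%:M]ab1 -[LHS]mulmxA; congr (_ *m _).
  have [_ _ /= e] := cb; rewrite mulmxA -e -mulmxA [X in _ *m X](_ : _ = 1%:M) ?mulmx1 //.
have ab : ccomp a b = chain_id V by congr (_, _).
have ba : ccomp b a = chain_id (cxsum CI CK) by congr (_, _).
have [e1 e2 e3 e4 e5] := cin_pr CI CK.
pose i : cmap CI V := (i1, i0).
have ci : chain i by [].
have iE : i = ccomp (cin1 CI CK) b.
  by congr (_, _); rewrite /= /rin1 mul_row_col mul0mx mul1mx addr0.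
pose pI := ccomp a (cpr1 CI CK).
have cpI : chain pI by apply: chain_comp => //; apply: chain_pr1.
have ipI : ccomp i pI = chain_id CI by rewrite iE /pI -ccompA (ccompA b) ba ccomp1l.
pose j := ccomp (cin2 CI CK) b; pose pK := ccomp a (cpr2 CI CK).
have cj : chain j by apply: chain_comp => //; apply: chain_in2.
have cpK : chain pK by apply: chain_comp => //; apply: chain_pr2.
have jpK : ccomp j pK = chain_id CK by rewrite /j /pK -ccompA (ccompA b) ba ccomp1l.
have pij : ccomp pI i + ccomp pK j = chain_id V.
  rewrite iE /pI /pK /j -!ccompA -ccompDr !ccompA -ccompDl.
  by rewrite e5 ccomp1l ab.
have vCI : valid_cx CI.
  split=> //=.
  - apply: (@is_proj'_retract _ _ i.1 pI.1 v1) => //; first by have [] := cpI.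
    by have := congr1 fst ipI.
  apply: (@is_proj'_retract _ _ i.2 pI.2 v0) => //; first by have [] := cpI.
  by have := congr1 snd ipI.
have vCK : valid_cx CK.
  split=> //=.
  - apply: (@is_proj'_retract _ _ j.1 pK.1 v1); [by have [] := cj | by have [] := cpK |].
    by have := congr1 fst jpK.
  apply: (@is_proj'_retract _ _ j.2 pK.2 v0); [by have [] := cj | by have [] := cpK |].
  by have := congr1 snd jpK.
have [r1' hr1' er1] := factor_inj hi1 fi1 h1 (submx_refl _) ei1.
have [r0' hr0' er0] := factor_inj hi0 fi0 h0 (submx_refl _) ei0.
pose r : cmap V CI := (r1', r0').
have cr : chain r.
  by split=> //=; apply: (row_free_inj fi0); rewrite -!mulmxA er0 edI hc -er1 mulmxA.
have ri : ccomp r i = h by rewrite [RHS]surjective_pairing -er1 -er0.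
have [t [ct t1 t2]] : exists t : cmap CI CI,
    [/\ chain t, ccomp (ccomp i r) t = chain_id CI & ccomp t (ccomp i r) = chain_id CI].
  have tfree X (M : rep k n) (u : 'M[k]_(rd X, rd M)) (v : 'M[k]_(rd M, rd X)) (g : 'M[k]_(rd M)) :
      row_free u -> (u :=: g)%MS -> v *m u = g -> \rank (g *m g) = \rank g -> row_free (u *m v).
    move=> fu eu vu rg; rewrite /row_free -(mxrankMfree _ fu) -mulmxA vu.
    by rewrite (eqmxMr _ eu) rg -eu; move: fu.
  have f1 := tfree _ _ _ _ _ fi1 ei1 er1 r1.
  have f0 := tfree _ _ _ _ _ fi0 ei0 er0 r0.
  have [|t1 [ht1 t11 t12]] := hom_inv (hom_comp hi1 hr1') f1; first by rewrite /row_full; move: f1.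
  have [|t0 [ht0 t01 t02]] := hom_inv (hom_comp hi0 hr0') f0; first by rewrite /row_full; move: f0.
  exists (t1, t0); split; [|by congr (_, _) | by congr (_, _)].
  have [_ _ /= e] := chain_comp ci cr; split=> //=.
  rewrite -[LHS]mul1mx -t12 -[LHS]mulmxA; congr (_ *m _).
  by rewrite mulmxA -e -mulmxA t01 mulmx1.
have isoV : cxiso V (cxsum CI CK).
  by apply/cxisoP; exists a, b; rewrite ab ba; split=> //; apply: heq_refl.
have [/cx_is_zeroP zI|/cx_is_zeroP zK] := indec CI CK vCI vCK isoV.
  right; rewrite -ri -[r]ccomp1r -ccompA; apply: null_compl => //.
  exact: null_compr.
left; have pIi : heq (ccomp pI i) (chain_id V).
  rewrite -pij /heq opprD addrA subrr add0r; apply: nullN.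
  rewrite -[pK]ccomp1r -ccompA; apply: null_compl => //; exact: null_compr.
exists (ccomp pI (ccomp t i)); split.
- by apply: chain_comp => //; apply: chain_comp.
- apply: heq_trans (pIi); rewrite -ri -ccompA (ccompA i) ipI ccomp1l ccompA.
  apply: heq_compr => //.
  have rE : heq r (ccomp pI (ccomp i r)).
    rewrite ccompA -[X in heq X _]ccomp1l; apply: heq_compr => //.
    exact: heq_sym pIi.
  apply: heq_trans (heq_compr ct rE) _; rewrite -ccompA t1 ccomp1r; exact: heq_refl.
- by rewrite -ri -(ccompA pI) -(ccompA t) (ccompA i) (ccompA t) t2 ccomp1l.
Qed.

(** Take [N] with the total rank of the power [N.+1] minimal. Squaring that power cannot lower the
    total rank, nor raise it in either degree. *)
Lemma rank_pow_stable V (f : cmap V V) : exists N,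
  \rank ((cpow f N.+1).1 *m (cpow f N.+1).1) = \rank (cpow f N.+1).1 /\
  \rank ((cpow f N.+1).2 *m (cpow f N.+1).2) = \rank (cpow f N.+1).2.
Proof.
pose rk N := (\rank (cpow f N).1 + \rank (cpow f N).2)%N.
have [N hN] : exists N, forall M, (rk N.+1 <= rk M.+1)%N.
  have ex : exists r, `[< exists N, rk N.+1 = r >] by exists (rk 1%N); apply/asboolP; exists 0%N.
  case: (ex_minnP ex) => r /asboolP[N <-] hmin; exists N => M.
  by apply: hmin; apply/asboolP; exists M.
exists N; have := hN (N + N.+1)%N; rewrite /rk -addSn cpowD /=.
set A := _ *m (cpow f N).1; set B := _ *m (cpow f N).2.
have := mxrankM_maxl A A; have := mxrankM_maxl B B; lia.
Qed.

Lemma is_iso_pow V (f : cmap V V) N : chain f -> is_iso (cpow f N.+1) -> is_iso f.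
Proof.
move=> hf [g [hg g1 g2]]; have hN := chain_pow N hf.
have e : ccomp f (cpow f N) = ccomp (cpow f N) f.
  by have := cpowD f N 1; rewrite addn1 /= ccomp1r.
exists (ccomp (cpow f N) g); split; first exact: chain_comp.
  by rewrite ccompA.
move: g2; rewrite /= e ccompA => g2.
have gc : chain (ccomp g (cpow f N)) by apply: chain_comp.
have hr : heq (ccomp (cpow f N) g) (ccomp g (cpow f N)).
  rewrite -[X in heq X _]ccomp1l.
  apply: (@heq_trans _ _ _ _ _ (ccomp (ccomp (ccomp g (cpow f N)) f) (ccomp (cpow f N) g))).
    apply: heq_compr; [exact: chain_comp | exact: heq_sym].
  rewrite -[X in heq _ X]ccomp1r -!(ccompA _ f); apply: heq_compl => //.
  by rewrite ccompA.
by apply: heq_trans g2; apply: heq_compr.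
Qed.

Lemma fitting V (f : cmap V V) : valid_cx V -> cx_indec V -> chain f ->
  is_iso f \/ exists N, nullh (cpow f N.+1).
Proof.
move=> vV iV hf; have [N [r1 r2]] := rank_pow_stable f.
have [h|h] := fitting_iso_or_null vV iV (chain_pow N.+1 hf) r1 r2.
  by left; apply: is_iso_pow h.
by right; exists N.
Qed.

Lemma is_iso_cancelr V (f w : cmap V V) : chain f -> chain w ->
  is_iso w -> is_iso (ccomp f w) -> is_iso f.
Proof.
move=> hf hw [w' [hw' w1 w2]] [x [hx x1 x2]].
have hwx := chain_comp hw hx; exists (ccomp w x); split=> //; first by rewrite ccompA.
have h : heq (ccomp (ccomp w x) f) (ccomp (ccomp w (ccomp (ccomp x f) w)) w').
  rewrite -[X in heq X _]ccomp1r !ccompA -!(ccompA _ w w').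
  by apply: heq_compl; [do ?apply: chain_comp | apply: heq_sym].
apply: heq_trans h _; apply: heq_trans w1; apply: heq_compr => //.
by rewrite -[X in heq _ X]ccomp1r; apply: heq_compl => //; rewrite -ccompA.
Qed.

Lemma is_iso_heq V (f g : cmap V V) : chain f -> chain g -> heq f g -> is_iso g -> is_iso f.
Proof.
move=> hf hg e [x [hx x1 x2]]; exists x; split=> //.
  by apply: heq_trans x1; apply: heq_compr.
by apply: heq_trans x2; apply: heq_compl.
Qed.

Lemma is_iso_unipotent V (f : cmap V V) N : chain f -> nullh (cpow f N) ->
  is_iso (chain_id V - f).
Proof.
move=> hf hN; pose g := \sum_(i < N) cpow f i.
have cg : chain g by apply: chain_sum => i; apply: chain_pow.
have fg : ccomp f g = ccomp g f.
  rewrite ccomp_suml ccomp_sumr; apply: eq_bigr => i _.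
  by have := cpowD f i 1; rewrite addn1 /= ccomp1r.
have e : ccomp (chain_id V - f) g = chain_id V - cpow f N.
  rewrite ccompBl ccomp1l ccomp_sumr /g; elim: (N) => [|M IH]; first by rewrite !big_ord0 !subrr.
  by rewrite !big_ord_recr /= opprD addrACA IH addrA subrK.
have e' : heq (chain_id V - cpow f N) (chain_id V).
  by rewrite /heq addrAC subrr add0r; apply: nullN.
by exists g; split; rewrite ?e // ccompBr ccomp1r -fg -[X in X - _]ccomp1l -ccompBl e.
Qed.

(** Locality of the endomorphism ring: if [w] inverts [f + s] and [ccomp f w] is nilpotent, then
    [ccomp s w] is homotopic to the identity minus a nilpotent, so [s] is invertible. *)
Lemma local_sum V (l : seq (cmap V V)) : valid_cx V -> cx_indec V ->
  (forall x, x \in l -> chain x) -> is_iso (\sum_(x <- l) x) ->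
  exists2 x, x \in l & is_iso x.
Proof.
move=> vV iV; elim: l => [|f l IH] hl.
  rewrite big_nil => -[g [_ + _]]; rewrite ccomp0l => /heq_sym e.
  by case: iV => -[]; apply/cx_is_zeroP; apply: heq_null e (null0 _ _).
have hf : chain f by apply: hl; rewrite mem_head.
have hs : chain (\sum_(x <- l) x).
  rewrite big_seq_cond; elim/big_ind: _ => [||x]; [exact: chain0 | exact: chainD |].
  by rewrite andbT => xl; apply: hl; rewrite inE xl orbT.
rewrite big_cons; set s := \sum_(x <- l) x in hs *; move=> [w [hw w1 w2]].
have iw : is_iso w by exists (f + s); split=> //; apply: chainD.
have hfw := chain_comp hf hw.
have [h|[N hN]] := fitting vV iV hfw.
  by exists f; rewrite ?mem_head //; apply: is_iso_cancelr h.
have [x xl ix] : exists2 x, x \in l & is_iso x.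
  apply: IH; first by move=> x xl; apply: hl; rewrite inE xl orbT.
  apply: (is_iso_cancelr hs hw iw); apply: is_iso_heq (is_iso_unipotent hfw hN).
  - exact: chain_comp.
  - by apply: chainB => //; apply: chain1.
  by move: w1; rewrite ccompDl /heq opprB addrA (addrC (ccomp s w)).
by exists x; rewrite // inE xl orbT.
Qed.

(** The isomorphism makes [V] a retract of [U], with idempotent [e]. By Fitting [e] is invertible,
    hence homotopic to the identity, or nilpotent, hence null, which would make [V] contractible. *)
Lemma indec_factor_iso U V (p : cmap V U) (q : cmap U V) :
  valid_cx U -> cx_indec U -> valid_cx V -> cx_indec V -> chain p -> chain q ->
  is_iso (ccomp p q) -> cxiso V U.
Proof.
move=> vU iU vV iV hp hq [x [hx x1 x2]].
pose r := ccomp q x; have hr : chain r by apply: chain_comp.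
have pr : heq (ccomp p r) (chain_id V) by rewrite /r ccompA.
pose e := ccomp r p; have he : chain e by apply: chain_comp.
have ee : heq (ccomp e e) e.
  rewrite /e -ccompA (ccompA p) -[X in heq _ (ccomp _ X)]ccomp1l.
  by apply: heq_compl => //; apply: heq_compr.
have [[y [hy y1 y2]]|[N hN]] := fitting vU iU he.
  apply/cxisoP; exists p, r; split=> //.
  have h : heq e (ccomp y (ccomp e e)).
    rewrite ccompA -[X in heq X _]ccomp1l; apply: heq_compr => //.
    exact: heq_sym y2.
  by apply: heq_trans h _; apply: heq_trans y2; apply: heq_compl.
have eN : heq e (cpow e N.+1).
  elim: N {hN} => [|N IH]; first by rewrite /= ccomp1r; apply: heq_refl.
  apply: heq_trans (heq_sym ee) _; exact: heq_compl.
have e0 := heq_null eN hN.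
case: iV => -[]; apply/cx_is_zeroP.
apply: (heq_null (heq_sym pr)).
apply: (@heq_null _ _ _ _ (ccomp p r) (ccomp (ccomp p e) r)).
  rewrite /e (ccompA p) -(ccompA (ccomp p r)) -[X in heq X _]ccomp1l.
  by apply: heq_compr; [exact: chain_comp | exact: heq_sym pr].
by apply: null_compr => //; apply: null_compl.
Qed.

(** [U] is a retract of a sum of copies of [V], so the identity of [F i] is homotopic to a sum of
    maps each passing through some [G j]; by locality one of these is an isomorphism. *)
Lemma summand_match U V m p (F : 'I_m -> cx k n) (G : 'I_p -> cx k n) i :
  valid_cx U -> valid_cx V -> hom_shift_zero V V ->
  (forall X, is_mod' X -> Hom1zero V X -> Hom1zero U X) ->
  (forall X, is_mod' X -> Hom0zero V X -> Hom0zero U X) ->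
  biproduct U F -> biproduct V G ->
  (forall i, valid_cx (F i) /\ cx_indec (F i)) ->
  (forall j, valid_cx (G j) /\ cx_indec (G j)) ->
  exists j, cxiso (F i) (G j).
Proof.
move=> vU vV hV VU1 VU0 [a [b [ca cb ab _ _]]] [c [d [cc cdd _ _ dc]]] hF hG.
have [l [hl el]] := retract_of_sum vV vU hV VU1 VU0.
have [vFi iFi] := hF i.
pose l' := [seq ccomp (ccomp (ccomp (a i) x.1) (d j)) (ccomp (c j) (ccomp x.2 (b i)))
  | x <- l, j <- enum 'I_p].
have hl' x : x \in l' -> chain x.
  case/allpairsP=> -[y j] /= [/hl[y1 y2] _ ->].
  by apply: chain_comp; apply: chain_comp => //; apply: chain_comp.
have [|x /allpairsP[[y j] /= [/hl[y1 y2] _ ->]] iso] := local_sum vFi iFi hl'.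
- apply: (is_iso_heq (g := chain_id (F i))).
  + by rewrite big_seq_cond; elim/big_ind: _ => [||x]; [exact: chain0 | exact: chainD |];
      rewrite andbT; apply: hl'.
  + exact: chain1.
  + apply: heq_trans (ab i); rewrite big_allpairs_dep /=.
    have e1 : heq (ccomp (a i) (\sum_(x <- l) ccomp x.1 x.2)) (a i).
      by rewrite -[X in heq _ X]ccomp1r; apply: heq_compl.
    have e2 : heq (\sum_(x <- l) ccomp (ccomp (a i) (ccomp x.1 x.2)) (b i)) (ccomp (a i) (b i)).
      by rewrite -ccomp_suml -ccomp_sumr; apply: heq_compr.
    apply: heq_trans e2; rewrite /heq -sumrB big_seq_cond.
    elim/big_ind: _ => [||x]; [exact: null0 | exact: nullD |].
    rewrite andbT => /hl[x1 x2].
    rewrite big_enum /= (eq_bigr (fun j => ccomp (ccomp (ccomp (a i) x.1) (ccomp (d j) (c j)))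
       (ccomp x.2 (b i)))); last by move=> j _; rewrite !ccompA.
    rewrite -ccomp_suml -ccomp_sumr -/(heq _ _) (ccompA (a i)) -[X in heq _ X]ccompA.
    apply: heq_compr; first exact: chain_comp.
    rewrite -[X in heq _ X]ccomp1r; apply: heq_compl => //; exact: chain_comp.
  exists (chain_id (F i)); split; [exact: chain1 | |]; rewrite ccomp1l; exact: heq_refl.
exists j; have [vG iG] := hG j.
by apply: indec_factor_iso iso => //; apply: chain_comp => //; apply: chain_comp.
Qed.

Theorem presilt_unique U V m p (F : 'I_m -> cx k n) (G : 'I_p -> cx k n) :
  valid_cx U -> valid_cx V -> hom_shift_zero U U -> hom_shift_zero V V ->
  (forall X, is_mod' X -> Hom1zero U X <-> Hom1zero V X) ->
  (forall X, is_mod' X -> Hom0zero U X <-> Hom0zero V X) ->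
  biproduct U F -> biproduct V G ->
  (forall i, valid_cx (F i) /\ cx_indec (F i)) ->
  (forall j, valid_cx (G j) /\ cx_indec (G j)) ->
  (forall i i', i <> i' -> ~ cxiso (F i) (F i')) ->
  (forall j j', j <> j' -> ~ cxiso (G j) (G j')) -> cxiso U V.
Proof.
move=> vU vV hU hV e1 e0 bU bV hF hG nF nG; apply: (biproduct_match bU bV) => // [i|j].
  by apply: (summand_match i vU vV hV _ _ bU bV hF hG) => X hX; [case: (e1 X hX) | case: (e0 X hX)].
by apply: (summand_match j vV vU hU _ _ bV bU hG hF) => X hX; [case: (e1 X hX) | case: (e0 X hX)].
Qed.

End Uniqueness.

(** The count of non-zero entries bounds the rank above. The same bound for the complementary
    idempotent forces equality. *)
Lemma rank_diag_pred (K : fieldType) d (P : pred 'I_d) :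
  \rank (diag_mx (\row_s (P s)%:R) : 'M[K]_d) = #|P|.
Proof.
pose D (Q : pred 'I_d) : 'M[K]_d := diag_mx (\row_s (Q s)%:R).
have le Q : (\rank (D Q) <= #|Q|)%N.
  have -> : D Q = \sum_(s | Q s) delta_mx s s.
    apply/matrixP => i j; rewrite summxE !mxE; case: (boolP (Q i)) => Qi.
      rewrite (bigD1 i) //= big1 ?addr0 ?mxE ?eqxx // => [|s /andP[_ ns]].
        by rewrite eq_sym; case: eqP.
      by rewrite mxE eq_sym (negbTE ns).
    rewrite mul0rn big1 // => s Qs; rewrite mxE; case: eqP => // e.
    by rewrite e Qs in Qi.
  rewrite -sum1_card; elim/big_ind2: _ => [|A a B b lA lB|s _]; rewrite ?mxrank0 ?mxrank_delta //.
  by apply: leq_trans (mxrank_add A B) _; apply: leq_add.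
have id : D P *m D P = D P.
  rewrite /D mulmx_diag; congr diag_mx; apply/rowP => i; rewrite !mxE.
  by case: (P i); rewrite ?mulr1 ?mulr0.
have c : 1%:M - D P = D (predC P).
  apply/matrixP => i j; rewrite !mxE /=; case: eqP => [->|_]; last by rewrite subr0.
  by rewrite !mulr1n; case: (P j); rewrite ?subrr ?subr0.
rewrite -/(D P); apply/eqP; rewrite eqn_leq le /=.
have := le (predC P); rewrite -c rank_compl // => h1.
have := cardC P; rewrite card_ord => h2; have h3 := rank_leq_row (D P).
have h4 : #|predC P| = #|[predC P]| by apply: eq_card.
rewrite h4 in h1; rewrite -(leq_add2r #|[predC P]|) h2 -leq_subLR.
exact: h1.
Qed.

(** * Monomial and thin modules *)

Section Monomial.
Variables (k : fieldType) (n : nat) (T : finType) (vt : T -> 'I_n).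
Variables (fa fb : T -> option T) (ht : T -> nat).

(** The basis vector of [s] goes to that of [f s], or to 0 for [None]; matrix products become
    compositions of partial maps. *)
Definition pm (f : T -> option T) : 'M[k]_#|T| :=
  \matrix_(s, t) (f (enum_val s) == Some (enum_val t))%:R.

Lemma eq_pm f g : f =1 g -> pm f = pm g.
Proof. by move=> e; apply/matrixP => s t; rewrite !mxE e. Qed.

Lemma pmM f g : pm f *m pm g = pm (fun t => obind g (f t)).
Proof.
apply/matrixP => s t; rewrite !mxE; case e : (f (enum_val s)) => [u|] /=; last first.
  by rewrite big1 // => u _; rewrite !mxE e mul0r.
rewrite (bigD1 (enum_rank u)) //= !mxE e enum_rankK eqxx mul1r big1 ?addr0 // => v ne.
rewrite !mxE e; case: eqP => [[eu]|_]; last by rewrite mul0r.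
by rewrite eu enum_valK eqxx in ne.
Qed.

Lemma pm1 : pm Some = 1%:M.
Proof. by apply/matrixP => s t; rewrite !mxE (inj_eq Some_inj) (inj_eq enum_val_inj). Qed.

Lemma pm0 : pm (fun _ => None) = 0.
Proof. by apply/matrixP => s t; rewrite !mxE. Qed.

Lemma sum_pm (w : T -> 'I_n) h :
  \sum_i pm (fun t => if w t == i then h t else None) = pm h.
Proof.
apply/matrixP => s t; rewrite summxE mxE (bigD1 (w (enum_val s))) //= mxE eqxx.
by rewrite big1 ?addr0 // => i; rewrite eq_sym mxE => /negbTE ->.
Qed.

Lemma rank_pm (P : pred T) : \rank (pm (fun t => if P t then Some t else None)) = #|P|.
Proof.
rewrite (_ : pm _ = diag_mx (\row_s (P (enum_val s))%:R)).
  rewrite rank_diag_pred /=; rewrite -(card_imset _ (@enum_val_inj _ T)).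
  apply: eq_card => t; apply/imsetP/idP => [[s Ps ->]//|Pt].
  by exists (enum_rank t); rewrite ?enum_rankK // unfold_in /= enum_rankK.
apply/matrixP => s t; rewrite !mxE; case: (P _); last by rewrite mul0rn.
by rewrite (inj_eq Some_inj) (inj_eq enum_val_inj) -mulr_natr mul1r.
Qed.

Definition mono : rep k n := @Rep k n #|T|
  (fun i => pm (fun t => if vt t == i then Some t else None))
  (fun i => pm (fun t => if vt t == i then fa t else None))
  (fun i => pm (fun t => if vt t == ordS i then fb t else None)).

Definition mono_step (x : 'I_n * bool) t :=
  if x.2 then if vt t == x.1 then fa t else None
  else if vt t == ordS x.1 then fb t else None.

Lemma arr_mono x : arr mono x = pm (mono_step x).
Proof. by case: x => i []. Qed.

Lemma dimv_mono i : dimv mono i = #|[pred t | vt t == i]|.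
Proof. exact: rank_pm. Qed.

Hypothesis vt_fa : forall t t', fa t = Some t' -> vt t' = ordS (vt t).
Hypothesis vt_fb : forall t t', fb t = Some t' -> vt t = ordS (vt t').
Hypothesis fab : forall t, obind fb (fa t) = obind fa (fb t).
Hypothesis ht_fa : forall t t', fa t = Some t' -> (ht t < ht t')%N.
Hypothesis ht_fb : forall t t', fb t = Some t' -> (ht t < ht t')%N.

(** [fab] is the preprojective relation. The height [ht] grows along every arrow, so words longer
    than its maximum act as zero. *)
Lemma is_mod_mono : is_mod mono.
Proof.
split; first split => /=.
- by rewrite sum_pm pm1.
- move=> i j; rewrite pmM; case: (eqVneq i j) => [->|ne].
    by apply: eq_pm => t; case: eqP => //= ->; rewrite eqxx.
  rewrite -pm0; apply: eq_pm => t; case: eqP => //= ->; by rewrite (negbTE ne).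
- move=> i; rewrite !pmM; apply: eq_pm => t; case: eqP => //= <-; rewrite eqxx.
  by case e : (fa t) => [t'|] //=; rewrite (vt_fa e) eqxx.
- move=> i; rewrite !pmM; apply: eq_pm => t; case: eqP => //= e; rewrite e eqxx.
  case e' : (fb t) => [t'|] //=; have := vt_fb e'.
  by rewrite e => /ordS_inj <-; rewrite eqxx.
- rewrite sumrB; apply/eqP; rewrite subr_eq0; apply/eqP.
  rewrite (eq_bigr (fun i => pm (fun t => if vt t == i then obind fb (fa t) else None))).
    rewrite sum_pm (eq_pm fab) -(sum_pm (fun t => ord_pred (vt t))).
    apply: eq_bigr => i _; rewrite pmM; apply: eq_pm => t.
    rewrite -(inj_eq (@ordS_inj n)) ord_predK; case: eqP => //= e.
    case e' : (fb t) => [t'|] //=; have := vt_fb e'.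
    by rewrite e => /ordS_inj <-; rewrite eqxx.
  move=> i _; rewrite pmM; apply: eq_pm => t; case: eqP => //= e.
  by case e' : (fa t) => [t'|] //=; rewrite (vt_fa e') e eqxx.
exists (\max_t ht t).+1 => s hs.
suff [w ew hw] : exists2 w, wordmx mono s = pm w &
    forall t t', w t = Some t' -> (ht t + size s <= ht t')%N.
  rewrite [LHS]ew -pm0; apply: eq_pm => t; case e : (w t) => [t'|] //.
  by have := hw _ _ e; have := leq_bigmax (F := ht) t'; rewrite hs; lia.
elim: s {hs} => [|x s [w ew hw]] /=.
  by exists Some => [|t t' [->]]; rewrite ?pm1 ?addn0.
exists (fun t => obind w (mono_step x t)); first by rewrite -pmM -ew arr_mono.
move=> t t''; case e : (mono_step x t) => [t'|] //= /hw; rewrite addnS => le.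
apply: leq_trans le; rewrite -addSn leq_add2r.
move: e; rewrite /mono_step; case: x.2; case: eqP => // _; [exact: ht_fa | exact: ht_fb].
Qed.

Definition bvec t : 'rV[k]_#|T| := delta_mx 0 (enum_rank t).

Lemma bvec_pm t f : bvec t *m pm f = if f t is Some t' then bvec t' else 0.
Proof.
apply/rowP => s; rewrite -rowE !mxE enum_rankK; case: (f t) => [t'|]; rewrite !mxE //=.
by rewrite (inj_eq Some_inj) -(inj_eq enum_val_inj) enum_rankK eq_sym.
Qed.

End Monomial.

Lemma val_ordS_lt n (v : 'I_n) : (v.+1 < n)%N -> ordS v = v.+1 :> nat.
Proof. by move=> h; rewrite /= modn_small. Qed.

Lemma val_ord_pred_gt0 n (v : 'I_n) : (0 < v)%N -> ord_pred v = v.-1 :> nat.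
Proof.
move=> h; rewrite /= (_ : (v + n).-1 = v.-1 + n)%N; last lia.
by rewrite modnDr modn_small //; have := ltn_ord v; lia.
Qed.

Section Thin.
Variables (k : fieldType) (n : nat) (i j : nat) (eps : nat -> bool).
Hypothesis jn : (j <= n)%N.

Let T := {v : 'I_n | (i <= v < j)%N}.
(** [eps p] orients the edge between [p.-1] and [p]: towards [p], by an [a]-arrow, if true, and
    towards [p.-1], by a [b]-arrow, if false. *)
Let fa (t : T) : option T :=
  if ((val t).+1 < j)%N && eps (val t).+1 then (insub (ordS (val t)) : option T) else None.
Let fb (t : T) : option T :=
  if (i < val t)%N && ~~ eps (val t) then (insub (ord_pred (val t)) : option T) else None.
(** The number of edges that point towards the vertex of [t]; crossing an edge along its orientation
    makes it point the right way and changes no other. *)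
Let ht (t : T) : nat :=
  \sum_(u < n) (((u <= val t)%N && eps u) || ((val t < u)%N && ~~ eps u)).

Definition thin : rep k n := mono k (val : T -> 'I_n) fa fb.

Let fa_some t t' : fa t = Some t' ->
  [/\ val t' = ordS (val t), val t' = (val t).+1 :> nat & eps (val t')].
Proof.
rewrite /fa; case: andP => // -[h e]; case: insubP => // u _ eu [<-].
have lt : ((val t).+1 < n)%N by lia.
by split; rewrite ?eu ?val_ordS_lt.
Qed.

Let fb_some t t' : fb t = Some t' ->
  [/\ val t = ordS (val t'), val t = (val t').+1 :> nat & ~~ eps (val t)].
Proof.
rewrite /fb; case: andP => // -[h e]; case: insubP => // u _ eu [<-].
split; rewrite ?eu ?ord_predK // val_ord_pred_gt0; lia.
Qed.

Lemma leqb (b c : bool) : (b -> c) -> (b <= c)%N.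
Proof. by case: b => // ->. Qed.

Lemma is_mod_thin : is_mod thin.
Proof.
apply: (@is_mod_mono _ _ _ _ _ _ ht).
- by move=> t t' /fa_some[].
- by move=> t t' /fb_some[].
- move=> t.
  have -> : obind fb (fa t) = None.
    case e : (fa t) => [t'|] //=; have [_ _ h] := fa_some e.
    by rewrite /fb h andbF.
  case e : (fb t) => [t'|] //=; have [_ h1 h2] := fb_some e.
  by rewrite /fa -h1 (negbTE h2) andbF.
- move=> t t' /fa_some[_ e1 e2]; have lt := ltn_ord (val t').
  rewrite /ht (bigD1 (val t')) // [X in (_ < X)%N](bigD1 (val t')) //=.
  rewrite e2 leqnn !andbF orbF andbT e1 ltnn add0n add1n ltnS.
  apply: leq_sum => u; rewrite -val_eqE /= e1 /= => /eqP ne; apply: leqb => /orP.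
  by case: (eps u) => -[/andP[] //|/andP[]] // h _; apply/orP; [left|right]; rewrite andbT; lia.
- move=> t t' /fb_some[_ e1 e2]; have lt := ltn_ord (val t).
  rewrite /ht (bigD1 (val t)) // [X in (_ < X)%N](bigD1 (val t)) //=.
  rewrite (negbTE e2) ltnn !andbF /= e1 ltnSn add0n add1n ltnS.
  apply: leq_sum => u; rewrite -val_eqE /= e1 /= => /eqP ne; apply: leqb => /orP.
  by case: (eps u) => -[/andP[] //|/andP[]] // h _; apply/orP; [left|right]; rewrite andbT; lia.
Qed.

Lemma dimv_thin (v : 'I_n) : dimv thin v = (i <= v < j)%N.
Proof.
rewrite dimv_mono; have [h|h] := boolP (i <= v < j)%N.
  have -> : #|[pred t : T | val t == v]| = #|pred1 (exist _ v h : T)|.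
    by apply: eq_card => t; rewrite !inE -val_eqE.
  by rewrite card1.
have -> // : #|[pred t : T | val t == v]| = 0%N.
apply: eq_card0 => t; rewrite !inE; apply/negP => /eqP e.
by have := valP t; rewrite /= e (negbTE h).
Qed.

(** The arrow on the edge is injective on its source, with the partial map [M] undoing it, and
    carries [U] into itself, so the dimension of [U] cannot drop along it. *)
Lemma thin_edge (U : 'M[k]_(rd thin)) (p q : 'I_n) : stab U ->
  (i <= p)%N -> q = p.+1 :> nat -> (q < j)%N ->
  if eps q then (\rank (U *m idem thin p) <= \rank (U *m idem thin q))%N
  else (\rank (U *m idem thin q) <= \rank (U *m idem thin p))%N.
Proof.
move=> [_ s] ip qp qj; have eq : q = ordS p by apply: ord_inj; rewrite val_ordS_lt; lia.
case: ifP => e.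
  have h1 : idem thin p *m amx thin p = amx thin p.
    by have := idem_arr (p, true) p is_mod_thin; rewrite eqxx.
  have h2 : amx thin p *m idem thin q = amx thin p.
    by have := arr_idem (p, true) q is_mod_thin; rewrite /= eq eqxx.
  pose M := pm k (fun t : T => insub (ord_pred (val t)) : option T).
  have eM : amx thin p *m M = idem thin p.
    rewrite /= pmM; apply: eq_pm => t; case: eqP => // et; rewrite /fa /= et -qp qj e /=.
    rewrite -eq insubT => [|h]; first by rewrite qj; lia.
    rewrite /= eq ordSK -et; exact: valK.
  rewrite -{1}eM mulmxA; apply: leq_trans (mxrankM_maxl _ _) _.
  by rewrite -h2 mulmxA mxrankS // submxMr //; apply: s (p, true).
have h1 : bmx thin p *m idem thin p = bmx thin p.
  by have := arr_idem (p, false) p is_mod_thin; rewrite /= eqxx.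
pose M := pm k (fun t : T => insub (ordS (val t)) : option T).
have eM : bmx thin p *m M = idem thin q.
  rewrite /= pmM -eq; apply: eq_pm => t; case: eqP => // et.
  rewrite /fb /= et e qp ltnS ip /= eq ordSK insubT => [|h]; first by rewrite ip -qp; lia.
  rewrite /= -eq -et; exact: valK.
rewrite -{1}eM mulmxA; apply: leq_trans (mxrankM_maxl _ _) _.
by rewrite -h1 mulmxA mxrankS // submxMr //; apply: s (p, false).
Qed.

End Thin.

Lemma linfun_exists (K : fieldType) (aT rT : vectType K) (f : aT -> rT) :
  linear f -> exists F : 'Hom(aT, rT), forall u, F u = f u.
Proof.
move=> lf; pose g : {linear aT -> rT} :=
  HB.pack f (GRing.isLinear.Build K aT rT *:%R f lf).
by exists (linfun g) => u; rewrite lfunE.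
Qed.

(** * Dimension vectors of bricks *)

Section Support.
Variables (K : fieldType) (m p : nat).

(** Matrix units span, which bounds the dimension above; the complementary support obeys the same
    bound and the two spaces fill everything. *)
Lemma support_exists (P : 'I_m -> 'I_p -> bool) : exists V : {vspace 'M[K]_(m, p)},
  (forall f, f \in V <-> forall s t, ~~ P s t -> f s t = 0) /\
  \dim V = (\sum_s \sum_t P s t)%N.
Proof.
pose pr (Q : 'I_m -> 'I_p -> bool) (V : {vspace 'M[K]_(m, p)}) :=
  forall f, f \in V <-> forall s t, ~~ Q s t -> f s t = 0.
have ex Q : exists V, pr Q V.
  apply: subspace_exists => [s t _|a u v hu hv s t h]; first by rewrite mxE.
  by rewrite !mxE hu // hv // mulr0 addr0.
have le Q V : pr Q V -> (\dim V <= \sum_s \sum_t Q s t)%N.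
  move=> hV; pose l := [seq (delta_mx z.1 z.2 : 'M[K]_(m, p)) | z <- enum [pred z | Q z.1 z.2]].
  have sz : size l = (\sum_s \sum_t Q s t)%N.
    rewrite size_map -cardE -sum1_card big_mkcond /= pair_big /=.
    by apply: eq_bigr => z _; rewrite inE; case: (Q _ _).
  rewrite -sz; apply: leq_trans (dim_span l); apply/dimvS/subvP => f /hV hf.
  rewrite [f]matrix_sum_delta; apply: rpred_sum => s _; apply: rpred_sum => t _.
  have [Qst|nQ] := boolP (Q s t); last by rewrite hf // scale0r mem0v.
  apply/rpredZ/memv_span; apply/mapP; exists (s, t) => //.
  by rewrite mem_enum inE.
have [V hV] := ex P; have [V' hV'] := ex (fun s t => ~~ P s t).
exists V; split=> //; apply/eqP; rewrite eqn_leq le //=.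
have full : (V + V')%VS = fullv.
  apply/eqP; rewrite eqEsubv subvf /=; apply/subvP => f _.
  apply/memv_addP; exists (\matrix_(s, t) if P s t then f s t else 0).
    by apply/hV => s t /negbTE h; rewrite mxE h.
  exists (\matrix_(s, t) if P s t then 0 else f s t).
    by apply/hV' => s t; rewrite negbK => h; rewrite mxE h.
  by apply/matrixP => s t; rewrite !mxE; case: (P s t); rewrite ?addr0 ?add0r.
have h1 := dimv_add_leqif V V'; have := le _ _ hV'; have := h1.1.
rewrite full dimvf /dim /=.
have : (\sum_s \sum_t P s t + \sum_(s < m) \sum_(t < p) (~~ P s t))%N = (m * p)%N.
  rewrite -big_split -[m in RHS]card_ord -sum_nat_const; apply: eq_bigr => s _ /=.
  rewrite -big_split -[p in RHS]card_ord -sum1_card; apply: eq_bigr => t _ /=.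
  by case: (P s t).
move=> e h2 h3; rewrite -(leq_add2r (\sum_(s < m) \sum_(t < p) (~~ P s t))) e.
by apply: leq_trans h2 _; rewrite leq_add2l.
Qed.

End Support.

(** Rank-nullity for pairing [v] with a basis of [U]. In this form the duality of the commutator
    complex needs no adjoint maps. *)
Lemma trace_perp_dim (K : fieldType) d (V U : {vspace 'M[K]_d}) (W : {vspace 'M[K]_d}) :
  (forall v, v \in V -> (forall u, u \in U -> \tr (u *m v) = 0) -> v \in W) ->
  (\dim V <= \dim U + \dim W)%N.
Proof.
move=> h; have [|F hF] := @linfun_exists K ('M[K]_d) ('rV[K]_(\dim U))
  (fun v => \row_b \tr ((vbasis U)`_b *m v)).
  by move=> a u v; apply/rowP => b; rewrite !mxE mulmxDr -scalemxAr mxtraceD mxtraceZ.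
rewrite -(limg_ker_dim F V) addnC; apply: leq_add.
  by apply: leq_trans (dimvS (subvf _)) _; rewrite dimvf /dim /= mul1n.
apply/dimvS/subvP => v; rewrite memv_cap memv_ker hF => /andP[Vv /eqP e]; apply: h => // u.
move/coord_vbasis => ->; rewrite mulmx_suml raddf_sum big1 // => b _ /=.
rewrite -scalemxAl mxtraceZ; move/rowP: e => /(_ b); rewrite !mxE => ->.
by rewrite mulr0.
Qed.

Lemma commutator_linear (K : fieldType) d (A u v : 'M[K]_d) (a : K) :
  (a *: u + v) *m A - A *m (a *: u + v) = a *: (u *m A - A *m u) + (v *m A - A *m v).
Proof.
rewrite mulmxDl mulmxDr -scalemxAl -scalemxAr scalerBr opprD addrACA.
by [].
Qed.

Section BrickRank.
Variables (K : fieldType) (d n : nat) (vt : 'I_d -> 'I_n) (A B : 'M[K]_d).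
Hypothesis suppA : forall s t, vt t != ordS (vt s) -> A s t = 0.
Hypothesis suppB : forall s t, vt s != ordS (vt t) -> B s t = 0.
Hypothesis AB : A *m B = B *m A.
Hypothesis brick : forall f : 'M[K]_d, (forall s t, vt s != vt t -> f s t = 0) ->
  f *m A = A *m f -> f *m B = B *m f -> exists a, f = a%:M.

Let dd i := #|[pred s | vt s == i]|.

Let mulA_supp (f : 'M[K]_d) s t : (forall s t, vt s != vt t -> f s t = 0) ->
  vt t != ordS (vt s) -> (f *m A) s t = 0 /\ (A *m f) s t = 0.
Proof.
move=> hf ne; split; rewrite mxE big1 // => u _.
  have [e|/hf ->] := eqVneq (vt s) (vt u); last by rewrite mul0r.
  by rewrite suppA ?mulr0 // -e.
have [e|/hf ->] := eqVneq (vt u) (vt t); last by rewrite mulr0.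
by rewrite suppA ?mul0r // e.
Qed.

Let mulB_supp (f : 'M[K]_d) s t : (forall s t, vt s != vt t -> f s t = 0) ->
  vt s != ordS (vt t) -> (f *m B) s t = 0 /\ (B *m f) s t = 0.
Proof.
move=> hf ne; split; rewrite mxE big1 // => u _.
  have [e|/hf ->] := eqVneq (vt s) (vt u); last by rewrite mul0r.
  by rewrite suppB ?mulr0 // -e.
have [e|/hf ->] := eqVneq (vt u) (vt t); last by rewrite mulr0.
by rewrite suppB ?mul0r // e.
Qed.

Let tr_delta (M : 'M[K]_d) s t : \tr (delta_mx s t *m M) = M t s.
Proof.
rewrite /mxtrace (bigD1 s) //= big1 ?addr0 => [|u ne].
  by rewrite mxE (bigD1 t) //= big1 ?addr0 ?mxE ?eqxx ?mul1r // => v nv;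
    rewrite mxE (negbTE nv) andbF mul0r.
by rewrite mxE big1 // => v _; rewrite mxE (negbTE ne) mul0r.
Qed.

Let dd_sum (F : 'I_n -> nat) : (\sum_s F (vt s) = \sum_i dd i * F i)%N.
Proof.
rewrite (partition_big vt predT) //=; apply: eq_bigr => i _.
by rewrite (eq_bigr (fun _ => F i)) ?sum_nat_const // => s /eqP ->.
Qed.

(* The commutator complex V0 -> V1 -> V0, f |-> ([f, A], [f, B]) and
   (f, g) |-> [f, B] + [A, g], is its own dual under the trace pairing; so both
   of its maps have rank dim V0 - 1, and dim V1 >= 2 (dim V0 - 1). *)
Lemma brick_rank : (\sum_i dd i * dd i <= \sum_i dd i * dd (ordS i) + 1)%N.
Proof.
have [V0 [hV0 dV0]] := @support_exists K d d (fun s t => vt s == vt t).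
pose P1 (s : 'I_d) (u : 'I_(d + d)) :=
  match split u with inl t => vt t == ordS (vt s) | inr t => vt s == ordS (vt t) end.
have [V1 [hV1 dV1]] := @support_exists K d (d + d) P1.
have eV0 : \dim V0 = (\sum_i dd i * dd i)%N.
  rewrite dV0 -dd_sum; apply: eq_bigr => s _.
  by rewrite /dd -sum1_card [RHS]big_mkcond; apply: eq_bigr => t _; rewrite inE eq_sym; case: eqP.
have eV1 : \dim V1 = (\sum_i dd i * dd (ordS i) + \sum_i dd i * dd (ordS i))%N.
  rewrite dV1 (eq_bigr (fun s => (\sum_t (vt t == ordS (vt s)) + \sum_t (vt s == ordS (vt t)))%N)).
    rewrite big_split /=; congr (_ + _)%N.
      rewrite -dd_sum; apply: eq_bigr => s _.
      by rewrite /dd -sum1_card [RHS]big_mkcond; apply: eq_bigr => t _; rewrite inE; case: eqP.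
    rewrite exchange_big -dd_sum; apply: eq_bigr => t _ /=.
    by rewrite /dd -sum1_card [RHS]big_mkcond; apply: eq_bigr => s _; rewrite inE; case: eqP.
  move=> s _; rewrite big_split_ord /=; congr (_ + _)%N; apply: eq_bigr => t _;
    by rewrite /P1 -?/(lshift _ _) ?(unsplitK (inl t)) ?(unsplitK (inr t)).
pose d0 (f : 'M[K]_d) := row_mx (f *m A - A *m f) (f *m B - B *m f).
have lin0 a (u v : 'M[K]_d) : d0 (a *: u + v) = a *: d0 u + d0 v.
  by rewrite /d0 scale_row_mx add_row_mx; congr row_mx; apply: commutator_linear.
have [D0 hD0] := linfun_exists (lin0 : linear d0).
pose d1 (u : 'M[K]_(d, d + d)) :=
  (lsubmx u *m B - B *m lsubmx u) + (A *m rsubmx u - rsubmx u *m A).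
have lin1 a (u v : 'M[K]_(d, d + d)) : d1 (a *: u + v) = a *: d1 u + d1 v.
  have -> : d1 (a *: u + v) = (lsubmx (a *: u + v) *m B - B *m lsubmx (a *: u + v)) -
      (rsubmx (a *: u + v) *m A - A *m rsubmx (a *: u + v)) by rewrite opprB.
  have l1 : lsubmx (a *: u + v) = a *: lsubmx u + lsubmx v by apply: linearP.
  have r1 : rsubmx (a *: u + v) = a *: rsubmx u + rsubmx v by apply: linearP.
  rewrite l1 r1 !commutator_linear opprD addrACA -scalerN -scalerDr.
  by rewrite /d1 !opprB.
have [D1 hD1] := linfun_exists (lin1 : linear d1).
have comm1 f : f \in V0 -> f *m A = A *m f -> f *m B = B *m f -> f \in <[1%:M : 'M[K]_d]>%VS.
  by move=> /hV0 hf fA fB; have [a ->] := brick hf fA fB; apply/vlineP; exists a; rewrite scalemx1.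
have dim1 : (\dim <[(1%:M : 'M[K]_d)]>%VS <= 1)%N by rewrite dim_vline leq_b1.
have k0 : (\dim (V0 :&: lker D0) <= 1)%N.
  apply: leq_trans dim1; apply/dimvS/subvP => f; rewrite memv_cap memv_ker hD0 /d0.
  case/andP=> Vf; rewrite row_mx_eq0 !subr_eq0 => /andP[/eqP fA /eqP fB].
  exact: comm1.
have W1 : (D0 @: V0 <= V1 :&: lker D1)%VS.
  apply/subvP => _ /memv_imgP[f Vf ->]; rewrite memv_cap memv_ker; apply/andP; split.
    apply/hV1 => s u; rewrite hD0 /d0 /P1; case: splitP => t eu ne.
      rewrite (_ : u = lshift d t) ?row_mxEl; last exact: ord_inj.
      have [e1 e2] := mulA_supp ((hV0 f).1 Vf) ne.
      by rewrite [LHS]mxE e1 mxE e2 subrr.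
    rewrite (_ : u = rshift d t) ?row_mxEr; last exact: ord_inj.
    have [e1 e2] := mulB_supp ((hV0 f).1 Vf) ne.
    by rewrite [LHS]mxE e1 mxE e2 subrr.
  apply/eqP; rewrite hD1 hD0 /d0 /d1 row_mxKl row_mxKr !mulmxBl !mulmxBr !mulmxA.
  rewrite -(mulmxA f B A) -AB mulmxA.
  move: (f *m A *m B) (A *m f *m B) (B *m f *m A) (A *m B *m f) => x1 x2 x3 x4.
  by apply/matrixP => s t; rewrite !mxE; ring.
(* An element of [V0] orthogonal to the image of [D1] commutes with [A] and [B], as pairing with
   images of matrix units shows entry by entry; so it is scalar. *)
have perp : (\dim V0 <= \dim (D1 @: V1) + 1)%N.
  apply: leq_trans (leq_add (leqnn _) dim1); apply: trace_perp_dim => v Vv tr0.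
  apply: comm1 => //.
    apply/matrixP => t s; have [e|ne] := eqVneq (vt s) (ordS (vt t)); last first.
      by have [-> ->] := mulA_supp ((hV0 v).1 Vv) ne.
    have mem : row_mx 0 (delta_mx s t) \in V1.
      apply/hV1 => s' u; rewrite /P1; case: splitP => t' eu ne.
        by rewrite (_ : u = lshift d t') ?row_mxEl ?mxE //; apply: ord_inj.
      rewrite (_ : u = rshift d t') ?row_mxEr ?mxE; last exact: ord_inj.
      by case: eqP => // es; case: eqP => // et; rewrite es et e eqxx in ne.
    have := tr0 _ (memv_img D1 mem); rewrite hD1 /d1 row_mxKl row_mxKr.
    rewrite mul0mx mulmx0 subrr add0r mulmxBl -mulmxA mxtraceD raddfN /=.
    rewrite mxtrace_mulC -!mulmxA !tr_delta => /eqP; rewrite subr_eq0 => /eqP; exact.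
  apply/matrixP => t s; have [e|ne] := eqVneq (vt t) (ordS (vt s)); last first.
    by have [-> ->] := mulB_supp ((hV0 v).1 Vv) ne.
  have mem : row_mx (delta_mx s t) 0 \in V1.
    apply/hV1 => s' u; rewrite /P1; case: splitP => t' eu ne; last first.
      by rewrite (_ : u = rshift d t') ?row_mxEr ?mxE //; apply: ord_inj.
    rewrite (_ : u = lshift d t') ?row_mxEl ?mxE; last exact: ord_inj.
    by case: eqP => // es; case: eqP => // et; rewrite es et e eqxx in ne.
  have := tr0 _ (memv_img D1 mem); rewrite hD1 /d1 row_mxKl row_mxKr.
  rewrite mul0mx mulmx0 subrr addr0 mulmxBl -!mulmxA mxtraceD raddfN /=.
  rewrite [X in _ - X]mxtrace_mulC -!mulmxA !tr_delta => /eqP; rewrite subr_eq0 => /eqP.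
  by move=> ->.
have arith (a b c e f g p : nat) : (a + b = c -> e + f = g -> b <= e -> a <= 1 ->
    c <= f + 1 -> g = p + p -> c <= p + 1)%N by lia.
rewrite -eV0; exact: arith (limg_ker_dim D0 V0) (limg_ker_dim D1 V1) (dimvS W1) k0 perp eV1.
Qed.

End BrickRank.

(** * Modules as graded spaces with two commuting operators *)

Section Operators.
Variables (k : fieldType) (n : nat) (X : rep k n).
Hypothesis hX : is_mod X.

Lemma idem_fwd i : idem X i *m fwd X = amx X i.
Proof.
rewrite /fwd mulmx_sumr (bigD1 i) //= big1 ?addr0 => [|j ne].
  by have := idem_arr (i, true) i hX; rewrite /= eqxx.
by have := idem_arr (j, true) i hX; rewrite /= eq_sym (negbTE ne).
Qed.

Lemma fwd_idem i : fwd X *m idem X (ordS i) = amx X i.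
Proof.
rewrite /fwd mulmx_suml (bigD1 i) //= big1 ?addr0 => [|j ne].
  by have := arr_idem (i, true) (ordS i) hX; rewrite /= eqxx.
by have := arr_idem (j, true) (ordS i) hX; rewrite /= (inj_eq (@ordS_inj n)) (negbTE ne).
Qed.

Lemma idem_bwd i : idem X (ordS i) *m bwd X = bmx X i.
Proof.
rewrite /bwd mulmx_sumr (bigD1 i) //= big1 ?addr0 => [|j ne].
  by have := idem_arr (i, false) (ordS i) hX; rewrite /= eqxx.
by have := idem_arr (j, false) (ordS i) hX; rewrite /= (inj_eq (@ordS_inj n)) eq_sym (negbTE ne).
Qed.

Lemma bwd_idem i : bwd X *m idem X i = bmx X i.
Proof.
rewrite /bwd mulmx_suml (bigD1 i) //= big1 ?addr0 => [|j ne].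
  by have := arr_idem (i, false) i hX; rewrite /= eqxx.
by have := arr_idem (j, false) i hX; rewrite /= (negbTE ne).
Qed.

Lemma fwd_bwd : fwd X *m bwd X = bwd X *m fwd X.
Proof.
have [[_ _ _ _ rel] _] := hX.
have eab : fwd X *m bwd X = \sum_i amx X i *m bmx X i.
  rewrite {1}/fwd mulmx_suml; apply: eq_bigr => i _.
  have e1 : idem X (ordS i) *m bmx X i = bmx X i.
    by have := idem_arr (i, false) (ordS i) hX; rewrite /= eqxx.
  by rewrite -(fwd_idem i) -!mulmxA idem_bwd e1.
have eba : bwd X *m fwd X = \sum_i bmx X i *m amx X i.
  rewrite {1}/bwd mulmx_suml; apply: eq_bigr => i _.
  have e1 : idem X i *m amx X i = amx X i.
    by have := idem_arr (i, true) i hX; rewrite /= eqxx.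
  by rewrite -(bwd_idem i) -!mulmxA idem_fwd e1.
by apply/eqP; rewrite -subr_eq0 eab eba -sumrB rel.
Qed.

Lemma hom_fwd Y (f : 'M[k]_(rd X, rd Y)) : is_mod Y ->
  (forall i, idem X i *m f = f *m idem Y i) ->
  fwd X *m f = f *m fwd Y -> bwd X *m f = f *m bwd Y -> is_hom f.
Proof.
move=> hY e ef eb i; split=> //.
  rewrite -idem_fwd -mulmxA ef mulmxA e -mulmxA; congr (_ *m _).
  rewrite /fwd mulmx_sumr (bigD1 i) //= big1 ?addr0 => [|j ne].
    by have := idem_arr (i, true) i hY; rewrite /= eqxx.
  by have := idem_arr (j, true) i hY; rewrite /= eq_sym (negbTE ne).
rewrite -bwd_idem -mulmxA e mulmxA eb -mulmxA; congr (_ *m _).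
rewrite /bwd mulmx_suml (bigD1 i) //= big1 ?addr0 => [|j ne].
  by have := arr_idem (i, false) i hY; rewrite /= eqxx.
by have := arr_idem (j, false) i hY; rewrite /= (negbTE ne).
Qed.

End Operators.

Section Adapted.
Variables (k : fieldType) (n : nat) (X : rep k n).
Hypothesis hX : is_mod X.

Let T := {i : 'I_n & 'I_(\rank (idem X i))}.
Let Ri i := row_base (idem X i).
Let Ci i := col_base (idem X i).

Let RC i j (a : 'I_(\rank (idem X i))) (b : 'I_(\rank (idem X j))) :
  (Ri i *m Ci j) a b = (Tagged (fun i => 'I_(\rank (idem X i))) a ==
                        Tagged (fun i => 'I_(\rank (idem X i))) b)%:R.
Proof.
have [[_ h2 _ _ _] _] := hX; have eb i' : Ci i' *m Ri i' = idem X i' by apply: mulmx_base.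
have [e|ne] := eqVneq i j; last first.
  have -> : Ri i *m Ci j = 0.
    apply: (row_full_inj (col_base_full (idem X i))); apply: (row_free_inj (row_base_free (idem X j))).
    by rewrite mulmx0 mul0mx (mulmxA (Ci i)) eb -(mulmxA (idem X i)) eb h2 (negbTE ne).
  rewrite mxE; case: eqP => // /(congr1 tag) /= e; by rewrite e eqxx in ne.
case: j / e b => b; rewrite eq_Tagged /=.
have -> : Ri i *m Ci i = 1%:M.
  apply: (row_full_inj (col_base_full (idem X i))); apply: (row_free_inj (row_base_free (idem X i))).
  by rewrite mulmx1 (mulmxA (Ci i)) eb -(mulmxA (idem X i)) eb h2 eqxx.
by rewrite mxE.
Qed.

(** The row bases of the idempotents together form a basis of [X], inverted by the column bases. It
    makes every idempotent diagonal, the setting of [brick_rank]. *)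
Lemma adapted_basis : exists Y, exists (f : 'M[k]_(rd Y, rd X)) (vt : 'I_(rd Y) -> 'I_n),
  [/\ is_hom f, row_free f, row_full f &
      forall i, idem Y i = diag_mx (\row_s (vt s == i)%:R)].
Proof.
have [[h1 h2 _ _ _] _] := hX.
pose P : 'M[k]_(#|{: T}|, rd X) := \matrix_(s, u) Ri (tag (enum_val s)) (tagged (enum_val s)) u.
pose Q : 'M[k]_(rd X, #|{: T}|) := \matrix_(u, s) Ci (tag (enum_val s)) u (tagged (enum_val s)).
have PQ : P *m Q = 1%:M.
  apply/matrixP => s t; rewrite [RHS]mxE -(inj_eq enum_val_inj).
  have -> : (P *m Q) s t = (Ri (tag (enum_val s)) *m Ci (tag (enum_val t)))
      (tagged (enum_val s)) (tagged (enum_val t)).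
    by rewrite !mxE; apply: eq_bigr => u _; rewrite !mxE.
  case: (enum_val s) (enum_val t) => [i a] [j b]; exact: RC.
have QP : Q *m P = 1%:M.
  rewrite -h1; apply/matrixP => u v; rewrite mxE summxE.
  rewrite (eq_bigr (fun i => \sum_(a < \rank (idem X i)) Ci i u a * Ri i a v)); last first.
    by move=> i _; rewrite -{1}[idem X i]mulmx_base mxE.
  rewrite sig_big_dep /= (reindex (@enum_rank _)) /=; last by apply: onW_bij; apply: enum_rank_bij.
  by apply: eq_bigr => t _; rewrite !mxE enum_rankK.
pose c M := P *m M *m Q.
pose Y := @Rep k n _ (fun i => c (idem X i)) (fun i => c (amx X i)) (fun i => c (bmx X i)).
exists Y, P, (fun s => tag (enum_val s)); split.
- by move=> i; split; rewrite /= /c -!mulmxA QP mulmx1.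
- by apply/row_freeP; exists Q.
- by apply/row_fullP; exists Q.
move=> i; rewrite /= /c; set D := diag_mx _.
suff -> : P *m idem X i = D *m P by rewrite -mulmxA PQ mulmx1.
rewrite /D mul_diag_mx; apply/matrixP => s u; rewrite [RHS]mxE [X in X * _]mxE.
have -> : P s u = (Ri (tag (enum_val s)) *m 1%:M) (tagged (enum_val s)) u by rewrite mulmx1 mxE.
have -> : (P *m idem X i) s u = (Ri (tag (enum_val s)) *m idem X i) (tagged (enum_val s)) u.
  by rewrite !mxE; apply: eq_bigr => v _; rewrite mxE.
rewrite mulmx1; case: (enum_val s) => j a /=.
have e0 : Ri j *m idem X i = (j == i)%:R *: Ri j.
  have /submxP[M eM] : (Ri j <= idem X j)%MS by rewrite eq_row_base.
  rewrite eM -mulmxA h2; case: (j == i); first by rewrite scale1r.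
  by rewrite mulmx0 scale0r.
by rewrite e0 mxE.
Qed.

End Adapted.

(** * Vectors on a cycle with small Euler form *)

Section IntervalDim.
Variables (n : nat) (d : 'I_n -> nat).
Hypothesis n0 : (0 < n)%N.
Hypothesis dd : (\sum_i d i * d i <= \sum_i d i * d (ordS i) + 1)%N.

Let de (i : 'I_n) : int := (d (ord_pred i))%:Z - (d i)%:Z.

Let reindexS (V : nmodType) (F : 'I_n -> V) : \sum_i F (ordS i) = \sum_i F i.
Proof. by rewrite [RHS](reindex _ (onW_bij _ (ordS_bij n))). Qed.

Let reindexP (V : nmodType) (F : 'I_n -> V) : \sum_i F (ord_pred i) = \sum_i F i.
Proof. by rewrite [RHS](reindex _ (onW_bij _ (ord_pred_bij n))). Qed.

Let sum_de : \sum_i de i = 0.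
Proof. by rewrite sumrB (reindexP (fun i => (d i)%:Z)) subrr. Qed.

(** Expanding the squares gives twice the difference of the two sums in [dd], so the constant 1
    there becomes 2. *)
Let sum_de2 : \sum_i de i ^+ 2 <= 2.
Proof.
have e : \sum_i de i ^+ 2 = 2 * \sum_i (d i * d i)%:Z - 2 * \sum_i (d i * d (ordS i))%:Z.
  have h1 := reindexP (fun i => (d i * d i)%:Z).
  have h2 : \sum_i (d (ord_pred i) * d i)%:Z = \sum_i (d i * d (ordS i))%:Z.
    by rewrite -reindexS; apply: eq_bigr => i _; rewrite ordSK.
  rewrite (eq_bigr (fun i => (d (ord_pred i) * d (ord_pred i))%:Z + (d i * d i)%:Z -
    2 * (d (ord_pred i) * d i)%:Z)); last by move=> i _; rewrite /de !PoszM; ring.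
  have two (a : int) : a + a = 2 * a by ring.
  by rewrite sumrB big_split /= h1 -mulr_sumr h2 two.
rewrite e -!(big_morph Posz PoszD (erefl _)).
by move: dd; lia.
Qed.

(** Summation by parts turns the pairing into the sum of [x i * de i]. Integers of sum zero and
    square sum at most 2 either all vanish, and then [p = q], or are 1 at one [p], -1 at one [q] and
    zero elsewhere. *)
Lemma interval_dim (R : realType) : exists p q, forall x : 'I_n -> R,
  \sum_i (x (ordS i) - x i) * (d i)%:R = x p - x q.
Proof.
have key (x : 'I_n -> R) : \sum_i (x (ordS i) - x i) * (d i)%:R = \sum_i x i * (de i)%:~R.
  rewrite (eq_bigr (fun i => x (ordS i) * (d (ord_pred (ordS i)))%:R - x i * (d i)%:R)).
    rewrite sumrB (reindexS (fun i => x i * (d (ord_pred i))%:R)) -sumrB.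
    by apply: eq_bigr => i _; rewrite /de rmorphB /= mulrBr.
  by move=> i _; rewrite ordSK mulrBl.
have [all0|] := boolP [forall i, de i == 0].
  exists (Ordinal n0), (Ordinal n0) => x; rewrite key subrr big1 // => i _.
  by rewrite (eqP (forallP all0 i)) mulr0.
rewrite negb_forall => /existsP[i0 ni0].
have [p hp] : exists p, 0 < de p.
  apply/existsP; apply: contra_neqT ni0; rewrite negb_exists => /forallP h.
  have h' i : 0 <= - de i by rewrite oppr_ge0 leNgt h.
  have : \sum_i - de i == 0 by rewrite sumrN sum_de oppr0.
  by rewrite psumr_eq0 // => /allP /(_ i0 (mem_index_enum _)); rewrite oppr_eq0 => /eqP.
have [q hq] : exists q, de q < 0.
  apply/existsP; apply: contra_neqT ni0; rewrite negb_exists => /forallP h.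
  have h' i : 0 <= de i by rewrite leNgt h.
  have : \sum_i de i == 0 by rewrite sum_de.
  by rewrite psumr_eq0 // => /allP /(_ i0 (mem_index_enum _)) /eqP.
have npq : q != p by apply/eqP => e; move: hq; rewrite e; lia.
exists p, q => x; rewrite key (bigD1 p) //= (bigD1 q) //=.
move: sum_de2; rewrite (bigD1 p) //= (bigD1 q) //=.
set s := \sum_(i | _) _ => hs.
have s0 : 0 <= s by apply: sumr_ge0 => i _; apply: sqr_ge0.
have p1 : 1 <= de p ^+ 2 by nia.
have q1 : 1 <= de q ^+ 2 by nia.
have ep : de p = 1 by nia.
have eq : de q = -1 by nia.
have es : s = 0 by lia.
rewrite ep eq big1 ?addr0 => [|i hi]; first by rewrite mulr1 mulrN1.
have /eqP := es; rewrite psumr_eq0 => [|j _]; last exact: sqr_ge0.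
move=> /allP /(_ i (mem_index_enum _)); rewrite hi /= sqrf_eq0 => /eqP ->.
by rewrite mulr0.
Qed.

End IntervalDim.

(** * TF equivalence on H *)

Section Patterns.
Variables (R : realType) (n : nat).

(* The elements of H are the cyclic differences of functions x on the vertices,
   with x unique up to a constant; in these coordinates W' permutes the values
   of x. *)
Definition th_of (x : 'I_n -> R) : 'rV[R]_n := \row_i (x (ordS i) - x i).
Definition same_pattern (x y : 'I_n -> R) := forall i j, (x i < x j) = (y i < y j).

Lemma sum_ordS (V : nmodType) (F : 'I_n -> V) : \sum_i F (ordS i) = \sum_i F i.
Proof. by rewrite [RHS](reindex _ (onW_bij _ (ordS_bij n))). Qed.

Lemma inH_th_of x : inH (th_of x).
Proof.
rewrite /inH (eq_bigr (fun i => x (ordS i) - x i)) => [|i _]; last by rewrite mxE.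
by rewrite sumrB sum_ordS subrr.
Qed.

Lemma val_ordS_last (i : 'I_n) : is_last i -> ordS i = 0%N :> nat.
Proof.
by move=> /eqP e; rewrite /= e prednK ?modnn //; have := ltn_ord i; lia.
Qed.

Lemma not_last (i : 'I_n) : ~~ is_last i -> (i.+1 < n)%N.
Proof. by rewrite /is_last => /eqP; have := ltn_ord i; lia. Qed.

Lemma inHP th : inH th -> exists x, th = th_of x.
Proof.
move=> h; exists (fun i => \sum_(l < n | (l < i)%N) th 0 l); apply/rowP => i; rewrite mxE.
have [hl|/not_last hl] := boolP (is_last i).
  rewrite (val_ordS_last hl) big_pred0 // sub0r; move: h; rewrite /inH (bigD1 i) //=.
  move/eqP; rewrite addr_eq0 => /eqP ->; congr (- _); apply: eq_bigl => l.
  by rewrite -val_eqE /= (eqP hl); have := ltn_ord l; lia.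
rewrite val_ordS_lt // [X in _ = X - _](bigD1 i) //= ?ltnSn //.
rewrite (eq_bigl (fun l : 'I_n => (l < i)%N)) ?addrK // => l.
by rewrite -val_eqE /=; lia.
Qed.

End Patterns.

Section ThinTF.
Variables (k : fieldType) (R : realType) (n : nat).
Implicit Types (th eta : 'rV[R]_n).

(** Passing from [D p] to [D p.+1] as weight of the partial sum [a p.+1 - a i] never decreases the
    product, since [D] moves in the direction of its sign. *)
Lemma abel_sum_le (a : nat -> R) (D : nat -> nat) i m :
  (forall p, (i <= p < i + m)%N -> if a i < a p.+1 then (D p <= D p.+1)%N else (D p.+1 <= D p)%N) ->
  \sum_(i <= v < (i + m).+1) (a v.+1 - a v) * (D v)%:R <=
  (a (i + m).+1%N - a i) * (D (i + m)%N)%:R.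
Proof.
elim: m => [|m IH] h; first by rewrite addn0 big_nat1.
rewrite addnS big_nat_recr /=; last lia.
have /IH : forall p, (i <= p < i + m)%N ->
    if a i < a p.+1 then (D p <= D p.+1)%N else (D p.+1 <= D p)%N by move=> p hp; apply: h; lia.
set S := \sum_(i <= v < _) _ => hS.
have step : (a (i + m).+1%N - a i) * (D (i + m)%N)%:R <=
    (a (i + m).+1%N - a i) * (D (i + m).+1%N)%:R.
  have hm : (i <= i + m < i + m.+1)%N by lia.
  have := h (i + m)%N hm; case: ltP => le hD.
    by apply: ler_wpM2l; rewrite ?subr_ge0 ?ler_nat // ltW.
  by apply: ler_wnM2l; rewrite ?subr_le0 ?ler_nat.
apply: le_trans (lerD (le_trans hS step) (lexx _)) _.
by rewrite -mulrDl addrC addrA subrK.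
Qed.

Lemma sum_ord_interval (F : 'I_n -> R) (G : nat -> R) i j : (j <= n)%N ->
  (forall v : 'I_n, (i <= v < j)%N -> F v = G v) ->
  \sum_(v < n | (i <= v < j)%N) F v = \sum_(i <= p < j) G p.
Proof.
move=> jn FG; rewrite (big_nat_widen _ _ n) // (big_nat_widenl _ 0) // big_mkord.
by rewrite (eq_bigr (fun v : 'I_n => G v)) => [|v /FG //]; apply: eq_bigl => v /=; rewrite andbC.
Qed.

Definition ivsum th (i j : nat) : R := \sum_(v < n | (i <= v < j)%N) th 0 v.

(* Orient the edge between the vertices p-1 and p of the interval towards p
   exactly when th[i, p) > 0. *)
Lemma thin_TF th (i j : nat) : (i < j <= n)%N -> exists X : rep k n,
  [/\ is_mod X, (j <= n.-1)%N -> is_mod' X,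
      forall eta, pair eta (dimv X) = ivsum eta i j,
      0 <= ivsum th i j -> Tbar th X & ivsum th i j <= 0 -> Fbar th X].
Proof.
move=> /andP[ij jn]; have n0 : (0 < n)%N by lia.
pose ordn p : 'I_n := insubd (Ordinal n0) p.
have ordnE p : (p < n)%N -> ordn p = p :> nat by move=> h; rewrite val_insubd h.
pose a p := \sum_(v < n | (v < p)%N) th 0 v.
have aS p : (p < n)%N -> a p.+1 - a p = th 0 (ordn p).
  move=> pn; rewrite /a (bigD1 (ordn p)) /= ?ordnE //.
  rewrite (eq_bigl (fun v : 'I_n => (v < p)%N)) ?addrK // => v.
  by rewrite -val_eqE /= ordnE //; lia.
pose eps p := a i < a p.
pose X := thin k n i j eps; have hX : is_mod X := @is_mod_thin k n i j eps jn.
have pairX eta : pair eta (dimv X) = ivsum eta i j.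
  rewrite /pair /ivsum [RHS]big_mkcond; apply: eq_bigr => v _.
  by rewrite dimv_thin; case: ifP; rewrite ?mulr1 ?mulr0.
have dim0 (U : 'M[k]_(rd X)) (v : 'I_n) : (subdim U v <= dimv X v)%N by apply: mxrankM_maxr.
have aij : a j - a i = ivsum th i j.
  suff -> : a j = a i + ivsum th i j by rewrite addrC addKr.
  rewrite {1}/a (bigID (fun v : 'I_n => (v < i)%N)) /=; congr (_ + _).
    by apply: eq_bigl => v /=; apply/andP/idP => [[]//|h]; split=> //; lia.
  by apply: eq_bigl => v /=; rewrite -leqNgt andbC.
(* Abel summation leaves only the dimension of [U] at the right end [j.-1] of the interval, which is
   0 or 1. Both memberships follow from this one bound. *)
have key (U : 'M[k]_(rd X)) : stab U ->
    pair th (subdim U) <= ivsum th i j * (subdim U (ordn j.-1))%:R.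
  move=> sU; pose D p : nat := subdim U (ordn p); pose m := (j.-1 - i)%N.
  have ej : j = (i + m).+1 by rewrite /m; lia.
  have -> : pair th (subdim U) = \sum_(i <= v < (i + m).+1) (a v.+1 - a v) * (D v)%:R.
    have D0 (v : 'I_n) : ~~ (i <= v < j)%N -> subdim U v = 0%N.
      move=> /negbTE h; apply/eqP; rewrite -leqn0; apply: leq_trans (dim0 U v) _.
      by rewrite dimv_thin // h.
    rewrite -ej -(@sum_ord_interval (fun v => th 0 v * (subdim U v)%:R)) // => [|v hv].
      rewrite [RHS]big_mkcond; apply: eq_bigr => v _; case: ifP => // /negbT /D0 ->.
      by rewrite mulr0.
    by rewrite aS // /D; have -> : ordn v = v by apply: ord_inj; rewrite ordnE.
  rewrite -aij [in X in _ <= X]ej; apply: abel_sum_le => p hp.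
  have pn : (p < n)%N by lia.
  have := @thin_edge k n i j eps jn U (ordn p) (ordn p.+1) sU.
  rewrite !ordnE; [|lia..]; have h1 : (i <= p)%N by lia. have h2 : (p.+1 < j)%N by lia. move/(_ h1 erefl h2).
  by rewrite /eps.
exists X; split=> //.
- move=> jn1; split=> // v /eqP vl; apply/eqP; rewrite -mxrank_eq0 -/(dimv X v) dimv_thin vl.
  by rewrite eqb0; lia.
- move=> ge0; split=> // U sU.
  have -> : pair th (fun v => @subdim _ _ X 1%:M v - subdim U v)%N =
      pair th (dimv X) - pair th (subdim U).
    rewrite /pair -sumrB; apply: eq_bigr => v _; rewrite -mulrBr; congr (_ * _).
    by rewrite natrB ?/subdim ?mul1mx // dim0.
  rewrite subr_ge0; apply: le_trans (key U sU) _; rewrite pairX.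
  rewrite -[X in _ <= X]mulr1 ler_wpM2l // -[1]/(1%:R) ler_nat.
  by apply: leq_trans (dim0 U _) _; rewrite dimv_thin leq_b1.
move=> le0; split=> // U sU; apply: le_trans (key U sU) _.
by rewrite mulr_le0_ge0.
Qed.

(** Equivalence tested on Pi'-modules alone, which is all that complexes over Pi' control. *)
Definition TFeq' th eta :=
  (forall X : rep k n, is_mod' X -> Tbar th X <-> Tbar eta X) /\
  (forall X : rep k n, is_mod' X -> Fbar th X <-> Fbar eta X).

(** If th[i, j) is nonnegative, the thin module built for [th] lies in Tbar of [th], hence of [eta],
    so eta[i, j) is nonnegative; the one built for [eta] gives the converse. The guarded hypotheses
    cover all modules as well as Pi'-modules. *)
Lemma TF_ivsum_sign th eta i j : (i < j <= n)%N ->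
  (forall X : rep k n, ((j <= n.-1)%N -> is_mod' X) -> Tbar th X <-> Tbar eta X) ->
  (forall X : rep k n, ((j <= n.-1)%N -> is_mod' X) -> Fbar th X <-> Fbar eta X) ->
  (0 <= ivsum th i j) = (0 <= ivsum eta i j) /\ (ivsum th i j <= 0) = (ivsum eta i j <= 0).
Proof.
have T0 (t : 'rV[R]_n) (X : rep k n) : is_mod X -> Tbar t X -> 0 <= pair t (dimv X).
  by move=> _ /TbarP[_ h]; apply: (h X 1%:M); [exact: hom1 | rewrite -sub1mx].
have F0 (t : 'rV[R]_n) (X : rep k n) : is_mod X -> Fbar t X -> pair t (dimv X) <= 0.
  by move=> _ /FbarP[_ h]; apply: (h X 1%:M); [exact: hom1 | rewrite row_free_unit unitmx1].
move=> hij hT hF; have [X [hX hX' pX XT XF]] := thin_TF th hij.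
have [Y [hY hY' pY YT YF]] := thin_TF eta hij.
split; apply/idP/idP.
- by move/XT/(hT _ hX')/(T0 _ _ hX); rewrite pX.
- by move/YT/(hT _ hY')/(T0 _ _ hY); rewrite pY.
- by move/XF/(hF _ hX')/(F0 _ _ hX); rewrite pX.
- by move/YF/(hF _ hY')/(F0 _ _ hY); rewrite pY.
Qed.

Lemma ivsum_th_of (x : 'I_n -> R) (i j : 'I_n) : (i <= j)%N -> ivsum (th_of x) i j = x j - x i.
Proof.
move=> ij; have n0 : (0 < n)%N by have := ltn_ord i; lia.
pose ordn p : 'I_n := insubd (Ordinal n0) p.
have ordnE p : (p < n)%N -> ordn p = p :> nat by move=> h; rewrite val_insubd h.
have ordnK (v : 'I_n) : ordn v = v by apply: ord_inj; rewrite ordnE.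
rewrite /ivsum (@sum_ord_interval _ (fun p => x (ordn p.+1) - x (ordn p))) => [||v hv].
- by rewrite (telescope_sumr (fun p => x (ordn p))) // !ordnK.
- exact: ltnW.
rewrite mxE ordnK; congr (x _ - _); apply: ord_inj; have := ltn_ord j => jn.
by rewrite val_ordS_lt ?ordnE //; lia.
Qed.

End ThinTF.

(** * Bricks and the signs they detect *)

Section Bricks.
Variables (k : closedFieldType) (R : realType) (n : nat).
Hypothesis n0 : (0 < n)%N.
Implicit Types (X Y N : rep k n) (th eta : 'rV[R]_n).

Definition is_brick X := forall f : 'M[k]_(rd X), is_hom f -> exists a, f = a%:M.

Lemma brick_dim X : is_mod X -> is_brick X ->
  exists p q, forall x : 'I_n -> R, pair (th_of x) (dimv X) = x p - x q.
Proof.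
move=> hX bX; have [Y [P [vt [hP fP uP eY]]]] := adapted_basis hX.
have hY : is_mod Y := is_mod_inj hP fP hX.
have [Q [hQ PQ QP]] := hom_inv hP fP uP.
have entry i (M : 'M[k]_(rd Y)) s t : (idem Y i *m M) s t = (vt s == i)%:R * M s t.
  by rewrite eY mul_diag_mx !mxE.
have entry' i (M : 'M[k]_(rd Y)) s t : (M *m idem Y i) s t = M s t * (vt t == i)%:R.
  by rewrite eY mul_mx_diag !mxE.
have dY i : dimv X i = #|[pred s | vt s == i]|.
  by rewrite -(dimv_iso i hP fP uP) /dimv eY rank_diag_pred.
have [|p [q pq]] := @interval_dim n (dimv X) n0 _ R.
  rewrite (eq_bigr (fun i => #|[pred s | vt s == i]| * #|[pred s | vt s == i]|)%N); last first.
    by move=> i _; rewrite dY.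
  rewrite [X in (_ <= X + 1)%N](eq_bigr (fun i =>
    #|[pred s | vt s == i]| * #|[pred s | vt s == ordS i]|)%N); last by move=> i _; rewrite !dY.
  apply: (@brick_rank k _ n vt (fwd Y) (bwd Y)).
  - move=> s t ne; rewrite /fwd summxE big1 // => i _.
    rewrite -(idem_fwd hY) entry; case: eqP => [e|_]; last by rewrite mul0r.
    rewrite mul1r; have := entry' (ordS i) (fwd Y) s t; rewrite fwd_idem //.
    by rewrite -e (negbTE ne) mulr0 -(idem_fwd hY) entry eqxx mul1r => ->.
  - move=> s t ne; rewrite /bwd summxE big1 // => i _.
    rewrite -(bwd_idem hY) entry'; case: eqP => [e|_]; last by rewrite mulr0.
    rewrite mulr1; have := entry (ordS i) (bwd Y) s t; rewrite idem_bwd //.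
    by rewrite -e (negbTE ne) mul0r -(bwd_idem hY) entry' eqxx mulr1 => ->.
  - exact: fwd_bwd.
  move=> f sf fA fB.
  have hf : is_hom f.
    apply: hom_fwd => // i; apply/matrixP => s t; rewrite entry entry'.
    have [->|ne] := eqVneq (vt s) (vt t); first by rewrite mulrC.
    by rewrite sf // mulr0 mul0r.
  have [a ea] := bX _ (hom_comp (hom_comp hQ hf) hP).
  have e3 : f = P *m (Q *m f *m P) *m Q by rewrite !mulmxA PQ mul1mx -mulmxA PQ mulmx1.
  by exists a; rewrite e3 ea mul_mx_scalar -scalemxAl PQ scalemx1.
by exists p, q => x; rewrite -pq; apply: eq_bigr => i _; rewrite mxE.
Qed.

(** Subtract an eigenvalue from a non-scalar endomorphism. *)
Lemma not_brick_endo X : (0 < rd X)%N -> ~ is_brick X ->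
  exists f : 'M[k]_(rd X), [/\ is_hom f, f != 0 & ~~ row_free f].
Proof.
move=> d0 /existsNP[f /not_implyP[hf /forallNP ns]].
have [a ra] : exists a, root (char_poly f) a.
  by apply/closed_rootP; rewrite size_char_poly; case: (rd X) d0.
exists (f - a%:M); split.
- by apply: homB => //; rewrite -scalemx1; apply: homZ; apply: hom1.
- by rewrite subr_eq0; apply/eqP => /ns.
move: ra; rewrite -eigenvalue_root_char /eigenvalue /eigenspace.
by rewrite -kermx_eq0.
Qed.

Lemma endo_exact X (f : 'M[k]_(rd X)) : is_mod X -> is_hom f -> f != 0 -> ~~ row_free f ->
  exists I K Q (p : 'M[k]_(rd X, rd I)) (i : 'M[k]_(rd I, rd X)) (j : 'M[k]_(rd K, rd X))
    (q : 'M[k]_(rd X, rd Q)),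
  [/\ [/\ is_hom p, row_full p & (rd I < rd X)%N], [/\ is_hom i & row_free i],
      [/\ is_hom j, row_free j & (rd K < rd X)%N], [/\ is_hom q, row_full q & (rd Q < rd X)%N] &
      forall th, pair th (dimv X) = pair th (dimv K) + pair th (dimv I) /\
                 pair th (dimv X) = pair th (dimv I) + pair th (dimv Q)].
Proof.
move=> hX hf nf nff.
have [I [i [hi fi ei]]] := sub_exists (stab_hom hf).
have [p hp ep] := factor_inj hi fi hf (submx_refl _) ei.
have [K [j [hj fj ej]]] := sub_exists (stab_ker hf).
have [Q [q [hq fq eq]]] := quot_exists (stab_hom hf).
have rI : rd I = \rank f by rewrite -ei; apply/esym/eqP.
have fp : row_full p by rewrite /row_full -(mxrankMfree p fi) ep rI.
have ekp : (j :=: kermx p)%MS.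
  apply: eqmx_trans ej _; apply/eqmxP/andP; split.
    apply/sub_kermxP/(row_free_inj fi); rewrite mul0mx -mulmxA ep; exact: mulmx_ker.
  by apply/sub_kermxP; rewrite -ep mulmxA mulmx_ker mul0mx.
have eiq : (i :=: kermx q)%MS by apply: eqmx_trans ei (eqmx_sym eq).
have rf : (0 < \rank f)%N by rewrite lt0n mxrank_eq0.
have rf' : (\rank f < rd X)%N by rewrite ltn_neqAle rank_leq_row andbT.
have r1 := rd_exact fj fp ekp; have r2 := rd_exact fi fq eiq.
exists I, K, Q, p, i, j, q; split; try by split=> //; lia.
move=> th; split; rewrite -pairD; apply: pair_eq => l.
  exact: dimv_exact hX hj fj hp fp ekp.
exact: dimv_exact hX hi fi hq fq eiq.
Qed.

Lemma pair_gt0_rd th X : pair th (dimv X) != 0 -> (0 < rd X)%N.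
Proof.
apply: contraNltn; rewrite leqn0 => /eqP d0; rewrite /pair big1 // => i _.
suff -> : dimv X i = 0%N by rewrite mulr0.
by apply/eqP; rewrite -leqn0; apply: leq_trans (rank_leq_row _) _; rewrite d0.
Qed.

(** The image and the cokernel of a non-zero singular endomorphism are proper quotients whose
    classes add up to that of [X]; one of them is again negative. *)
Lemma brick_quotient th X : is_mod X -> pair th (dimv X) < 0 ->
  exists N (g : 'M[k]_(rd X, rd N)),
    [/\ is_hom g, row_full g, is_brick N & pair th (dimv N) < 0].
Proof.
have [m le] := ubnP (rd X); elim: m X le => // m IH X le hX neg.
have [bX|nb] := EM (is_brick X).
  by exists X, 1%:M; split; [exact: hom1 | rewrite -sub1mx | |].
have [|f [hf nf nff]] := not_brick_endo _ nb; first by apply: (@pair_gt0_rd th); rewrite lt_eqF.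
have [I [K [Q [p [i [j [q [[hp fp lI] _ _ [hq fq lQ] /(_ th)[_ e]]]]]]]]] := endo_exact hX hf nf nff.
have step Y (g : 'M[k]_(rd X, rd Y)) : is_hom g -> row_full g -> (rd Y < rd X)%N ->
    pair th (dimv Y) < 0 -> exists N (g : 'M[k]_(rd X, rd N)),
    [/\ is_hom g, row_full g, is_brick N & pair th (dimv N) < 0].
  move=> hg fg lY nY; have [|N [g' [hg' fg' bN nN]]] := IH Y (leq_trans lY le) _ nY.
    exact: is_mod_surj hg fg hX.
  exists N, (g *m g'); split=> //; first exact: hom_comp.
  by rewrite /row_full eqmxMfull.
have [nI|pI] := ltP (pair th (dimv I)) 0; first exact: (step I p).
by apply: (step Q q) => //; move: neg; rewrite e; lra.
Qed.

Lemma brick_submodule th X : is_mod X -> 0 < pair th (dimv X) ->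
  exists N (g : 'M[k]_(rd N, rd X)),
    [/\ is_hom g, row_free g, is_brick N & 0 < pair th (dimv N)].
Proof.
have [m le] := ubnP (rd X); elim: m X le => // m IH X le hX pos.
have [bX|nb] := EM (is_brick X).
  by exists X, 1%:M; split; [exact: hom1 | rewrite row_free_unit unitmx1 | |].
have [|f [hf nf nff]] := not_brick_endo _ nb; first by apply: (@pair_gt0_rd th); rewrite gt_eqF.
have [I [K [Q [p [i [j [q [[_ _ lI] [hi fi] [hj fj lK] _ /(_ th)[e _]]]]]]]]] :=
  endo_exact hX hf nf nff.
have step Y (g : 'M[k]_(rd Y, rd X)) : is_hom g -> row_free g -> (rd Y < rd X)%N ->
    0 < pair th (dimv Y) -> exists N (g : 'M[k]_(rd N, rd X)),
    [/\ is_hom g, row_free g, is_brick N & 0 < pair th (dimv N)].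
  move=> hg fg lY nY; have [|N [g' [hg' fg' bN nN]]] := IH Y (leq_trans lY le) _ nY.
    exact: is_mod_inj hg fg hX.
  exists N, (g' *m g); split=> //; first exact: hom_comp.
  by rewrite /row_free mxrankMfree.
have [nI|pI] := ltP 0 (pair th (dimv I)); first exact: (step I i).
by apply: (step K j) => //; move: pos; rewrite e; lra.
Qed.

(** A quotient violating Tbar has a brick quotient violating it. On a brick the two functionals take
    the values [x p - x q] and [y p - y q], of equal sign. Submodules do the same for Fbar. *)
Lemma pattern_TFeq (x y : 'I_n -> R) : same_pattern x y -> TFeq k (th_of x) (th_of y).
Proof.
have T (x' y' : 'I_n -> R) (X : rep k n) : same_pattern x' y' -> Tbar (th_of x') X -> Tbar (th_of y') X.
  move=> xy /TbarP[hX h]; apply/TbarP; split=> // Y g hg fg; rewrite leNgt; apply/negP => neg.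
  have hY := is_mod_surj hg fg hX.
  have [N [f [hf ff bN nN]]] := brick_quotient hY neg.
  have hN := is_mod_surj hf ff hY; have [p [q pq]] := brick_dim hN bN.
  have := h N (g *m f) (hom_comp hg hf); rewrite /row_full eqmxMfull // -/(row_full f) => /(_ ff).
  by move: nN; rewrite !pq subr_lt0 subr_ge0 -xy leNgt => ->.
have F (x' y' : 'I_n -> R) (X : rep k n) : same_pattern x' y' -> Fbar (th_of x') X -> Fbar (th_of y') X.
  move=> xy /FbarP[hX h]; apply/FbarP; split=> // Y g hg fg; rewrite leNgt; apply/negP => pos.
  have hY := is_mod_inj hg fg hX.
  have [N [f [hf ff bN nN]]] := brick_submodule hY pos.
  have hN := is_mod_inj hf ff hY; have [p [q pq]] := brick_dim hN bN.
  have := h N (f *m g) (hom_comp hf hg); rewrite /row_free mxrankMfree // -/(row_free f) => /(_ ff).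
  by move: nN; rewrite !pq subr_gt0 subr_le0 -xy leNgt => ->.
move=> xy; have yx : same_pattern y x by move=> i j; rewrite xy.
by split=> X; split; [exact: T | exact: T | exact: F | exact: F].
Qed.

Lemma TFeq'_pattern (x y : 'I_n -> R) : TFeq' k (th_of x) (th_of y) -> same_pattern x y.
Proof.
move=> [hT hF].
have s (i j : 'I_n) : (i < j)%N -> (x i < x j) = (y i < y j) /\ (x j < x i) = (y j < y i).
  move=> ij; have hj : (j <= n.-1)%N by have := ltn_ord j; lia.
  have hij : (i < j <= n)%N by rewrite ij ltnW.
  have [e1 e2] := @TF_ivsum_sign k R n (th_of x) (th_of y) i j hij
    (fun X h => hT X (h hj)) (fun X h => hF X (h hj)).
  move: e1 e2; rewrite !ivsum_th_of ?(ltnW ij) // !subr_ge0 !subr_le0 => e1 e2.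
  by rewrite !ltNge e1 e2.
move=> i j; case: (ltngtP i j) => [/s[]//|/s[]//|/ord_inj ->].
by rewrite !ltxx.
Qed.

Lemma TFeq_TFeq' th eta : TFeq k th eta -> TFeq' k th eta.
Proof. by move=> [hT hF]; split=> X _; [apply: hT | apply: hF]. Qed.

(** The interval [[0, n)] carries a thin module of dimension vector [h], whose sign is preserved. *)
Lemma TFeq_inH th eta : TFeq k th eta -> inH th -> inH eta.
Proof.
move=> [hT hF]; have hn : (0 < n <= n)%N by rewrite n0 leqnn.
have e (t : 'rV[R]_n) : ivsum t 0 n = \sum_i t 0 i.
  by apply: eq_bigl => v; rewrite ltn_ord.
have [e1 e2] := @TF_ivsum_sign k R n th eta 0 n hn (fun X _ => hT X) (fun X _ => hF X).
rewrite /inH => h; apply/eqP; rewrite eq_le -e -e1 -e2 e h.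
by rewrite lexx.
Qed.

Lemma TFeq_patternP (x y : 'I_n -> R) : TFeq k (th_of x) (th_of y) <-> same_pattern x y.
Proof. by split=> [/TFeq_TFeq'/TFeq'_pattern|/pattern_TFeq]. Qed.

Lemma TFeq'_TFeq (x y : 'I_n -> R) : TFeq' k (th_of x) (th_of y) -> TFeq k (th_of x) (th_of y).
Proof. by move/TFeq'_pattern/pattern_TFeq. Qed.

End Bricks.

(** * The pieces of the Weyl group *)

Section Weyl.
Variables (R : realType) (n : nat).
Hypothesis hn : (1 < n)%N.
Implicit Types (x y z : 'I_n -> R) (J : {set 'I_n}) (w u : seq 'I_n) (s t : {perm 'I_n}).

Let n0 : (0 < n)%N := ltnW hn.

Lemma ordS_neq (j : 'I_n) : ordS j != j.
Proof.
apply/eqP => /(congr1 (@nat_of_ord n)); have [hl|/not_last hl] := boolP (is_last j).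
  by rewrite val_ordS_last // (eqP hl); lia.
by rewrite val_ordS_lt //; lia.
Qed.

Lemma refl_th_of (j : 'I_n) x : refl j (th_of x) = th_of (x \o tperm j (ordS j)).
Proof.
apply/rowP => i; rewrite /refl /alpha !mxE /=.
have nj := ordS_neq j.
have ep l : (l == ord_pred j) = (ordS l == j) by rewrite -(inj_eq (@ordS_inj n)) ord_predK.
have [->|ij] := eqVneq i j.
  rewrite tpermL tpermR ep (negbTE nj) [j == ordS j]eq_sym (negbTE nj) /=; ring.
have [->|iSj] := eqVneq i (ordS j).
  (* The first case is [n = 2], where the two neighbours of [j] coincide. *)
  rewrite tpermR ep; have [->|n2] := eqVneq (ordS (ordS j)) j; first by rewrite tpermL /=; ring.
  by rewrite tpermD /= 1?eq_sym ?ordS_neq //; ring.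
have ti : tperm j (ordS j) i = i by rewrite tpermD // eq_sym.
rewrite ti ep.
have [e|n2] := eqVneq (ordS i) j; first by rewrite e tpermL -e /=; ring.
by rewrite tpermD /= 1?eq_sym ?(inj_eq (@ordS_inj n)) //; ring.
Qed.

Definition wperm w : {perm 'I_n} := (\prod_(j <- w) tperm j (ordS j))%g.

Lemma wact_th_of w x : wact w (th_of x) = th_of (x \o wperm w).
Proof.
elim: w => [|j w IH] /=.
  by rewrite /wperm big_nil; congr th_of; apply: funext => i /=; rewrite perm1.
rewrite IH refl_th_of; congr th_of; apply: funext => i /=.
by rewrite /wperm big_cons permM.
Qed.

Lemma wperm_cat w u : wperm (w ++ u) = (wperm w * wperm u)%g.
Proof. by rewrite /wperm big_cat. Qed.

Lemma refl_linear (j : 'I_n) a (t1 t2 : 'rV[R]_n) :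
  refl j (a *: t1 + t2) = a *: refl j t1 + refl j t2.
Proof. by apply/rowP => i; rewrite /refl !mxE; ring. Qed.

Lemma wact_linear w a (t1 t2 : 'rV[R]_n) :
  wact w (a *: t1 + t2) = a *: wact w t1 + wact w t2.
Proof. by elim: w => //= j w IH; rewrite IH refl_linear. Qed.

Lemma wact_evlast w : wordW' w -> wact w (evlast R n) = evlast R n.
Proof.
elim: w => //= j w IH /andP[hj /IH ->]; rewrite /refl mxE (negbTE hj).
by rewrite scale0r subr0.
Qed.

Lemma wact_cat w u (t1 : 'rV[R]_n) : wact (w ++ u) t1 = wact w (wact u t1).
Proof. exact: foldr_cat. Qed.

Lemma sum_evlast : \sum_i evlast R n 0 i = 1.
Proof.
have h : (n.-1 < n)%N by lia.
rewrite (bigD1 (Ordinal h)) //= big1 ?addr0 ?mxE ?/is_last ?eqxx // => i.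
by rewrite -val_eqE /= mxE /is_last => /negbTE ->.
Qed.

(** [sameCoset] compares actions on the whole space, whereas [wperm] describes them on H only. The
    line of [evlast] is a complement of H fixed by W'. *)
Lemma wact_perm_eq w w' : wordW' w -> wordW' w' -> wperm w = wperm w' ->
  forall t1 : 'rV[R]_n, wact w t1 = wact w' t1.
Proof.
move=> hw hw' e t1; pose c := \sum_i t1 0 i.
have -> : t1 = c *: evlast R n + (t1 - c *: evlast R n) by rewrite addrC subrK.
have [|x ->] := @inHP R n (t1 - c *: evlast R n).
  rewrite /inH (eq_bigr (fun i => t1 0 i - c * evlast R n 0 i)); last by move=> i _; rewrite !mxE.
  by rewrite sumrB -mulr_sumr sum_evlast mulr1 subrr.
by rewrite !wact_linear !wact_evlast // !wact_th_of e.
Qed.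

(** The cone of [J] in the coordinates [x]: weakly increasing functions whose strict steps are
    exactly those in [J]. *)
Definition sortedJ J x := forall j : 'I_n, ~~ is_last j ->
  if j \in J then is_true (x j < x (ordS j)) else x j = x (ordS j).

Lemma ord_pred_last (j : 'I_n) : (0 < j)%N -> ~~ is_last (ord_pred j).
Proof. by move=> h; rewrite /is_last val_ord_pred_gt0 //; have := ltn_ord j; lia. Qed.

Lemma ord_ind_from (i : 'I_n) (P : 'I_n -> Prop) : P i ->
  (forall j : 'I_n, (i <= j)%N -> ~~ is_last j -> P j -> P (ordS j)) ->
  forall j : 'I_n, (i <= j)%N -> P j.
Proof.
move=> Pi PS j; have [m] := ubnP (j - i)%N; elim: m j => // m IH j le ij.
have [->//|ne] := eqVneq j i; have ji : (i < j)%N by rewrite ltn_neqAle ij andbT eq_sym.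
rewrite -(ord_predK j); have hp : ~~ is_last (ord_pred j) by apply: ord_pred_last; lia.
by apply: PS => //; rewrite ?val_ord_pred_gt0; [lia.. | apply: IH; rewrite val_ord_pred_gt0; lia].
Qed.

Lemma sortedJ_le J x (i j : 'I_n) : sortedJ J x -> (i <= j)%N -> x i <= x j.
Proof.
move=> sx; move: j; apply: (@ord_ind_from i (fun j => x i <= x j)) => // j ij hj le.
apply: le_trans le _.
by have := sx j hj; case: ifP => _ => [/ltW|->].
Qed.

Lemma sortedJ_pattern J x y : sortedJ J x -> sortedJ J y -> same_pattern x y.
Proof.
move=> sx sy i j; have [ij|/ltnW ji] := leqP i j; last first.
  by rewrite !ltNge (sortedJ_le sx ji) (sortedJ_le sy ji).
move: j ij; apply: (@ord_ind_from i (fun j => (x i < x j) = (y i < y j))) => [|j ij hj IH].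
  by rewrite !ltxx.
have := sx j hj; have := sy j hj; case: ifP => _ => [h1 h2|<- <- //].
by rewrite (le_lt_trans (sortedJ_le sx ij) h2) (le_lt_trans (sortedJ_le sy ij) h1).
Qed.

Lemma pattern_sortedJ J x y : same_pattern x y -> sortedJ J x -> sortedJ J y.
Proof.
move=> xy sx j hj; have := sx j hj; case: ifP => _; first by rewrite xy.
by move=> e; apply/eqP; rewrite eq_le !leNgt -!xy e ltxx.
Qed.

Lemma ltn_val_ordS (j : 'I_n) : ~~ is_last j -> ordS j = j.+1 :> nat.
Proof. by move/not_last/val_ordS_lt. Qed.

(** The weight sum of [i * F i] measures sortedness. It serves as potential function both for
    sorting a real function and for shortening a permutation. *)
Lemma sum_tperm (V : comNzRingType) (F : 'I_n -> V) (j : 'I_n) : ~~ is_last j ->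
  \sum_(i < n) (i : nat)%:R * F (tperm j (ordS j) i) = \sum_(i < n) (i : nat)%:R * F i + (F j - F (ordS j)).
Proof.
move=> hj; move: (ordS j) (ordS_neq j) (ltn_val_ordS hj) => l nl vl.
rewrite (bigD1 j) //= (bigD1 l) //= [in RHS](bigD1 j) //= [X in _ = _ + X + _](bigD1 l) //=.
rewrite tpermL tpermR vl (eq_bigr (fun i : 'I_n => (i : nat)%:R * F i)); last first.
  by move=> i /andP[h1 h2]; rewrite tpermD // eq_sym.
by rewrite -natr1; ring.
Qed.

Lemma increasing_perm s :
  (forall j : 'I_n, ~~ is_last j -> (s j < s (ordS j))%N) -> s = 1%g.
Proof.
move=> inc; have le (i : 'I_n) : (i <= s i)%N.
  apply: (@ord_ind_from (Ordinal n0) (fun i => (i <= s i)%N)) => // j _ hj le.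
  by rewrite ltn_val_ordS //; have := inc j hj; lia.
have e : (\sum_i (s i - i) = 0)%N.
  rewrite sumnB //.
  by rewrite [X in (_ - X)%N](reindex_inj (@perm_inj _ s)) subnn.
apply/permP => i; rewrite perm1; apply: ord_inj; have := le i.
move: e; rewrite (bigD1 i) //=; lia.
Qed.

(** Bubble sort. At a descent [j] of [s], sortedness and invariance of [x] force [x j = x (ordS j)],
    so [j] is outside [J] and its transposition is allowed; undoing the descent raises the weight
    [F], which is bounded. *)
Lemma block_perm_word J x s : sortedJ J x -> (forall i, x (s i) = x i) ->
  exists2 u, wordWJ J u & wperm u = s.
Proof.
move=> sx; pose F t := (\sum_(i < n) i * t i)%N.
have ub t : (F t <= n * (n * n))%N.
  apply: (@leq_trans (\sum_(i < n) n * n)); last by rewrite sum_nat_const card_ord.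
  by apply: leq_sum => i _; apply: leq_mul; apply/ltnW/ltn_ord.
have [m] := ubnP (n * (n * n) - F s)%N; elim: m s => // m IH s le xs.
have [->|ns] := eqVneq s 1%g; first by exists [::]; rewrite // /wperm big_nil.
have [j hj lt] : exists2 j : 'I_n, ~~ is_last j & (s (ordS j) < s j)%N.
  have [j] : exists j : 'I_n, ~~ (~~ is_last j ==> (s j < s (ordS j))%N).
    apply/existsP; rewrite -negb_forall; apply: contra ns => /forallP h.
    by apply/eqP/increasing_perm => j hj; have := h j; rewrite hj.
  rewrite negb_imply -leqNgt leq_eqVlt => /andP[hj /orP[/eqP/ord_inj/perm_inj e|lt]]; last by exists j.
  by have := ordS_neq j; rewrite e eqxx.
have jJ : j \notin J.
  have := sx j hj; case: ifP => // _.
  by rewrite -(xs j) -(xs (ordS j)) ltNge (sortedJ_le sx (ltnW lt)).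
have xj : x j = x (ordS j) by have := sx j hj; rewrite (negbTE jJ).
pose s' := (tperm j (ordS j) * s)%g.
have eF : (F s' + s (ordS j) = F s + s j)%N.
  apply/eqP; rewrite -(eqr_nat int) !natrD; apply/eqP.
  have eG t : (F t)%:R = \sum_(i < n) (i : nat)%:R * (t i : nat)%:R :> int.
    by rewrite natr_sum; apply: eq_bigr => i _; rewrite natrM.
  pose G (i : 'I_n) : int := (s i : nat)%:R.
  rewrite !eG (eq_bigr (fun i : 'I_n => (i : nat)%:R * G (tperm j (ordS j) i))).
    by rewrite sum_tperm // /G; ring.
  by move=> i _; rewrite permM.
have [||u hu eu] := IH s'.
- by have := ub s'; have := ub s; lia.
- move=> i; rewrite permM xs; case: tpermP => // ->; by rewrite ?xj.
exists (j :: u); first by rewrite /wordWJ /= hj jJ.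
by rewrite /wperm big_cons -/(wperm u) eu /s' mulgA tperm2 mul1g.
Qed.

Lemma wordWJ_W' J u : wordWJ J u -> wordW' u.
Proof. by apply: sub_all => j /andP[]. Qed.

Lemma perm_word s : exists2 u, wordW' u & wperm u = s.
Proof.
have [|//|u hu eu] := @block_perm_word set0 (fun _ => 0) s.
  by move=> j _; rewrite inE.
by exists u => //; apply: wordWJ_W' hu.
Qed.

(** A permutation maximising the sum of [i * x (s i)] has no descent, since swapping one would
    increase the sum. *)
Lemma sorting_perm x : exists s J, admJ J /\ sortedJ J (x \o s).
Proof.
pose F s := \sum_(i < n) (i : nat)%:R * x (s i).
pose s := [arg max_(s > 1%g) F s]%O.
have smax t : F t <= F s by rewrite /s; case: arg_maxP => // s' _ h; apply: h.
have mono (j : 'I_n) : ~~ is_last j -> x (s j) <= x (s (ordS j)).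
  move=> hj; have := smax (tperm j (ordS j) * s)%g; rewrite /F.
  rewrite (eq_bigr (fun i : 'I_n => (i : nat)%:R * (x \o s) (tperm j (ordS j) i))); last first.
    by move=> i _; rewrite permM.
  by rewrite sum_tperm // gerDl subr_le0.
exists s, [set j | ~~ is_last j && (x (s j) < x (s (ordS j)))]; split.
  by move=> j; rewrite inE => /andP[].
move=> j hj; rewrite inE hj /=; case: ltP => // h.
by apply/eqP; rewrite eq_le h mono.
Qed.

Lemma inH_eq (t1 t2 : 'rV[R]_n) : inH t1 -> inH t2 ->
  (forall i : 'I_n, ~~ is_last i -> t1 0 i = t2 0 i) -> t1 = t2.
Proof.
move=> h1 h2 e; apply/rowP => i; have [hi|/e//] := boolP (is_last i).
have eS : \sum_(j | j != i) t1 0 j = \sum_(j | j != i) t2 0 j.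
  apply: eq_bigr => j ne; apply: e; apply: contra ne.
  by rewrite -val_eqE /= => /eqP ->; rewrite (eqP hi).
move: h1 h2; rewrite /inH (bigD1 i) //= eS => h1; rewrite (bigD1 i) //=.
by move: h1; set c := \sum_(j | _) _; lra.
Qed.

Lemma coneJ_inH J (t1 : 'rV[R]_n) : coneJ J t1 -> inH t1.
Proof.
move=> [c [_ ->]]; rewrite /inH (eq_bigr (fun i => \sum_(j in J) c j * ((i == j)%:R - evlast R n 0 i))).
  rewrite exchange_big big1 // => j _; rewrite -mulr_sumr sumrB sum_evlast.
  have -> : \sum_i ((i == j)%:R : R) = 1.
    by rewrite (bigD1 j) //= eqxx big1 ?addr0 // => i; case: eqP.
  by rewrite subrr mulr0.
by move=> i _; rewrite summxE; apply: eq_bigr => j _; rewrite !mxE.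
Qed.

Lemma cone_coord (c : 'I_n -> R) J (i : 'I_n) : ~~ is_last i ->
  (\sum_(j in J) c j *: (ev R j - evlast R n)) 0 i = if i \in J then c i else 0.
Proof.
move=> hi; rewrite summxE (eq_bigr (fun j => if i == j then c j else 0)).
  rewrite -big_mkcondr /=; case: ifP => iJ.
    rewrite (big_pred1 i) // => j /=; rewrite [j == i]eq_sym.
    by case: (eqVneq i j) => [e|_]; rewrite ?andbF // -e iJ.
  by rewrite big_pred0 // => j; case: (eqVneq i j) => [e|_]; rewrite ?andbF // -e iJ.
by move=> j _; rewrite !mxE (negbTE hi) subr0; case: eqP => _; rewrite ?mulr1 ?mulr0.
Qed.

Lemma coneJP J (t1 : 'rV[R]_n) : coneJ J t1 <-> exists2 x, sortedJ J x & t1 = th_of x.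
Proof.
split=> [hc|[x sx ->]].
  have [x ex] := inHP (coneJ_inH hc); exists x => // j hj.
  have [c [c0 ec]] := hc; have := cone_coord c J hj; rewrite -ec ex mxE => /eqP.
  rewrite subr_eq => /eqP ->; have [jJ|jJ] := boolP (j \in J).
    by rewrite ltrDr c0.
  by rewrite add0r.
(* If [J] contains the last vertex, the generator there is zero and any positive coefficient will
   do. *)
exists (fun j => if is_last j then 1 else x (ordS j) - x j); split.
  move=> j jJ; case: ifP => // /negbT hj; rewrite subr_gt0.
  by have := sx j hj; rewrite jJ.
apply: inH_eq => [||i hi]; first exact: inH_th_of.
  apply: (@coneJ_inH J); exists (fun j => if is_last j then 1 else x (ordS j) - x j).
  split=> // j jJ; case: ifP => // /negbT hj; rewrite subr_gt0.
  by have := sx j hj; rewrite jJ.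
rewrite cone_coord // mxE (negbTE hi); have := sx i hi; case: ifP => // _ ->.
by rewrite subrr.
Qed.

Lemma pieceP J w (t1 : 'rV[R]_n) :
  piece J w t1 <-> exists2 x, sortedJ J x & t1 = th_of (x \o wperm w).
Proof.
split=> [[t0 /coneJP[x sx ->] ->]|[x sx ->]]; first by exists x; rewrite ?wact_th_of.
by exists (th_of x); rewrite ?wact_th_of //; apply/coneJP; exists x.
Qed.

Lemma piece_inH J w (t1 : 'rV[R]_n) : piece J w t1 -> inH t1.
Proof. by move=> /pieceP[x _ ->]; apply: inH_th_of. Qed.

Lemma pieces_cover (t1 : 'rV[R]_n) :
  inH t1 <-> exists J w, [/\ admJ J, wordW' w & piece J w t1].
Proof.
split=> [/inHP[x ->]|[J [w [_ _ /piece_inH]]] //].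
have [s [J [aJ sJ]]] := sorting_perm x; have [u hu eu] := perm_word (s^-1)%g.
exists J, u; split=> //; apply/pieceP; exists (x \o s) => //.
by congr th_of; apply: funext => i /=; rewrite eu permKV.
Qed.

Lemma wact_stab J u (t1 : 'rV[R]_n) : wordWJ J u -> coneJ J t1 -> wact u t1 = t1.
Proof.
elim: u => //= j u IH /andP[/andP[hj nJ] /IH{}IH] hc; rewrite IH //.
have /coneJP[x sx ->] := hc; rewrite /refl mxE; have := sx j hj.
by rewrite (negbTE nJ) => ->; rewrite subrr scale0r subr0.
Qed.

Lemma piece_coset J w w' : sameCoset R J w w' ->
  forall t1 : 'rV[R]_n, piece J w t1 <-> piece J w' t1.
Proof.
move=> [u hu e] t1; split=> -[t0 hc ->]; exists t0 => //.
  by rewrite e wact_cat (wact_stab hu hc).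
by rewrite e wact_cat (wact_stab hu hc).
Qed.

Lemma th_of_inj x y : th_of x = th_of y -> exists c, forall i, x i = y i + c.
Proof.
move=> e; exists (x (Ordinal n0) - y (Ordinal n0)) => i.
apply: (@ord_ind_from (Ordinal n0) (fun i => x i = y i + _)) => //; first by rewrite addrC subrK.
move=> j _ _ h; have := congr1 (fun t : 'rV_n => t 0 j) e; rewrite !mxE h.
by move=> e'; move: h; lra.
Qed.

(** Pigeonhole: the indices from [i] on cannot all be sent strictly above [i], so some [j] with
    [i <= j] has [s j <= i], and then x i <= x j = y (s j) <= y i. *)
Lemma sorted_perm_le J J' x y s : sortedJ J x -> sortedJ J' y ->
  (forall i, x i = y (s i)) -> forall i, x i <= y i.
Proof.
move=> sx sy e i.
have [j ij le] : exists2 j : 'I_n, (i <= j)%N & (s j <= i)%N.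
  pose A := [set j : 'I_n | (i <= j)%N]; pose B := [set j : 'I_n | (i < j)%N].
  have [j] : exists j, ~~ ((j \in A) ==> (s j \in B)).
    apply/existsP; rewrite -negb_forall; apply/negP => /forallP h.
    have sAB : s @: A \subset B.
      by apply/subsetP => _ /imsetP[j jA ->]; have := h j; rewrite jA.
    have := subset_leq_card sAB; rewrite card_imset; last exact: perm_inj.
    have -> : A = i |: B.
      by apply/setP => j; rewrite !inE leq_eqVlt -val_eqE eq_sym.
    by rewrite cardsU1 inE ltnn add1n ltnn.
  by rewrite negb_imply !inE -leqNgt => /andP[]; exists j.
by apply: le_trans (sortedJ_le sx ij) _; rewrite e; apply: sortedJ_le sy le.
Qed.

(** After absorbing the constant [c], the two sorted functions are rearrangements of each other,
    hence equal. Their strict steps give [J = J'], and the rearranging permutation stabilises [x],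
    so it is a word in the generators of W'_J. *)
Lemma pieces_disjoint J J' w w' (t1 : 'rV[R]_n) : admJ J -> admJ J' ->
  wordW' w -> wordW' w' -> piece J w t1 -> piece J' w' t1 -> J = J' /\ sameCoset R J w w'.
Proof.
move=> aJ aJ' hw hw' /pieceP[x sx ->] /pieceP[y sy /th_of_inj[c ec]].
pose y' i := y i + c; have sy' : sortedJ J' y'.
  by move=> j /sy; rewrite /y'; case: ifP => _ => [|->//]; rewrite ltrD2r.
pose s := ((wperm w)^-1 * wperm w')%g.
have es i : x i = y' (s i).
  by have := ec ((wperm w)^-1 i)%g; rewrite /= permKV /y' permM.
have es' i : y' i = x ((s^-1)%g i) by rewrite es permKV.
have xy : x = y'.
  apply: funext => i; apply/eqP; rewrite eq_le (sorted_perm_le sx sy' es).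
  by rewrite (sorted_perm_le sy' sx es').
split.
  apply/setP => j; have [hj|hj] := boolP (is_last j).
    by apply/idP/idP => [/aJ|/aJ']; rewrite hj.
  have := sx j hj; have := sy' j hj; rewrite -xy.
  case: (j \in J'); case: (j \in J) => // h1 h2; first by rewrite h2 ltxx in h1.
  by rewrite h1 ltxx in h2.
have [|u hu eu] := @block_perm_word J x s sx.
  by move=> i; rewrite [RHS]es xy.
exists u => //; apply: wact_perm_eq => //.
  by rewrite /wordW' all_cat; apply/andP; split=> //; apply: wordWJ_W' hu.
by rewrite wperm_cat eu /s mulKVg.
Qed.

Lemma piece_patternP J w x y : piece J w (th_of x) ->
  (same_pattern x y <-> piece J w (th_of y)).
Proof.
move=> /pieceP[x0 sx /th_of_inj[c ec]].
have ex i : x0 i + c = x ((wperm w)^-1 i)%g by rewrite ec /= permKV.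
have sx' : sortedJ J (x \o (wperm w)^-1%g).
  by move=> j /sx; rewrite /= -!ex; case: ifP => _ => [|->//]; rewrite ltrD2r.
have yE z : z = (z \o (wperm w)^-1%g) \o wperm w.
  by apply: funext => i /=; rewrite permK.
split=> [xy|/pieceP[y0 sy /th_of_inj[c' ec']]].
  apply/pieceP; exists (y \o (wperm w)^-1%g); last by rewrite -yE.
  by apply: pattern_sortedJ sx' => i j; apply: xy.
have h := sortedJ_pattern sx' sy => i j.
by rewrite !ec' !ltrD2r /= -h /= !permK.
Qed.

Lemma piece_TFeq (k : closedFieldType) J w (t1 : 'rV[R]_n) : piece J w t1 ->
  forall t2 : 'rV[R]_n, TFeq k t1 t2 <-> piece J w t2.
Proof.
move=> hp t2; have [x ex] := inHP (piece_inH hp); subst t1.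
split=> [h|hp2].
  have [y ey] := inHP (TFeq_inH n0 h (inH_th_of x)); subst t2.
  by apply/(piece_patternP y hp); apply/(TFeq_patternP k n0).
have [y ey] := inHP (piece_inH hp2); subst t2.
by apply/(TFeq_patternP k n0)/(piece_patternP y hp).
Qed.

End Weyl.

(** * The complexes attached to subsets of the vertices *)

Section Free.
Variables (k : fieldType) (n : nat) (I : finType) (lam : I -> 'I_n).
Hypothesis hn : (1 < n)%N.
Let n0 : (0 < n)%N := ltnW hn.
Let o0 : 'I_n := Ordinal n0.

(* The basis vector (i, a, b) is the i-th generator times (a-arrows)^a (b-arrows)^b. *)
Definition fvalid (p : I * 'I_n * 'I_n) :=
  (lam p.1.1 + p.1.2 < n.-1)%N && (p.2 <= lam p.1.1)%N.
Definition fbasis := {p | fvalid p}.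
Definition fa (t : fbasis) : option fbasis := insub ((val t).1.1, ordS (val t).1.2, (val t).2).
Definition fb (t : fbasis) : option fbasis := insub ((val t).1, ordS (val t).2).
Definition fvt (t : fbasis) : 'I_n :=
  iter (val t).2 (@ord_pred n) (iter (val t).1.2 (@ordS n) (lam (val t).1.1)).
(** The direct sum of the P'(lam i). As the two operators commute, a path dies as soon as its
    [a]-part or its [b]-part alone would reach the last vertex, whence the two bounds in [fvalid]; a
    generator at the last vertex contributes zero. *)
Definition free_rep : rep k n := mono k fvt fa fb.

Lemma iter_ordS_val a (v : 'I_n) : (v + a < n)%N -> iter a (@ordS n) v = (v + a)%N :> nat.
Proof.
elim: a => [|a IH] h; first by rewrite addn0.
by rewrite iterS val_ordS_lt IH; lia.
Qed.

Lemma iter_ord_pred_val b (v : 'I_n) : (b <= v)%N -> iter b (@ord_pred n) v = (v - b)%N :> nat.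
Proof.
elim: b => [|b IH] h; first by rewrite subn0.
by rewrite iterS val_ord_pred_gt0 IH; lia.
Qed.

Lemma faP (t : fbasis) : [/\ ((val t).1.2).+1 < n, ((val t).2).+1 < n.+1,
  lam (val t).1.1 + (val t).1.2 < n.-1 & (val t).2 <= lam (val t).1.1]%N.
Proof. by have /andP[h1 h2] := valP t; split=> //; lia. Qed.

Lemma fa_some t t' : fa t = Some t' -> [/\ (val t').1.1 = (val t).1.1,
  (val t').1.2 = ((val t).1.2).+1 :> nat, (val t').1.2 = ordS (val t).1.2 & (val t').2 = (val t).2].
Proof.
rewrite /fa; case: insubP => // u _ eu [<-]; rewrite eu; have [h _ _ _] := faP t.
by split=> //; rewrite val_ordS_lt.
Qed.

Lemma fb_some t t' : fb t = Some t' -> [/\ (val t').1.1 = (val t).1.1,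
  (val t').1.2 = (val t).1.2 & (val t').2 = ((val t).2).+1 :> nat].
Proof.
rewrite /fb; case: insubP => // u _ eu [<-]; rewrite eu; have [_ _ h1 h2] := faP t.
by split=> //; rewrite val_ordS_lt //; lia.
Qed.

Lemma iter_pred_ordS b (v : 'I_n) : iter b (@ord_pred n) (ordS v) = ordS (iter b (@ord_pred n) v).
Proof. by elim: b => //= b ->; rewrite ordSK ord_predK. Qed.

Lemma fvt_fa t t' : fa t = Some t' -> fvt t' = ordS (fvt t).
Proof.
by move=> /fa_some[e1 e2 _ e3]; rewrite /fvt e1 e2 e3 iterS iter_pred_ordS.
Qed.

Lemma fvt_fb t t' : fb t = Some t' -> fvt t = ordS (fvt t').
Proof. by move=> /fb_some[e1 e2 e3]; rewrite /fvt e1 e2 e3 iterS ord_predK. Qed.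

Lemma fa_eq t p : val t = p -> fa t = insub (p.1.1, ordS p.1.2, p.2).
Proof. by move=> <-. Qed.

Lemma fb_eq t p : val t = p -> fb t = insub (p.1, ordS p.2).
Proof. by move=> <-. Qed.

Lemma fab_comm t : obind fb (fa t) = obind fa (fb t).
Proof.
have [h1 h2 h3 h4] := faP t.
pose q := ((val t).1.1, ordS (val t).1.2, ordS (val t).2).
have -> : obind fb (fa t) = insub q.
  rewrite /fa; case: insubP => [u _|nv] /=; first exact: (@fb_eq u).
  by rewrite insubF //; apply: contraNF nv; rewrite /fvalid /= h4 andbT => /andP[].
apply/esym; rewrite /fb; case: insubP => [u _|nv] /=; first exact: (@fa_eq u).
by rewrite insubF //; apply: contraNF nv; rewrite /fvalid /= h3 => /andP[].
Qed.

Lemma is_mod_free : is_mod free_rep.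
Proof.
apply: (@is_mod_mono k n fbasis fvt fa fb (fun t : fbasis => (val t).1.2 + (val t).2)%N).
- exact: fvt_fa.
- exact: fvt_fb.
- exact: fab_comm.
- by move=> t t' /fa_some[_ e _ ->]; rewrite e addSn.
- by move=> t t' /fb_some[_ -> e]; rewrite e addnS.
Qed.

Lemma fvt_not_last t : ~~ is_last (fvt t).
Proof.
have [h1 h2 h3 h4] := faP t; rewrite /is_last /fvt.
by rewrite iter_ord_pred_val iter_ordS_val; lia.
Qed.

Lemma is_mod'_free : is_mod' free_rep.
Proof.
split=> [|i hi]; first exact: is_mod_free.
rewrite /= -(pm0 k fbasis); apply: eq_pm => t; case: eqP => // e.
by have := fvt_not_last t; rewrite e hi.
Qed.

Lemma fwd_free : fwd free_rep = pm k fa. Proof. exact: sum_pm. Qed.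

Lemma bwd_free : bwd free_rep = pm k fb.
Proof.
rewrite /bwd -(sum_pm k (fun t => ord_pred (fvt t))); apply: eq_bigr => i _ /=.
by apply: eq_pm => t; rewrite -[ord_pred _ == i](inj_eq (@ordS_inj n)) ord_predK.
Qed.

Definition free_gen i : 'rV[k]_(rd free_rep) :=
  if (insub (i, o0, o0) : option fbasis) is Some t then bvec k t else 0.

Lemma mx_bvec m (M N : 'M[k]_(rd free_rep, m)) :
  (forall t, bvec k t *m M = bvec k t *m N) -> M = N.
Proof.
move=> h; apply/row_matrixP => s; rewrite !rowE; have := h (enum_val s).
by rewrite /bvec enum_valK.
Qed.

Lemma bvec_gen (t : fbasis) : bvec k t =
  free_gen (val t).1.1 *m fwd free_rep ^+ (val t).1.2 *m bwd free_rep ^+ (val t).2.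
Proof.
have [m] := ubnP ((val t).1.2 + (val t).2)%N; elim: m t => // m IH t le.
have [h1 h2 h3 h4] := faP t.
have pr (v : 'I_n) : (0 < v)%N -> exists2 u : 'I_n, u = v.-1 :> nat & ordS u = v.
  by move=> h; exists (ord_pred v); [exact: val_ord_pred_gt0 | exact: ord_predK].
have [b0|b0] := posnP (val t).2; last first.
  have [u eu1 eu2] := pr _ b0.
  have vt' : fvalid ((val t).1, u).
    by apply/andP; split; [exact: h3 | apply: leq_trans h4; rewrite /= eu1 leq_pred].
  pose t' : fbasis := exist (fun p => fvalid p) ((val t).1, u) vt'.
  have et : fb t' = Some t by rewrite /fb /= eu2 -surjective_pairing; apply: valK.
  have -> : bvec k t = bvec k t' *m bwd free_rep by rewrite bwd_free bvec_pm et.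
  rewrite IH /=; last by move: le b0 eu1 => /= le0 b00 ->; lia.
  by rewrite eu1 -mulmxA -[in RHS](prednK b0) exprSr.
have [a0|a0] := posnP (val t).1.2; last first.
  have [u eu1 eu2] := pr _ a0.
  have vt' : fvalid ((val t).1.1, u, (val t).2).
    apply/andP; split; last exact: h4.
    by apply: leq_ltn_trans h3; rewrite /= eu1 leq_add2l leq_pred.
  pose t' : fbasis := exist (fun p => fvalid p) ((val t).1.1, u, (val t).2) vt'.
  have et : fa t' = Some t by rewrite /fa /= eu2 -!surjective_pairing; apply: valK.
  have -> : bvec k t = bvec k t' *m fwd free_rep by rewrite fwd_free bvec_pm et.
  rewrite IH /=; last by move: le a0 eu1 => /= le0 a00 ->; lia.
  by rewrite eu1 b0 expr0 !mulmx1 -mulmxA -[in RHS](prednK a0) exprSr.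
rewrite a0 b0 !expr0 !mulmx1 /free_gen.
have -> : ((val t).1.1, o0, o0) = val t.
  by rewrite [RHS]surjective_pairing [(val t).1]surjective_pairing; congr (_, _, _); apply: ord_inj.
by rewrite valK.
Qed.

Section Universal.
Variable (X : rep k n).
Hypothesis hX : is_mod' X.
Let A := fwd X.
Let B := bwd X.

Lemma idem_fwdS i : idem X i *m A = A *m idem X (ordS i).
Proof. by rewrite idem_fwd ?fwd_idem //; case: hX. Qed.

Lemma idem_bwdP i : idem X i *m B = B *m idem X (ord_pred i).
Proof. by rewrite -{1}(ord_predK i) idem_bwd ?bwd_idem //; case: hX. Qed.

Lemma fwd_shift (v : 'rV[k]_(rd X)) l a : v *m idem X l = v ->
  v *m A ^+ a *m idem X (iter a (@ordS n) l) = v *m A ^+ a.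
Proof.
elim: a => [|a IH] h; first by rewrite expr0 mulmx1.
by rewrite exprSr iterS mulmxA -mulmxA -idem_fwdS mulmxA IH.
Qed.

Lemma bwd_shift (v : 'rV[k]_(rd X)) l b : v *m idem X l = v ->
  v *m B ^+ b *m idem X (iter b (@ord_pred n) l) = v *m B ^+ b.
Proof.
elim: b => [|b IH] h; first by rewrite expr0 mulmx1.
by rewrite exprSr iterS mulmxA -mulmxA -idem_bwdP mulmxA IH.
Qed.

Lemma fwd_zero (v : 'rV[k]_(rd X)) (l : 'I_n) a : v *m idem X l = v ->
  (n.-1 <= l + a)%N -> v *m A ^+ a = 0.
Proof.
move=> h le; pose a0 := (n.-1 - l)%N; have ll := ltn_ord l.
have -> : a = (a0 + (a - a0))%N by rewrite /a0; lia.
rewrite exprD mulmxA -(fwd_shift a0 h) (_ : idem X _ = 0) ?mulmx0 ?mul0mx //.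
by have [_ ->] := hX; rewrite // /is_last iter_ordS_val /a0; lia.
Qed.

Lemma bwd_zero (v : 'rV[k]_(rd X)) (l : 'I_n) b : v *m idem X l = v ->
  (l < b)%N -> v *m B ^+ b = 0.
Proof.
move=> h le; have -> : b = (l.+1 + (b - l.+1))%N by lia.
rewrite exprD mulmxA -(bwd_shift l.+1 h) (_ : idem X _ = 0) ?mulmx0 ?mul0mx //.
have [_ ->] := hX; rewrite // /is_last iterS.
have e : iter l (@ord_pred n) l = 0%N :> nat by rewrite iter_ord_pred_val ?subnn.
by rewrite /= e add0n modn_small ?prednK //; lia.
Qed.

(** The images of the basis vectors are forced. They define a homomorphism because in [X] too a path
    through the last vertex acts as zero ([fwd_zero], [bwd_zero]). *)
Lemma free_hom (v : I -> 'rV[k]_(rd X)) : (forall i, v i *m idem X (lam i) = v i) ->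
  exists2 f : 'M[k]_(rd free_rep, rd X), is_hom f & forall i, free_gen i *m f = v i.
Proof.
move=> hv; have [hXm hX'] := hX.
have AB : A *m B = B *m A by apply: fwd_bwd.
have AX b : A *m B ^+ b = B ^+ b *m A.
  elim: b => [|b IH]; first by rewrite expr0 mulmx1 mul1mx.
  by rewrite exprS mulmxA [A *m B]AB -mulmxA IH mulmxA.
pose w (t : fbasis) := v (val t).1.1 *m A ^+ (val t).1.2 *m B ^+ (val t).2.
pose f : 'M[k]_(rd free_rep, rd X) := \matrix_s w (enum_val s).
have bf t : bvec k t *m f = w t by rewrite -rowE rowK enum_rankK.
have wE t : w t *m idem X (fvt t) = w t by apply: bwd_shift; apply: fwd_shift.
exists f.
  apply: hom_fwd => //; first exact: is_mod_free.
  - move=> i; apply: mx_bvec => t; rewrite !mulmxA bf /= bvec_pm.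
    have [[_ h2 _ _ _] _] := hXm; rewrite -wE -mulmxA h2; case: eqP => [_|_].
      by rewrite wE.
    by rewrite mul0mx mulmx0.
  - apply: mx_bvec => t; rewrite !mulmxA bf fwd_free bvec_pm.
    have e : w t *m A = v (val t).1.1 *m A ^+ (val t).1.2.+1 *m B ^+ (val t).2.
      by rewrite /w -mulmxA -AX exprSr !mulmxA.
    rewrite e; case et : (fa t) => [t'|].
      by rewrite bf /w; have [-> -> _ ->] := fa_some et.
    rewrite mul0mx (fwd_zero (hv _)) ?mul0mx // leqNgt; apply/negP => lt.
    move: et; rewrite /fa; case: insubP => // /negP[].
    have [h1 h2 h3 h4] := faP t; apply/andP; split; last exact: h4.
    apply: leq_trans lt; rewrite ltnS leq_add2l -[X in (_ <= X)%N](val_ordS_lt h1).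
    exact: leqnn.
  apply: mx_bvec => t; rewrite !mulmxA bf bwd_free bvec_pm.
  have e : w t *m B = v (val t).1.1 *m A ^+ (val t).1.2 *m B ^+ (val t).2.+1.
    by rewrite /w exprSr mulmxA.
  rewrite e; case et : (fb t) => [t'|].
    by rewrite bf /w; have [-> -> ->] := fb_some et.
  have comm a b : A ^+ a *m B ^+ b = B ^+ b *m A ^+ a.
    elim: a => [|a IH]; first by rewrite expr0 mulmx1 mul1mx.
    by rewrite exprSr -mulmxA AX mulmxA IH -mulmxA.
  rewrite mul0mx -mulmxA comm mulmxA (bwd_zero (hv _)) ?mul0mx // ltnNge; apply/negP => lt.
  move: et; rewrite /fb; case: insubP => // /negP[].
  have [h1 h2 h3 h4] := faP t; apply/andP; split; first exact: h3.
  have h5 : ((val t).2.+1 < n)%N := leq_ltn_trans lt (ltn_ord _).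
  by apply: leq_trans lt; rewrite -[X in (_ <= X)%N](val_ordS_lt h5); apply: leqnn.
move=> i; rewrite /free_gen; case: insubP => [t _ et|nv].
  by rewrite bf /w et /= !expr0 !mulmx1.
rewrite mul0mx; have : is_last (lam i).
  move: nv; rewrite /fvalid /o0 /= addn0 leq0n andbT -leqNgt => h.
  by rewrite /is_last eqn_leq h andbT; have := ltn_ord (lam i); lia.
by move=> /hX' e; rewrite -hv e mulmx0.
Qed.

Lemma hom_ext (f g : 'M[k]_(rd free_rep, rd X)) : is_hom f -> is_hom g ->
  (forall i, free_gen i *m f = free_gen i *m g) -> f = g.
Proof.
have expand (h : 'M[k]_(rd free_rep, rd X)) t : is_hom h ->
    bvec k t *m h = free_gen (val t).1.1 *m h *m A ^+ (val t).1.2 *m B ^+ (val t).2.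
  move=> hh; have eA : fwd free_rep *m h = h *m A.
    rewrite /fwd /A /fwd mulmx_suml mulmx_sumr; apply: eq_bigr => i _; by have [] := hh i.
  have eB : bwd free_rep *m h = h *m B.
    rewrite /bwd /B /bwd mulmx_suml mulmx_sumr; apply: eq_bigr => i _; by have [] := hh i.
  have eAX a : fwd free_rep ^+ a *m h = h *m A ^+ a.
    elim: a => [|a IH]; first by rewrite !expr0 mul1mx mulmx1.
    by rewrite !exprS -mulmxA IH mulmxA [fwd free_rep *m h]eA -mulmxA.
  have eBX b : bwd free_rep ^+ b *m h = h *m B ^+ b.
    elim: b => [|b IH]; first by rewrite !expr0 mul1mx mulmx1.
    by rewrite !exprS -mulmxA IH mulmxA [bwd free_rep *m h]eB -mulmxA.
  rewrite bvec_gen.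
  transitivity (free_gen (val t).1.1 *m fwd free_rep ^+ (val t).1.2 *m (h *m B ^+ (val t).2)).
    by rewrite -[LHS]mulmxA; congr (_ *m _); apply: eBX.
  rewrite mulmxA; congr (_ *m _); rewrite -[RHS]mulmxA -[LHS]mulmxA.
  by congr (_ *m _); apply: eAX.
by move=> hf hg e; apply: mx_bvec => t; rewrite !expand // e.
Qed.

End Universal.

Lemma gen_idem i : free_gen i *m idem free_rep (lam i) = free_gen i.
Proof.
rewrite /free_gen; case: insubP => [t _ et|_]; last by rewrite mul0mx.
by rewrite /= bvec_pm /fvt et /= eqxx.
Qed.

Lemma is_proj'_free : is_proj' free_rep.
Proof.
split; first exact: is_mod'_free.
move=> M N g f hM hN hg fg hf.
have [hg1 _] := is_homE hg; have [hf1 _] := is_homE hf.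
have /fin_all_exists[y hy] i : exists y : 'rV[k]_(rd M), y *m idem M (lam i) = y /\ y *m g = free_gen i *m f.
  have /submxP[y ey] : (free_gen i *m f <= g)%MS by apply: submx_full.
  have [[_ h2 _ _ _] _] := hM.1.
  exists (y *m idem M (lam i)); split; first by rewrite -mulmxA h2 eqxx.
  by rewrite -mulmxA hg1 mulmxA -ey -mulmxA -hf1 mulmxA gen_idem.
have [h hh eh] := free_hom hM (fun i => (hy i).1).
exists h => //; apply: hom_ext => //; first exact: hom_comp.
by move=> i; rewrite mulmxA eh (hy i).2.
Qed.

Let nontop (t : fbasis) := (0 < (val t).1.2)%N || (0 < (val t).2)%N.

Lemma radsp_free : (radsp' free_rep :=: pm k (fun t => if nontop t then Some t else None))%MS.
Proof.
apply/eqmxP/andP; split.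
  apply/sumsmx_subP => x _; rewrite genmxE.
  have -> : arr free_rep x = arr free_rep x *m pm k (fun t => if nontop t then Some t else None).
    rewrite arr_mono pmM; apply: eq_pm => t; case e : (mono_step _ _ _ _ _) => [t'|] //=.
    suff -> : nontop t' by [].
    move: e; rewrite /mono_step /nontop; case: x.2; case: eqP => // _.
      by move=> /fa_some[_ -> _ _].
    by move=> /fb_some[_ _ ->]; rewrite orbT.
  exact: submxMl.
apply/row_subP => s; rewrite rowE; move: (enum_val s) (enum_valK s) => t <-.
rewrite -/(bvec k t) bvec_pm; case: ifP => [nt|_]; last exact: sub0mx.
rewrite bvec_gen.
have sA i : (amx free_rep i <= radsp' free_rep)%MS.
  by have := @sumsmx_sup k _ (i, true) predT _ _ (amx free_rep i) (fun x => <<arr free_rep x>>%MS);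
     apply=> //; rewrite genmxE.
have sB i : (bmx free_rep i <= radsp' free_rep)%MS.
  by have := @sumsmx_sup k _ (i, false) predT _ _ (bmx free_rep i) (fun x => <<arr free_rep x>>%MS);
     apply=> //; rewrite genmxE.
have rA m (v : 'M[k]_(m, _)) : (v *m fwd free_rep <= radsp' free_rep)%MS.
  by apply: submx_trans (submxMl _ _) _; apply: summx_sub.
have rB m (v : 'M[k]_(m, _)) : (v *m bwd free_rep <= radsp' free_rep)%MS.
  by apply: submx_trans (submxMl _ _) _; apply: summx_sub.
have [b0|b0] := posnP (val t).2; last by rewrite -(prednK b0) exprSr mulmxA rB.
rewrite b0 expr0 mulmx1; move: nt; rewrite /nontop b0 orbF => a0.
by rewrite -(prednK a0) exprSr mulmxA rA.
Qed.

Lemma topmult_free v : ~~ is_last v -> topmult free_rep v = #|[pred i | lam i == v]|.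
Proof.
move=> hv; rewrite /topmult -/(dimv free_rep v) dimv_mono.
rewrite (eqmxMr _ radsp_free) /= pmM.
rewrite (@eq_pm _ _ _ (fun t => if [pred t | nontop t && (fvt t == v)] t then Some t else None)); last first.
  by move=> t /=; case: (nontop t).
rewrite rank_pm -(cardID nontop [pred t | fvt t == v]).
rewrite (@eq_card _ _ [predI [pred t | fvt t == v] & nontop]); last first.
  by move=> t; rewrite !inE andbC.
rewrite addKn.
have lt : (v < n.-1)%N by have := ltn_ord v; move: hv; rewrite /is_last; lia.
rewrite -(card_in_image (f := fun t : fbasis => (val t).1.1)).
  apply: eq_card => i; rewrite !inE; apply/imageP/eqP => [[t]|hi].
    rewrite !inE => /andP[nt /eqP <-] ->; move: nt; rewrite /nontop negb_or -!leqNgt !leqn0.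
    by case/andP=> /eqP h1 /eqP h2; rewrite /fvt h1 h2.
  have vt : fvalid (i, o0, o0) by rewrite /fvalid /= addn0 hi lt.
  by exists (exist (fun p => fvalid p) _ vt) => //; rewrite !inE /fvt /nontop /= hi eqxx.
move=> t t'; rewrite !inE /nontop !negb_or -!leqNgt !leqn0.
move=> /andP[/andP[/eqP h1 /eqP h2] _] /andP[/andP[/eqP h3 /eqP h4] _] e.
apply: val_inj; rewrite [LHS]surjective_pairing [(val t).1]surjective_pairing.
rewrite [RHS]surjective_pairing [(val t').1]surjective_pairing e.
by congr (_, _, _); apply: ord_inj; rewrite ?h1 ?h2 ?h3 ?h4.
Qed.

End Free.

(** * Maps from U_S to the shifted cokernel of U_S' *)

Section CokernelTest.
Variables (k : fieldType) (n : nat).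
Hypothesis hn : (1 < n)%N.
Variables (S S' : {set 'I_n}) (X : rep k n).
Hypothesis hX : is_mod' X.
Variable g : 'I_n -> 'rV[k]_(rd X).
Hypothesis g_idem : forall i, g i *m idem X i = g i.
Hypothesis g_in : forall j, j \in S' -> g (ord_pred j) *m fwd X = g j.
Hypothesis g_out : forall j, j \notin S' -> g j *m bwd X = g (ord_pred j).

Definition two_vertex (T : {set 'I_n}) (j : 'I_n) := if j \in T then j else ord_pred j.

(** The differential of U_T on generators; a family [z] encodes a map from the degree 0 term to [Y],
    and [two_delta T z] its composite with the differential. *)
Definition two_delta (T : {set 'I_n}) (Y : rep k n) (z : 'I_n -> 'rV[k]_(rd Y)) (j : 'I_n) :=
  if j \in T then z (ord_pred j) *m fwd Y - z j else z j *m bwd Y - z (ord_pred j).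

Let Z := fwd X *m bwd X.

Definition in_delta (psi : 'I_n -> 'rV[k]_(rd X)) :=
  exists2 z : 'I_n -> 'rV[k]_(rd X), (forall i, z i *m idem X i = z i) &
    forall j, psi j = two_delta S z j.

Lemma in_delta0 : in_delta (fun _ => 0).
Proof.
exists (fun _ => 0) => [i|j]; first by rewrite mul0mx.
by rewrite /two_delta !mul0mx subrr if_same.
Qed.

Lemma in_deltaD c f h : in_delta f -> in_delta h -> in_delta (fun j => c *: f j + h j).
Proof.
move=> [z hz ez] [y hy ey]; exists (fun i => c *: z i + y i) => [i|j].
  by rewrite mulmxDl -scalemxAl hz hy.
rewrite ez ey /two_delta; case: ifP => _; rewrite mulmxDl -scalemxAl scalerBr opprD;
  exact: addrACA.
Qed.

Lemma in_delta_eq f h : f =1 h -> in_delta f -> in_delta h.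
Proof. by move=> e [z hz ez]; exists z => // j; rewrite -e. Qed.

Lemma in_delta_sum (J : Type) (r : seq J) (P : pred J) (c : J -> k) F :
  (forall i, P i -> in_delta (F i)) -> in_delta (fun j => \sum_(i <- r | P i) c i *: F i j).
Proof.
move=> h; elim: r => [|i r IH].
  by apply: in_delta_eq in_delta0 => j; rewrite big_nil.
case Pi : (P i).
  by apply: in_delta_eq (in_deltaD (c i) (h _ Pi) IH) => j; rewrite big_cons Pi.
by apply: in_delta_eq IH => j; rewrite big_cons Pi.
Qed.

Definition single (j : 'I_n) (x : 'rV[k]_(rd X)) (j' : 'I_n) := if j' == j then x else 0.

Lemma fwdZ : fwd X *m Z = Z *m fwd X.
Proof. by rewrite /Z -mulmxA -(fwd_bwd hX.1). Qed.

Lemma bwdZ : bwd X *m Z = Z *m bwd X.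
Proof. by rewrite /Z mulmxA -(fwd_bwd hX.1). Qed.

Lemma fwdZX c : fwd X *m Z ^+ c = Z ^+ c *m fwd X.
Proof.
elim: c => [|c IH]; first by rewrite expr0 mulmx1 mul1mx.
by rewrite exprS mulmxA fwdZ -mulmxA IH mulmxA.
Qed.

Lemma bwdZX c : bwd X *m Z ^+ c = Z ^+ c *m bwd X.
Proof.
elim: c => [|c IH]; first by rewrite expr0 mulmx1 mul1mx.
by rewrite exprS mulmxA bwdZ -mulmxA IH mulmxA.
Qed.

Lemma ZXD a b : Z ^+ a *m Z ^+ b = Z ^+ (a + b).
Proof. by rewrite exprD. Qed.

Lemma idemZ i : idem X i *m Z = Z *m idem X i.
Proof.
by rewrite /Z mulmxA idem_fwdS // -!mulmxA idem_bwdP // ordSK.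
Qed.

Lemma idemZX i c : idem X i *m Z ^+ c = Z ^+ c *m idem X i.
Proof.
elim: c => [|c IH]; first by rewrite expr0 mulmx1 mul1mx.
by rewrite exprS mulmxA idemZ -mulmxA IH mulmxA.
Qed.

Lemma g_fwd j : g (ord_pred j) *m fwd X = g j *m Z ^+ (j \notin S').
Proof.
case: (boolP (j \in S')) => hj; first by rewrite expr0 mulmx1 g_in.
by rewrite expr1 -g_out // -mulmxA /Z (fwd_bwd hX.1).
Qed.

Lemma g_bwd j : g j *m bwd X = g (ord_pred j) *m Z ^+ (j \in S').
Proof.
case: (boolP (j \in S')) => hj; last by rewrite expr0 mulmx1 g_out.
by rewrite expr1 -g_in // -mulmxA.
Qed.

(** An arrow sends a generator to the neighbouring one, times [Z] when it runs against the relation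
    there; [Z] commutes with both operators, so these factors collect. *)
Lemma g_word i a b : exists c, g i *m fwd X ^+ a *m bwd X ^+ b =
  g (iter b (@ord_pred n) (iter a (@ordS n) i)) *m Z ^+ c.
Proof.
elim: b => [|b [c IH]]; last first.
  exists ((iter b (@ord_pred n) (iter a (@ordS n) i) \in S') + c)%N.
  by rewrite exprSr mulmxA IH -mulmxA -bwdZX mulmxA g_bwd -mulmxA ZXD.
rewrite expr0; elim: a => [|a [c IH]].
  by exists 0%N; rewrite !expr0 !mulmx1.
exists ((iter a.+1 (@ordS n) i \notin S') + c)%N; move: IH; rewrite !mulmx1 /= => IH.
rewrite exprSr mulmxA IH -mulmxA -fwdZX mulmxA -[X in g X *m fwd _]ordSK g_fwd.
by rewrite -mulmxA ZXD.
Qed.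

(** Elementary maps to be killed: non-zero on the [j]-th generator of the degree -1 term only. They
    span when the [g i *m Z ^+ c] span [X]. *)
Definition tau j c := single j (g (two_vertex S j) *m Z ^+ c).

(* The family concentrated at i with value g_i Z^c; the two terms allow the
   vanishing of a generator at one end of the line to propagate to the other. *)
Lemma delta_tau i c : in_delta (fun j =>
  (-1) ^+ (i \in S) *: tau i (c + (i \in S' :\: S)) j +
  (-1) ^+ (ordS i \notin S) *: tau (ordS i) (c + (ordS i \in S :\: S')) j).
Proof.
pose z := single i (g i *m Z ^+ c).
have zi : forall j, z j *m idem X j = z j.
  move=> j; rewrite /z /single; case: eqP => [->|_]; last by rewrite mul0mx.
  by rewrite -mulmxA -idemZX mulmxA g_idem.
exists z => // j; rewrite /two_delta /z /tau /single /two_vertex.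
have np : ordS i != i by apply: ordS_neq.
case: (altP (j =P i)) => [->|ji].
  have -> : (i == ordS i) = false by rewrite eq_sym (negbTE np).
  have -> : (ord_pred i == i) = false.
    by rewrite -(inj_eq (@ordS_inj n)) ord_predK eq_sym (negbTE np).
  rewrite scaler0 addr0 mul0mx subr0 inE; case: (boolP (i \in S)) => hi /=.
    by rewrite expr1 scaleN1r sub0r addn0.
  by rewrite expr0 scale1r -mulmxA -bwdZX mulmxA g_bwd -mulmxA ZXD addnC.
rewrite scaler0 add0r; case: (altP (j =P ordS i)) => [->|jSi].
  rewrite ordSK eqxx mul0mx sub0r subr0 inE.
  case: (boolP (ordS i \in S)) => hi /=.
    rewrite expr0 scale1r andbT -mulmxA -fwdZX mulmxA -[X in g X *m fwd _]ordSK g_fwd.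
    by rewrite -mulmxA ZXD addnC.
  by rewrite expr1 scaleN1r andbF addn0.
have -> : (ord_pred j == i) = false by rewrite -(inj_eq (@ordS_inj n)) ord_predK (negbTE jSi).
by rewrite !mul0mx subrr if_same scaler0.
Qed.

Lemma tau_step i c : in_delta (tau i (c + (i \in S' :\: S))) <->
  in_delta (tau (ordS i) (c + (ordS i \in S :\: S'))).
Proof.
have hd := delta_tau i c; move: hd; set f := tau i _; set h := tau (ordS i) _.
have sg (b : bool) : (-1) ^+ b * (-1) ^+ b = 1 :> k by rewrite -expr2 sqrr_sign.
set e1 := (i \in S) : nat; set e2 := (ordS i \notin S) : nat.
move=> hd; split=> hf.
  have h1 := in_deltaD (- (-1) ^+ e1) hf hd.
  have h2 := in_deltaD ((-1) ^+ e2) h1 in_delta0.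
  apply: in_delta_eq h2 => j.
  by rewrite addr0 addrA scaleNr addNr add0r scalerA sg scale1r.
have h1 := in_deltaD (- (-1) ^+ e2) hf hd.
have h2 := in_deltaD ((-1) ^+ e1) h1 in_delta0.
apply: in_delta_eq h2 => j.
by rewrite addr0 addrCA scaleNr addNr addr0 scalerA sg scale1r.
Qed.

Lemma g_last i : is_last i -> g i = 0.
Proof. by move=> hi; rewrite -g_idem; have [_ ->] := hX; rewrite ?mulmx0. Qed.

Lemma tau0 j c : g (two_vertex S j) = 0 -> in_delta (tau j c).
Proof.
move=> h; apply: in_delta_eq in_delta0 => j'.
by rewrite /tau /single h mul0mx if_same.
Qed.

Lemma is_last_pred0 (j : 'I_n) : j = 0%N :> nat -> is_last (ord_pred j).
Proof.
by case: j => j hj e; rewrite /is_last /= in e *; rewrite e add0n modn_small //; lia.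
Qed.

(** No vertex lies in [S :\: S'], so a step to the right needs no extra power of [Z] and every
    exponent at [j] is reached from the left. At vertex 0 the relevant generator is zero because [g]
    vanishes at the last vertex. *)
Lemma tau_sub j c : S \subset S' -> in_delta (tau j c).
Proof.
move=> sS; have [m] := ubnP (j : nat); elim: m j c => // m IH j c le.
have [j0|jp] := posnP j.
  have gp : g (ord_pred j) = 0 by apply: g_last; apply: is_last_pred0.
  apply: tau0; rewrite /two_vertex; case: ifP => // hj.
  by rewrite -g_in ?(subsetP sS) // gp mul0mx.
have := tau_step (ord_pred j) c; rewrite ord_predK.
rewrite (_ : j \in S :\: S' = false); last first.
  by rewrite inE; apply/negP => /andP[/negP h /(subsetP sS)].
rewrite addn0 => <-; apply: IH; rewrite val_ord_pred_gt0 //; lia.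
Qed.

(** Mirror image: exponents propagate leftwards, starting from the last vertex. *)
Lemma tau_sup j c : S' \subset S -> in_delta (tau j c).
Proof.
move=> sS; have [m] := ubnP (n - j)%N; elim: m j c => // m IH j c le.
case: (boolP (is_last j)) => hj.
  have gp : g j = 0 by apply: g_last.
  apply: tau0; rewrite /two_vertex; case: ifP => // hS.
  rewrite -g_out ?gp ?mul0mx //; apply: contraFN hS; exact: (subsetP sS).
have := tau_step j c.
rewrite (_ : j \in S' :\: S = false); last first.
  by rewrite inE; apply/negP => /andP[/negP h /(subsetP sS)].
rewrite addn0 => ->; apply: IH; move: hj; rewrite /is_last => hj.
by rewrite val_ordS_lt; have := ltn_ord j; lia.
Qed.

Lemma in_delta_all (d : nat) (p : 'M[k]_(d, rd X)) psi :
  S \subset S' \/ S' \subset S -> row_full p ->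
  (forall s, exists i c, row s p = g i *m Z ^+ c) ->
  (forall j, psi j *m idem X (two_vertex S j) = psi j) -> in_delta psi.
Proof.
move=> hS fp hp hpsi.
have key j x : x *m idem X (two_vertex S j) = x -> in_delta (single j x).
  move=> hx; have /submxP[y ey] : (x <= p)%MS by apply: submx_full.
  pose F s := single j (row s p *m idem X (two_vertex S j)).
  have hF s : in_delta (F s).
    have [i [c e]] := hp s; rewrite /F e -mulmxA -idemZX mulmxA.
    have [eq|neq] := eqVneq i (two_vertex S j).
      rewrite eq g_idem; rewrite -/(tau j c).
      by case: hS => h; [apply: tau_sub | apply: tau_sup].
    have -> : g i *m idem X (two_vertex S j) = 0.
      have [[_ h2 _ _ _] _] := hX.1.
      by rewrite -g_idem -mulmxA h2 (negbTE neq) mulmx0.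
    by apply: in_delta_eq in_delta0 => j'; rewrite mul0mx /single if_same.
  apply: in_delta_eq (@in_delta_sum _ (index_enum _) predT (fun s => y 0 s) F (fun s _ => hF s)) => j'.
  rewrite /F /single; case: eqP => _; last by rewrite big1 // => s _; rewrite scaler0.
  have E : x = \sum_s y 0 s *: row s p by rewrite ey mulmx_sum_row.
  rewrite -[RHS]hx E mulmx_suml; apply: eq_bigr => s _.
  by rewrite scalemxAl.
apply: in_delta_eq (@in_delta_sum _ (index_enum _) predT (fun=> 1) _ (fun j _ => key j _ (hpsi j))) => j.
rewrite (bigD1 j) //= big1 ?addr0 /single ?eqxx ?scale1r // => i ij.
by rewrite eq_sym (negbTE ij) scaler0.
Qed.

End CokernelTest.

Section TwoTerm.
Variables (k : fieldType) (n : nat).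
Hypothesis hn : (1 < n)%N.

Definition two_rep0 : rep k n := free_rep k (fun j : 'I_n => j).
Definition two_rep1 (S : {set 'I_n}) : rep k n := free_rep k (two_vertex S).
Definition two_gen : 'I_n -> 'rV[k]_(rd two_rep0) := free_gen k (fun j : 'I_n => j) hn.

Lemma delta_idem (S : {set 'I_n}) (Y : rep k n) z : is_mod' Y -> (forall i, z i *m idem Y i = z i) ->
  forall j, two_delta S z j *m idem Y (two_vertex S j) = two_delta S z j.
Proof.
move=> hY hz j; have := idem_fwdS hY (ord_pred j); rewrite ord_predK => eA.
rewrite /two_delta /two_vertex; case: ifP => _; rewrite mulmxBl.
  by rewrite hz -mulmxA -eA mulmxA hz.
by rewrite hz -mulmxA -idem_bwdP // mulmxA hz.
Qed.

Lemma two_diff S : exists2 d : 'M[k]_(rd (two_rep1 S), rd two_rep0), is_hom d &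
  forall j, free_gen k (two_vertex S) hn j *m d = two_delta S two_gen j.
Proof.
apply: (free_hom hn (is_mod'_free k (fun j : 'I_n => j) hn) (lam := two_vertex S)).
by apply: delta_idem; [exact: is_mod'_free | move=> i; exact: gen_idem].
Qed.

(* In the cokernel, with generators g_i, the relations are g_(i-1) a = g_i for
   i in S and g_i b = g_(i-1) for i outside S. *)
Definition two_cx (S : {set 'I_n}) : cx k n := @Cx k n (two_rep1 S) two_rep0 (s2val (cid2 (two_diff S))).

Lemma valid_two S : valid_cx (two_cx S).
Proof.
split; [exact: is_proj'_free | exact: is_proj'_free | exact: (s2valP (cid2 (two_diff S)))].
Qed.

Lemma cd_two S j : free_gen k (two_vertex S) hn j *m cd (two_cx S) = two_delta S two_gen j.
Proof. exact: (s2valP' (cid2 (two_diff S))). Qed.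

Lemma delta_hom (S : {set 'I_n}) (X Y : rep k n) (f : 'M[k]_(rd X, rd Y)) z j : is_hom f ->
  two_delta S z j *m f = two_delta S (fun i => z i *m f) j.
Proof.
move=> hf; have [eA eB] : fwd X *m f = f *m fwd Y /\ bwd X *m f = f *m bwd Y.
  by split; rewrite /fwd /bwd mulmx_suml mulmx_sumr; apply: eq_bigr => i _; have [] := hf i.
by rewrite /two_delta; case: ifP => _; rewrite mulmxBl -[in LHS]mulmxA ?eA ?eB mulmxA.
Qed.

Lemma Hom1zero_two S X : is_mod' X ->
  (forall psi, (forall j, psi j *m idem X (two_vertex S j) = psi j) -> in_delta S psi) ->
  Hom1zero (two_cx S) X.
Proof.
move=> hX h phi hphi.
have [h1 _] := is_homE hphi.
have [|z hz ez] := h (fun j => free_gen k (two_vertex S) hn j *m phi).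
  by move=> j; rewrite -mulmxA -h1 mulmxA gen_idem.
have [psi hpsi epsi] := free_hom hn hX hz.
exists psi => //; apply: (@hom_ext k n _ (two_vertex S) hn X) => //.
  by apply: hom_comp => //; have [_ _] := valid_two S.
move=> j; rewrite ez mulmxA cd_two (delta_hom _ _ _ hpsi) /two_delta.
by case: ifP => _; rewrite !epsi.
Qed.

(** It suffices to factor maps after projection to the cokernel [Q] of U_S': projectivity lifts the
    factorization, and the error lands in the image of the differential of U_S'. [Q] is spanned by
    the [g i *m Z ^+ c]. *)
Lemma two_shift (S S' : {set 'I_n}) : S \subset S' \/ S' \subset S ->
  hom_shift_zero (two_cx S) (two_cx S').
Proof.
move=> hS; have [hP1 hP0 hd] := valid_two S; have [hQ1 hQ0 hd'] := valid_two S'.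
have [Q [p [hp fp kp]]] := quot_exists (stab_hom hd').
have hQ : is_mod' Q := is_mod'_surj hp fp hQ0.1.
have pd : cd (two_cx S') *m p = 0 by apply/sub_kermxP; rewrite kp.
pose g i := two_gen i *m p.
have [p1 _] := is_homE hp.
have g_idem i : g i *m idem Q i = g i by rewrite /g -mulmxA -p1 mulmxA gen_idem.
have gd j : two_delta S' g j = 0.
  by rewrite /g -(delta_hom _ _ _ hp) -cd_two -mulmxA pd mulmx0.
have g_in j : j \in S' -> g (ord_pred j) *m fwd Q = g j.
  by move=> hj; apply/eqP; rewrite -subr_eq0; have := gd j; rewrite /two_delta hj => ->.
have g_out j : j \notin S' -> g j *m bwd Q = g (ord_pred j).
  by move=> hj; apply/eqP; rewrite -subr_eq0; have := gd j; rewrite /two_delta (negbTE hj) => ->.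
have hz : Hom1zero (two_cx S) Q.
  apply: Hom1zero_two => // psi hpsi.
  apply: (@in_delta_all k n hn S S' Q hQ g g_idem g_in g_out _ p) => // s.
  have -> : row s p = bvec k (enum_val s) *m p by rewrite rowE /bvec enum_valK.
  rewrite (bvec_gen _ hn).
  set t := enum_val s.
  have [c e] := g_word hQ g_in g_out (val t).1.1 (val t).1.2 (val t).2.
  exists (iter (val t).2 (@ord_pred n) (iter (val t).1.2 (@ordS n) (val t).1.1)), c.
  rewrite -e /g.
  have eA a : fwd two_rep0 ^+ a *m p = p *m fwd Q ^+ a.
    elim: a => [|a IH]; first by rewrite !expr0 mul1mx mulmx1.
    rewrite !exprS -mulmxA IH mulmxA [_ *m p](_ : _ = p *m fwd Q) ?mulmxA //.
    by rewrite /fwd mulmx_suml mulmx_sumr; apply: eq_bigr => i _; have [] := hp i.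
  have eB a : bwd two_rep0 ^+ a *m p = p *m bwd Q ^+ a.
    elim: a => [|a IH]; first by rewrite !expr0 mul1mx mulmx1.
    rewrite !exprS -mulmxA IH mulmxA [_ *m p](_ : _ = p *m bwd Q) ?mulmxA //.
    by rewrite /bwd mulmx_suml mulmx_sumr; apply: eq_bigr => i _; have [] := hp i.
  transitivity (two_gen (val t).1.1 *m fwd two_rep0 ^+ (val t).1.2 *m (p *m bwd Q ^+ (val t).2)).
    by rewrite -[LHS]mulmxA; congr (_ *m _); apply: eB.
  rewrite mulmxA; congr (_ *m _); rewrite -[RHS]mulmxA -[LHS]mulmxA.
  by congr (_ *m _); apply: eA.
move=> phi hphi.
have [psi hpsi epsi] := hz _ (hom_comp hphi hp).
have sub : (psi <= p)%MS by apply: submx_full.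
have [h0 hh0 eh0] := proj_lift hP0 hQ0.1 hQ hp hpsi sub.
have hr : is_hom (phi - cd (two_cx S) *m h0) by apply: homB => //; apply: hom_comp.
have sub' : (phi - cd (two_cx S) *m h0 <= cd (two_cx S'))%MS.
  by rewrite -kp; apply/sub_kermxP; rewrite mulmxBl -mulmxA eh0 epsi subrr.
have [h1 hh1 eh1] := proj_lift hP1 hQ1.1 hQ0.1 hd' hr sub'.
by exists h0, h1; split=> //; rewrite eh1 addrC subrK.
Qed.

End TwoTerm.

Section TwoClass.
Variables (k : fieldType) (R : realType) (n : nat).
Hypothesis hn : (1 < n)%N.

Definition indic (S : {set 'I_n}) (i : 'I_n) : R := (i \in S)%:R.

Lemma inH_iota (v : 'rV[R]_n) : inH (Defs.iota v).
Proof.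
rewrite /inH /Defs.iota; under eq_bigr do rewrite !mxE.
rewrite sumrB -mulr_sumr; have := sum_evlast R hn; under eq_bigr do rewrite mxE.
by move=> ->; rewrite mulr1 subrr.
Qed.

Lemma iota_nonlast (v : 'rV[R]_n) i : ~~ is_last i -> Defs.iota v 0 i = v 0 i.
Proof. by move=> hi; rewrite !mxE (negbTE hi) mulr0 subr0. Qed.

(** The vertex [i] occurs once in degree 0, and in degree -1 for the relations [j = i] in [S] and
    [j = ordS i] outside [S]: 1 - [i in S] - [i+1 not in S] = [i+1 in S] - [i in S]. *)
Lemma class_two S : Defs.iota (cxclass R (two_cx k hn S)) = th_of (indic S).
Proof.
apply: inH_eq; [exact: inH_iota | exact: inH_th_of |] => i hi.
rewrite iota_nonlast // !mxE /= !(topmult_free k _ hn hi) /indic.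
have -> : #|[pred j : 'I_n | j == i]| = 1%N by rewrite (@eq_card1 _ i).
have -> : #|[pred j | two_vertex S j == i]| = ((i \in S) + (ordS i \notin S))%N.
  have pS j : (ord_pred j == i) = (j == ordS i) by rewrite -(inj_eq (@ordS_inj n)) ord_predK.
  rewrite -(cardID (mem S)); congr addn.
    case: (boolP (i \in S)) => hS.
      apply: (@eq_card1 _ i) => j; rewrite !inE /two_vertex; case hj: (j \in S); rewrite /= ?andbT ?andbF //.
      by apply/esym/negbTE; apply: contraFneq hj => ->.
    apply: eq_card0 => j; rewrite !inE /two_vertex; case hj: (j \in S); rewrite /= ?andbT ?andbF //.
    by apply: contraNF hS => /eqP <-.
  case: (boolP (ordS i \in S)) => hS.
    apply: eq_card0 => j; rewrite !inE /two_vertex; case hj: (j \in S); rewrite /= ?andbT ?andbF // pS.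
    by apply: contraFF hj => /eqP ->.
  apply: (@eq_card1 _ (ordS i)) => j; rewrite !inE /two_vertex; case hj: (j \in S); rewrite /= ?andbT ?andbF.
    by apply/esym/negbTE; apply: contraNneq hS => <-.
  exact: pS.
rewrite natrD; case: (i \in S); case: (ordS i \in S); rewrite /=; lra.
Qed.

End TwoClass.

(** * Indecomposability and decomposition of H *)

Section EulerInvariance.
Variables (k : fieldType) (R : realType) (n : nat).
Implicit Types (X P Q : rep k n) (U V W : cx k n).

Local Notation cmap U V :=
  ('M[k]_(rd (c1 U), rd (c1 V)) * 'M[k]_(rd (c0 U), rd (c0 V)))%type.

Lemma dim_mul_full P Q X (v : 'M[k]_(rd Q, rd P)) (V : {vspace 'M[k]_(rd P, rd X)}) :
  row_full v -> \dim (linfun (mulmx v) @: V) = \dim V.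
Proof.
move=> fv; apply: limg_dim_eq; apply/eqP; rewrite -subv0; apply/subvP => f.
rewrite memv_cap memv_ker lfunE memv0 /= => /andP[_ /eqP e].
by have /row_fullP[u uv] := fv; rewrite -[f]mul1mx -uv -mulmxA e mulmx0.
Qed.

Lemma hd_le P Q X (v : 'M[k]_(rd Q, rd P)) : is_proj' P -> is_proj' Q -> is_mod' X ->
  is_hom v -> row_full v -> (hd P X <= hd Q X)%N.
Proof.
move=> hP hQ hX hv fv; rewrite -!dim_homsp // -(dim_mul_full (homsp P X) fv).
by apply: dimvS; apply/subvP => _ /memv_imgP[f /homspP hf ->]; rewrite lfunE; apply/homspP/hom_comp.
Qed.

Lemma hd_rsum P Q X : is_proj' P -> is_proj' Q -> is_mod' X ->
  hd (rsum P Q) X = (hd P X + hd Q X)%N.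
Proof.
move=> hP hQ hX; rewrite -!dim_homsp //; last exact: is_proj'_rsum.
have r1 : rin1 P Q *m rpr1 P Q = 1%:M by rewrite /rin1 /rpr1 mul_row_col mulmx1 mulmx0 addr0.
have r2 : rin1 P Q *m rpr2 P Q = 0 by rewrite /rin1 /rpr2 mul_row_col mulmx1 mulmx0 addr0.
have r3 : rin2 P Q *m rpr2 P Q = 1%:M by rewrite /rin2 /rpr2 mul_row_col mulmx1 mulmx0 add0r.
have full2 : row_full (rpr2 P Q) by apply/row_fullP; exists (rin2 P Q).
rewrite -(limg_ker_dim (linfun (mulmx (rin1 P Q))) (homsp (rsum P Q) X)) addnC; congr addn.
  congr (\dim _); apply/eqP; rewrite eqEsubv; apply/andP; split; apply/subvP.
    move=> _ /memv_imgP[f /homspP hf ->]; rewrite lfunE; apply/homspP.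
    by apply: hom_comp => //; exact: hom_rin1.
  move=> f /homspP hf; apply/memv_imgP; exists (rpr1 P Q *m f).
    by apply/homspP; apply: hom_comp => //; exact: hom_rpr1.
  by rewrite lfunE /= mulmxA r1 mul1mx.
rewrite -(dim_mul_full (homsp Q X) full2).
congr (\dim _); apply/eqP; rewrite eqEsubv; apply/andP; split; apply/subvP => f.
  rewrite memv_cap memv_ker lfunE /= => /andP[/(@homspP _ _ (rsum P Q) X f) hf /eqP e].
  apply/memv_imgP; exists (rin2 P Q *m f).
    by apply/homspP; apply: hom_comp => //; exact: hom_rin2.
  by rewrite lfunE /= -[LHS]mul1mx -col_rin mul_col_mx e /rpr2 mul_col_mx mul0mx mul1mx.
case/memv_imgP => h /(@homspP _ _ Q X h) hh ->; rewrite memv_cap memv_ker lfunE /=.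
apply/andP; split; first by apply/(@homspP _ _ (rsum P Q) X _)/hom_comp => //; exact: hom_rpr2.
by rewrite lfunE /= mulmxA r2 mul0mx.
Qed.

(* The mapping cone of a homotopy equivalence is split exact, which compares
   [c0 U + c1 V] with [c0 V + c1 U]. *)
Lemma hd_cxiso_le U V X : valid_cx U -> valid_cx V -> is_mod' X -> cxiso U V ->
  (hd (c0 U) X + hd (c1 V) X <= hd (c0 V) X + hd (c1 U) X)%N.
Proof.
move=> [u1 u0 ud] [v1 v0 vd] hX /cxisoP[[a1 a0] [[b1 b0]]].
move=> [[/= ha1 ha0 ac] [/= hb1 hb0 bc] [h /= hh [h1 h0]] [l /= hl [l1 l0]]].
rewrite -!hd_rsum //.
pose S : 'M[k]_(rd (rsum (c0 V) (c1 U)), rd (rsum (c0 U) (c1 V))) :=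
  block_mx b0 (- l) (- cd U) a1.
pose T : 'M[k]_(rd (rsum (c0 U) (c1 V)), rd (rsum (c0 V) (c1 U))) :=
  block_mx a0 h (cd V) b1.
pose x := - (a0 *m l) + h *m a1.
(* The homotopies [h] and [l] complete the two chain maps to block matrices with unitriangular
   product, so [S] is onto. *)
have TS : T *m S = block_mx 1%:M x 0 1%:M.
  rewrite /T /S mulmx_block !mulmxN bc subrr /x.
  have -> : a0 *m b0 - h *m cd U = 1%:M by rewrite -h0 opprB addrC subrK.
  by have -> : - (cd V *m l) + b1 *m a1 = 1%:M by rewrite -l1 opprB subrK.
apply: (@hd_le _ _ _ S); try exact: is_proj'_rsum; first exact: hX.
  by apply: hom_rsuml; apply: hom_rsumr => //; apply: homN.
apply/row_fullP; exists (block_mx 1%:M (- x) 0 1%:M *m T).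
rewrite -mulmxA TS; apply: etrans (esym (scalar_mx_block _ _ _)).
by rewrite mulmx_block !mulmx0 !mul0mx !mulmx1 !mul1mx !addr0 !add0r addrN.
Qed.

Lemma euler_cxiso U V X : valid_cx U -> valid_cx V -> is_mod' X -> cxiso U V ->
  euler R U X = euler R V X.
Proof.
move=> vU vV hX e; have h1 := hd_cxiso_le vU vV hX e.
have h2 := hd_cxiso_le vV vU hX (cxiso_sym e).
rewrite /euler; apply/eqP; rewrite subr_eq -addrAC eq_sym subr_eq -!natrD eqr_nat.
by rewrite eqn_leq h1 h2.
Qed.

Lemma euler_cxsum U V X : valid_cx U -> valid_cx V -> is_mod' X ->
  euler R (cxsum U V) X = euler R U X + euler R V X.
Proof. by move=> [u1 u0 _] [v1 v0 _] hX; rewrite /euler /= !hd_rsum // !natrD; lra. Qed.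

(** Transport [phi] to [U], decompose it there and transport back; the homotopy [s] from the
    retraction to the identity supplies the correction terms, which factor through [cd V]. *)
Lemma hom_shift_zero_retract U V : retract V U -> valid_cx V -> hom_shift_zero U U ->
  hom_shift_zero V V.
Proof.
move=> [[a1 a0] [[b1 b0]]] [[/= ha1 ha0 ac] [/= hb1 hb0 bc] [s /= hs [s1 s0]]] [_ _ vd] hU phi hphi.
have [h0 [h1 [hh0 hh1 e]]] := hU (b1 *m phi *m a0) (hom_comp (hom_comp hb1 hphi) ha0).
have e1 : a1 *m b1 = 1%:M + cd V *m s by rewrite -s1 addrC subrK.
have e0 : a0 *m b0 = 1%:M + s *m cd V by rewrite -s0 addrC subrK.
exists (a0 *m h0 *m b0 - s *m phi *m (a0 *m b0)), (a1 *m h1 *m b1 - phi *m s); split.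
- by apply: homB; repeat apply: hom_comp.
- by apply: homB; repeat apply: hom_comp.
have : a1 *m (b1 *m phi *m a0) *m b0 = (a1 *m b1) *m phi *m (a0 *m b0) by rewrite !mulmxA.
rewrite e mulmxDr mulmxDl => E.
have -> : cd V *m (a0 *m h0 *m b0 - s *m phi *m (a0 *m b0)) +
  (a1 *m h1 *m b1 - phi *m s) *m cd V =
  (a1 *m (cd U *m h0) *m b0 + a1 *m (h1 *m cd U) *m b0) -
  (cd V *m s) *m phi *m (a0 *m b0) - phi *m (s *m cd V).
  rewrite mulmxBr mulmxBl !mulmxA ac -!mulmxA bc !mulmxA -!addrA; congr (_ + _).
  by rewrite [in LHS]addrCA.
rewrite E e1 mulmxDl mul1mx mulmxDl addrK e0 mulmxDr mulmx1 addrK //.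
Qed.

End EulerInvariance.

Section Indecomposable.
Variables (k : closedFieldType) (R : realType) (n : nat).
Hypothesis hn : (1 < n)%N.
Let n0 : (0 < n)%N := ltnW hn.
Implicit Types (X : rep k n) (U V W : cx k n).

Lemma presilt_TF U m (F : 'I_m -> cx k n) (c : 'I_m -> R) X : valid_cx U ->
  hom_shift_zero U U -> splits_homs U F -> (forall i, 0 < c i) -> is_mod' X ->
  (Tbar (Defs.iota (\sum_i c i *: cxclass R (F i))) X <-> Hom1zero U X) /\
  (Fbar (Defs.iota (\sum_i c i *: cxclass R (F i))) X <-> Hom0zero U X).
Proof.
move=> vU hU hF hc hX.
have th_e Y : is_mod' Y ->
    pair (Defs.iota (\sum_i c i *: cxclass R (F i))) (dimv Y) = \sum_i c i * euler R (F i) Y.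
  move=> hY; rewrite pair_iota //.
  under [RHS]eq_bigr do rewrite -pair_cxclass mulr_sumr.
  rewrite exchange_big; apply: eq_bigr => j _.
  by rewrite summxE mulr_suml; apply: eq_bigr => i _; rewrite mxE mulrA.
by split; [apply: (Tbar_presilt vU hU hF hc) | apply: (Fbar_presilt vU hU hF hc)].
Qed.

Lemma TFeq'_presilt U m p (F : 'I_m -> cx k n) (G : 'I_p -> cx k n) (c : 'I_m -> R) (d : 'I_p -> R) :
  valid_cx U -> hom_shift_zero U U -> splits_homs U F -> splits_homs U G ->
  (forall i, 0 < c i) -> (forall i, 0 < d i) ->
  TFeq' k (Defs.iota (\sum_i c i *: cxclass R (F i))) (Defs.iota (\sum_i d i *: cxclass R (G i))).
Proof.
move=> vU hU hF hG hc hd; split=> X hX.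
  by rewrite (presilt_TF vU hU hF hc hX).1 (presilt_TF vU hU hG hd hX).1.
by rewrite (presilt_TF vU hU hF hc hX).2 (presilt_TF vU hU hG hd hX).2.
Qed.

Lemma splits_self U : valid_cx U -> splits_homs U (fun _ : 'I_1 => U).
Proof. by move=> vU; split=> // X hX; split=> // h; apply: (h ord0). Qed.

Lemma presilt_TF1 U X : valid_cx U -> hom_shift_zero U U -> is_mod' X ->
  (Tbar (Defs.iota (cxclass R U)) X <-> Hom1zero U X) /\
  (Fbar (Defs.iota (cxclass R U)) X <-> Hom0zero U X).
Proof.
move=> vU hU hX.
have := presilt_TF (c := fun=> 1) vU hU (splits_self vU) (fun=> ltr01) hX.
by rewrite big_ord1 scale1r.
Qed.

Lemma pair0 v : pair (0 : 'rV[R]_n) v = 0.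
Proof. by rewrite /pair big1 // => i _; rewrite mxE mul0r. Qed.

(** For theta = 0 every module is in Tbar and Fbar, so Hom(U, X[1]) = Hom(U, X) = 0 for all [X].
    Applied to the two terms of [U] this produces a contraction. *)
Lemma class_zero U : valid_cx U -> hom_shift_zero U U -> Defs.iota (cxclass R U) = 0 ->
  cx_is_zero U.
Proof.
move=> vU hU e; have [u1 u0 ud] := vU.
have H1 X : is_mod' X -> Hom1zero U X.
  move=> hX; apply/(presilt_TF1 vU hU hX).1; rewrite e; split=> [|W _]; first exact: hX.1.
  by rewrite pair0.
have H0 X : is_mod' X -> Hom0zero U X.
  move=> hX; apply/(presilt_TF1 vU hU hX).2; rewrite e; split=> [|W _]; first exact: hX.1.
  by rewrite pair0.
have [psi hpsi epsi] := H1 _ u1.1 _ (hom1 _).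
apply/cx_is_zeroP; exists psi => //; split=> //=.
apply/eqP; rewrite -subr_eq0; apply/eqP; apply: (H0 _ u0.1).
  by apply: homB; [exact: hom1 | exact: hom_comp].
by rewrite mulmxBr mulmx1 mulmxA -epsi mul1mx subrr.
Qed.

(** The simple module at [i] reads off a coordinate of the class, which makes classes invariant
    under [cxiso]. *)
Lemma class_simple (i : 'I_n) : ~~ is_last i ->
  exists2 X : rep k n, is_mod' X & forall U, euler R U X = cxclass R U 0 i.
Proof.
move=> hi; have lin : (i.+1 <= n)%N := ltn_ord i.
exists (thin k n i i.+1 predT) => [|U].
  split=> [|j hj]; first exact: is_mod_thin.
  apply/eqP; rewrite -mxrank_eq0 -/(dimv _ j) dimv_thin // eqb0.
  apply: contraNN hi => /andP[h1 h2]; move: hj; rewrite /is_last => /eqP <-.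
  by rewrite eqn_leq h1 -ltnS h2.
rewrite -pair_cxclass (bigD1 i) //= big1 => [|j ji].
  by rewrite dimv_thin // leqnn ltnSn mulr1 addr0.
rewrite dimv_thin // (_ : (i <= j < i.+1)%N = false) ?mulr0 //.
by apply: contraNF ji; rewrite ltnS -eqn_leq => /eqP e; apply/eqP/ord_inj.
Qed.

Lemma iota_eq (v w : 'rV[R]_n) : (forall i, ~~ is_last i -> v 0 i = w 0 i) ->
  Defs.iota v = Defs.iota w.
Proof.
move=> h; apply: inH_eq; [exact: inH_iota | exact: inH_iota |] => i hi.
by rewrite !iota_nonlast // h.
Qed.

Lemma iota_cxiso U V : valid_cx U -> valid_cx V -> cxiso U V ->
  Defs.iota (cxclass R U) = Defs.iota (cxclass R V).
Proof.
move=> vU vV e; apply: iota_eq => i hi; have [X hX eX] := class_simple hi.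
by apply: etrans (esym (eX U)) _; apply: etrans _ (eX V); apply: euler_cxiso.
Qed.

Lemma iota_cxsum U V : valid_cx U -> valid_cx V ->
  Defs.iota (cxclass R (cxsum U V)) = Defs.iota (cxclass R U + cxclass R V).
Proof.
move=> vU vV; apply: iota_eq => i hi; have [X hX eX] := class_simple hi.
apply: etrans (esym (eX _)) _; rewrite mxE.
apply: etrans _ (congr2 +%R (eX U) (eX V)); exact: euler_cxsum.
Qed.

Lemma iotaD (v w : 'rV[R]_n) : Defs.iota (v + w) = Defs.iota v + Defs.iota w.
Proof.
apply/rowP => i; rewrite !mxE (_ : \sum_j (v + w) 0 j = \sum_j v 0 j + \sum_j w 0 j); first ring.
by rewrite -big_split; apply: eq_bigr => j _; rewrite mxE.
Qed.

Lemma iotaZ a (v : 'rV[R]_n) : Defs.iota (a *: v) = a *: Defs.iota v.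
Proof.
apply/rowP => i; rewrite !mxE (_ : \sum_j (a *: v) 0 j = a * \sum_j v 0 j); first ring.
by rewrite mulr_sumr; apply: eq_bigr => j _; rewrite mxE.
Qed.

Lemma th_ofD x y : th_of x + th_of y = th_of (fun i => x i + y i) :> 'rV[R]_n.
Proof. by apply/rowP => i; rewrite !mxE; ring. Qed.

Lemma th_ofZ a x : a *: th_of x = th_of (fun i => a * x i) :> 'rV[R]_n.
Proof. by apply/rowP => i; rewrite !mxE; ring. Qed.

Lemma boundary (S : {set 'I_n}) : S != set0 -> S != setT ->
  exists2 i : 'I_n, ~~ is_last i & (i \in S) != (ordS i \in S).
Proof.
move=> S0 ST; apply: contrapT => /forall2NP h.
pose o : 'I_n := Ordinal n0.
have c (j : 'I_n) : (j \in S) = (o \in S).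
  have [m] := ubnP (j : nat); elim: m j => // m IH j le.
  have [j0|jp] := posnP j; first by congr (_ \in S); apply: ord_inj.
  have e : ord_pred j = j.-1 :> nat by apply: val_ord_pred_gt0.
  rewrite -(IH (ord_pred j)); last by rewrite e; lia.
  case: (h (ord_pred j)) => /negP; rewrite negbK; last by rewrite ord_predK => /eqP ->.
  by rewrite /is_last e; have := ltn_ord j; lia.
case: (boolP (o \in S)) => ho.
  by case/eqP: ST; apply/setP => j; rewrite c ho inE.
by case/eqP: S0; apply/setP => j; rewrite c (negbTE ho) inE.
Qed.

Lemma two_not_zero (S : {set 'I_n}) : S != set0 -> S != setT -> ~ cx_is_zero (two_cx k hn S).
Proof.
move=> S0 ST z; have := iota_cxiso (valid_two k hn S) (valid_cxzero k n) z.
have [i hi ne] := boundary S0 ST.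
rewrite class_two => /rowP/(_ i); rewrite iota_nonlast // !mxE /indic /topmult /=.
have r0 (M : 'M[k]_0) : \rank M = 0%N by rewrite flatmx0 mxrank0.
rewrite !r0 subrr; move: ne; case: (i \in S); case: (ordS i \in S) => //= _; lra.
Qed.

End Indecomposable.

(** * Indecomposability of the complexes U_S *)

Section TwoIndec.
Variables (k : closedFieldType) (R : realType) (n : nat).
Hypothesis hn : (1 < n)%N.
Let n0 : (0 < n)%N := ltnW hn.
Implicit Types (X : rep k n) (U V W : cx k n).

Lemma Hom1zero_cxsum V W X : Hom1zero V X -> Hom1zero W X -> Hom1zero (cxsum V W) X.
Proof.
move=> hV hW phi hphi.
have [f hf ef] := hV _ (hom_comp (hom_rin1 (c1 V) (c1 W)) hphi).
have [g hg eg] := hW _ (hom_comp (hom_rin2 (c1 V) (c1 W)) hphi).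
exists (col_mx f g); first exact: hom_rsuml.
rewrite -[LHS]mul1mx -col_rin mul_col_mx ef eg /= mul_block_col !mul0mx addr0 add0r //.
Qed.

Lemma Hom0zero_cxsum V W X : Hom0zero V X -> Hom0zero W X -> Hom0zero (cxsum V W) X.
Proof.
move=> hV hW psi hpsi e.
have e1 : (cin1 V W).2 *m psi = 0.
  have [_ hc cc] := chain_in1 V W.
  by apply: hV; [exact: hom_comp hc hpsi | rewrite mulmxA cc -mulmxA e mulmx0].
have e2 : (cin2 V W).2 *m psi = 0.
  have [_ hc cc] := chain_in2 V W.
  by apply: hW; [exact: hom_comp hc hpsi | rewrite mulmxA cc -mulmxA e mulmx0].
by rewrite -[LHS]mul1mx -col_rin mul_col_mx [X in col_mx X _]e1 [X in col_mx _ X]e2 col_mx0.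
Qed.

Definition pairfam V W (i : 'I_2) := if (i : nat) == 0%N then V else W.

Lemma retract_cxsum V W : retract V (cxsum V W) /\ retract W (cxsum V W).
Proof.
have [e1 e2 _ _ _] := cin_pr V W; split.
  exists (cin1 V W), (cpr1 V W); split; [exact: chain_in1 | exact: chain_pr1 |].
  by rewrite e1; apply: heq_refl.
exists (cin2 V W), (cpr2 V W); split; [exact: chain_in2 | exact: chain_pr2 |].
by rewrite e2; apply: heq_refl.
Qed.

Lemma splits_cxsum U V W : valid_cx U -> valid_cx V -> valid_cx W -> cxiso U (cxsum V W) ->
  splits_homs U (pairfam V W).
Proof.
move=> vU vV vW e; have [rV rW] := retract_cxsum V W.
have r1 := retract_iso e; have r2 := retract_iso (cxiso_sym e).
have rV' := retract_trans rV r2; have rW' := retract_trans rW r2.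
split=> [i|X hX|X hX]; first by rewrite /pairfam; case: ifP.
  split=> [h i|h]; first by rewrite /pairfam; case: ifP => _; apply: Hom1zero_retract h.
  by apply: Hom1zero_retract r1 vU _; apply: Hom1zero_cxsum; [exact: (h ord0) | exact: (h ord_max)].
split=> [h i|h]; first by rewrite /pairfam; case: ifP => _; apply: Hom0zero_retract h.
by apply: Hom0zero_retract r1 _; apply: Hom0zero_cxsum; [exact: (h ord0) | exact: (h ord_max)].
Qed.

Lemma nat_split (m p m' p' : nat) : 0 <= m%:R - p%:R :> R -> 0 <= m'%:R - p'%:R :> R ->
  (m%:R - p%:R) + (m'%:R - p'%:R) = 1 :> R -> m = p \/ m' = p'.
Proof.
rewrite !subr_ge0 !ler_nat => h1 h2 e.
have : (m + m')%:R = (p + p' + 1)%:R :> R by rewrite !natrD; move: e; lra.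
by move/eqP; rewrite eqr_nat => /eqP; lia.
Qed.

Lemma cone_ge0 (a b : R) : (forall c d, 0 < c -> 0 < d -> 0 < c * a + d * b) -> 0 <= a.
Proof.
move=> h; rewrite leNgt; apply/negP => a0; have := h 1 1 ltr01 ltr01; rewrite !mul1r => ab.
have b0 : 0 < b by lra.
have na : 0 < - a by rewrite oppr_gt0.
by have := h _ _ b0 na; rewrite mulNr mulrC subrr ltxx.
Qed.

(** If U_S = V + W with classes [y] and [z], all [c y + d z] with [c, d > 0] have the torsion pair
    of U_S, hence the pattern of 1_S. So [y] and [z] are constant on [S] and off [S]; at a boundary
    of [S] their jumps are integers of the same sign with sum 1 or -1. One jump is zero, and that
    summand has class zero. *)
Lemma two_indec (S : {set 'I_n}) : S != set0 -> S != setT -> cx_indec (two_cx k hn S).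
Proof.
move=> S0 ST; split; first exact: (@two_not_zero k R n hn S S0 ST).
move=> V W vV vW e; set U := two_cx k hn S in e *.
have vU : valid_cx U := valid_two k hn S.
have hU : hom_shift_zero U U by apply: two_shift; left.
have [rV rW] := retract_cxsum V W; have r2 := retract_iso (cxiso_sym e).
have hV := hom_shift_zero_retract (retract_trans rV r2) vV hU.
have hW := hom_shift_zero_retract (retract_trans rW r2) vW hU.
have [y ey] := inHP (inH_iota hn (cxclass R V)).
have [z ez] := inHP (inH_iota hn (cxclass R W)).
have sum_yz : th_of (indic R S) = th_of (fun i => y i + z i).
  rewrite -(class_two k R hn S) (iota_cxiso R hn vU (valid_cxsum vV vW) e).
  by rewrite iota_cxsum // iotaD ey ez th_ofD.
have hcd c d : 0 < c -> 0 < d -> same_pattern (fun i => c * y i + d * z i) (indic R S).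
  move=> hc hd; apply: (TFeq'_pattern n0 (k := k)); rewrite -th_ofD -!th_ofZ -ey -ez.
  pose cd' (i : 'I_2) := if (i : nat) == 0%N then c else d.
  have := TFeq'_presilt (c := cd') (d := fun=> 1) vU hU (splits_cxsum vU vV vW e) (splits_self vU).
  rewrite big_ord1 scale1r class_two big_ord_recl big_ord1 iotaD !iotaZ; apply=> // i.
  by rewrite /cd'; case: ifP.
have const p q : (p \in S) = (q \in S) -> y p = y q /\ z p = z q.
  move=> epq.
  have h c d : 0 < c -> 0 < d -> c * y p + d * z p = c * y q + d * z q.
    move=> hc hd; apply/eqP; rewrite eq_le !leNgt !(hcd c d hc hd) /indic epq ltxx //.
  (* The coefficients (1, 1) and (1, 2) suffice to separate [y] from [z]. *)
  have l2 : 0 < 2 :> R by [].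
  have h1 := h 1 1 ltr01 ltr01; have h2 := h 1 2 ltr01 l2.
  by split; lra.
have [i hi ne] := boundary hn S0 ST.
have const_all x : (forall p q, (p \in S) = (q \in S) -> x p = x q) -> x (ordS i) = x i ->
    th_of x = 0 :> 'rV[R]_n.
  move=> hx ex; have c0 p : x p = x i.
    have [e1|e1] := eqVneq (p \in S) (i \in S); first exact: hx.
    by rewrite -ex; apply: hx; move: ne e1; case: (p \in S) (i \in S) (ordS i \in S) => [] [] [].
  by apply/rowP => p; rewrite !mxE !c0 subrr.
have ya : y (ordS i) - y i = (topmult (c0 V) i)%:R - (topmult (c1 V) i)%:R.
  by move/rowP/(_ i): ey; rewrite iota_nonlast // !mxE => <-.
have za : z (ordS i) - z i = (topmult (c0 W) i)%:R - (topmult (c1 W) i)%:R.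
  by move/rowP/(_ i): ez; rewrite iota_nonlast // !mxE => <-.
have sa : indic R S (ordS i) - indic R S i = (y (ordS i) - y i) + (z (ordS i) - z i).
  by move/rowP/(_ i): sum_yz; rewrite !mxE => ->; ring.
have fin : y (ordS i) = y i \/ z (ordS i) = z i.
  have nat0 (m p : nat) (x x' : R) : x - x' = m%:R - p%:R -> m = p -> x = x'.
    by move=> h mp; apply/eqP; rewrite -subr_eq0 h mp subrr.
  case iS : (i \in S) in ne; case oS : (ordS i \in S) in ne => //.
    have ge c d : 0 < c -> 0 < d -> 0 < c * (y i - y (ordS i)) + d * (z i - z (ordS i)).
      move=> hc hd; have := hcd c d hc hd (ordS i) i; rewrite /indic iS oS ltr01.
      by move/idP; lra.
    have g1 := cone_ge0 ge.
    have g2 : 0 <= z i - z (ordS i).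
      by apply: (@cone_ge0 _ (y i - y (ordS i))) => c d hc hd; rewrite addrC; apply: ge.
    (* 1_S drops at this edge, so [c0] and [c1] exchange roles. *)
    have := @nat_split (topmult (c1 V) i) (topmult (c0 V) i) (topmult (c1 W) i) (topmult (c0 W) i).
    rewrite -(opprB (topmult (c0 V) i)%:R) -(opprB (topmult (c0 W) i)%:R) -ya -za !opprB.
    move: sa; rewrite /indic iS oS /= => sa.
    case=> //; first by move: sa; lra.
      by move=> h; left; apply: nat0 ya _.
    by move=> h; right; apply: nat0 za _.
  have ge c d : 0 < c -> 0 < d -> 0 < c * (y (ordS i) - y i) + d * (z (ordS i) - z i).
    move=> hc hd; have := hcd c d hc hd i (ordS i); rewrite /indic iS oS ltr01.
    by move/idP; lra.
  have g1 := cone_ge0 ge.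
  have g2 : 0 <= z (ordS i) - z i.
    by apply: (@cone_ge0 _ (y (ordS i) - y i)) => c d hc hd; rewrite addrC; apply: ge.
  have := @nat_split (topmult (c0 V) i) (topmult (c1 V) i) (topmult (c0 W) i) (topmult (c1 W) i).
  rewrite -ya -za; move: sa; rewrite /indic iS oS /= => sa.
  case=> //; first by move: sa; lra.
    by move=> h; left; apply: nat0 ya _.
  by move=> h; right; apply: nat0 za _.
case: fin => h; [left | right]; apply: (class_zero (R := R)) => //.
  by rewrite ey; apply: const_all h => p q epq; have [] := const p q epq.
by rewrite ez; apply: const_all h => p q epq; have [] := const p q epq.
Qed.

End TwoIndec.

(** * Covering H by cones of presilting complexes *)

Section Existence.
Variables (k : closedFieldType) (R : realType) (n : nat).
Hypothesis hn : (1 < n)%N.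
Let n0 : (0 < n)%N := ltnW hn.
Implicit Types (X : rep k n) (U V W : cx k n).

Definition amax (x : 'I_n -> R) : {set 'I_n} := [set j | [forall i, x i <= x j]].

Lemma amaxP (x : 'I_n -> R) j : reflect (forall i, x i <= x j) (j \in amax x).
Proof. by rewrite inE; apply: forallP. Qed.

Lemma amax_neq0 x : amax x != set0.
Proof.
apply/set0Pn; exists [arg max_(i > Ordinal n0) x i]%O.
by apply/amaxP => i; case: Order.TotalTheory.arg_maxP => // j _ h; apply: h.
Qed.

(* The sets are the proper superlevel sets of x. *)
Lemma chain_decomp (x : 'I_n -> R) : exists (Ss : seq {set 'I_n}) (c : {set 'I_n} -> R),
  [/\ [/\ uniq Ss, forall S, 0 < c S & th_of x = \sum_(S <- Ss) c S *: th_of (indic R S)],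
      forall S, S \in Ss -> [/\ S != set0, S != setT & amax x \subset S] &
      forall S T, S \in Ss -> T \in Ss -> S \subset T \/ T \subset S].
Proof.
have [m] := ubnP (n - #|amax x|)%N; elim: m x => // m IH x le.
have [eT|nT] := eqVneq (amax x) setT.
  exists [::], (fun=> 1); split=> //; split=> //; rewrite big_nil.
  apply/rowP => i; rewrite !mxE; apply/eqP; rewrite subr_eq0 eq_le.
  have h p : p \in amax x by rewrite eT inE.
  by apply/andP; split; apply: (amaxP _ _ (h _)).
set S := amax x in nT le *.
have /set0Pn[s sS] := amax_neq0 x; have maxs := amaxP _ _ sS.
have [t0 t0S] : exists t, t \notin S.
  apply: contrapT => /forallNP h; case/eqP: nT; apply/setP => j; rewrite [RHS]inE.
  by apply/negPn/negP => hj; apply: (h j).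
pose t := [arg max_(i > t0 | i \notin S) x i]%O.
have [tS maxt] : t \notin S /\ forall i, i \notin S -> x i <= x t.
  by rewrite /t; case: Order.TotalTheory.arg_maxP.
have xS i : i \in S -> x i = x s.
  by move=> /amaxP h; apply/le_anti; rewrite h maxs.
have ts : x t < x s.
  rewrite lt_neqAle maxs andbT; apply: contraNneq tS => e.
  by apply/amaxP => i; rewrite e.
(* The gap between the two largest values: subtracting it on [S] lowers the top level onto the next
   one, so the maximum set grows strictly. *)
pose c0 := x s - x t; have c0_gt0 : 0 < c0 by rewrite subr_gt0.
pose x' i := x i - c0 * indic R S i.
have x'S i : i \in S -> x' i = x t.
  by move=> hi; rewrite /x' /indic hi mulr1 xS // /c0 opprB addrC subrK.
have x'N i : i \notin S -> x' i = x i.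
  by move=> hi; rewrite /x' /indic (negbTE hi) mulr0 subr0.
have max' i : x' i <= x t.
  by have [/x'S -> //|hi] := boolP (i \in S); rewrite x'N // maxt.
have tS' : t \in amax x' by apply/amaxP => i; rewrite (x'N t).
have sub' : S \subset amax x'.
  by apply/subsetP => i hi; apply/amaxP => j; rewrite (x'S i).
have lt' : (#|S| < #|amax x'|)%N.
  by apply: proper_card; apply/properP; split=> //; exists t.
have lec := max_card (mem (amax x')); rewrite card_ord in lec.
have [|Ss [c [[u c_gt0 e] hS hchain]]] := IH x'; first by move: le lt' lec; move: (#|amax x'|) (#|S|) => a b; lia.
have SnSs : S \notin Ss.
  by apply/negP => /hS[_ _ /subsetP/(_ _ tS')]; rewrite (negbTE tS).
exists (S :: Ss), (fun T => if T == S then c0 else c T); split.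
- split; first by rewrite /= SnSs.
    by move=> T; case: ifP.
  rewrite big_cons eqxx.
  have -> : \sum_(T <- Ss) (if T == S then c0 else c T) *: th_of (indic R T) = th_of x'.
    rewrite e; apply: eq_big_seq => T hT; case: eqP => // eT.
    by move: SnSs; rewrite -eT hT.
  by rewrite th_ofZ th_ofD; congr th_of; apply/funext => i; rewrite /x'; ring.
- move=> T; rewrite inE => /orP[/eqP ->|/hS[h1 h2 h3]]; first by split=> //; exact: amax_neq0.
  by split=> //; apply: subset_trans sub' h3.
move=> T T'; rewrite !inE => /orP[/eqP ->|hT] /orP[/eqP ->|hT'].
- by left.
- by left; have [_ _] := hS _ hT'; apply: subset_trans.
- by right; have [_ _] := hS _ hT; apply: subset_trans.
exact: hchain.
Qed.

Local Notation cxsums := (foldr (@cxsum k n) (cxzero k n)).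

Lemma valid_cxsums (A : Type) (f : A -> cx k n) s : (forall a, valid_cx (f a)) ->
  valid_cx (cxsums (map f s)).
Proof. by move=> h; elim: s => [|a s IH] /=; [exact: valid_cxzero | exact: valid_cxsum]. Qed.

Lemma hom_shift_zero_cxsums (A : eqType) (f : A -> cx k n) s s' :
  (forall a b, a \in s -> b \in s' -> hom_shift_zero (f a) (f b)) ->
  hom_shift_zero (cxsums (map f s)) (cxsums (map f s')).
Proof.
elim: s => [|a s IH] h /=; first exact: hom_shift_zero_0l.
apply: hom_shift_zero_suml; last by apply: IH => c b hc; apply: h; rewrite inE hc orbT.
have {h} : forall b, b \in s' -> hom_shift_zero (f a) (f b) by move=> b; apply: h; rewrite mem_head.
elim: s' {IH} => [|b s' IH] h /=; first exact: hom_shift_zero_0r.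
apply: hom_shift_zero_sumr; first by apply: h; rewrite mem_head.
by apply: IH => c hc; apply: h; rewrite inE hc orbT.
Qed.

Lemma two_inj (S T : {set 'I_n}) : S != set0 -> S != setT ->
  cxiso (two_cx k hn S) (two_cx k hn T) -> S = T.
Proof.
move=> S0 ST /(iota_cxiso R hn (valid_two k hn S) (valid_two k hn T)).
rewrite !class_two => e.
have pat : same_pattern (indic R S) (indic R T).
  by apply/(TFeq_patternP k n0); rewrite e; split.
have /set0Pn[a aS] := S0.
have [b bS] : exists b, b \notin S.
  apply: contrapT => /forallNP h; case/eqP: ST; apply/setP => j; rewrite [RHS]inE.
  by apply/negPn/negP => hj; apply: (h j).
have lt01 (Q : {set 'I_n}) p q : (indic R Q p < indic R Q q) = (p \notin Q) && (q \in Q).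
  by rewrite /indic; case: (p \in Q); case: (q \in Q); rewrite ?ltxx ?ltr01 ?ltr10.
have := pat b a; rewrite !lt01 bS aS /= => /esym/andP[bT aT].
by apply/setP => j; have := pat b j; rewrite !lt01 bS bT /=.
Qed.

Lemma iota_sum (I : Type) (r : seq I) (F : I -> 'rV[R]_n) :
  Defs.iota (\sum_(i <- r) F i) = \sum_(i <- r) Defs.iota (F i).
Proof.
apply: (big_morph (@Defs.iota R n)); first exact: iotaD.
by rewrite -(scale0r 0) iotaZ !scale0r.
Qed.

Lemma cone_seq_map (A : Type) (f : A -> 'rV[R]_n) (a0 : A) s v : cone_seq (map f s) v <->
  exists c : 'I_(size s) -> R, (forall i, 0 < c i) /\ v = \sum_i c i *: f (nth a0 s i).
Proof.
have e := size_map f s.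
split=> -[c [hc ->]].
  exists (fun i => c (cast_ord (esym e) i)); split=> //.
  rewrite (reindex (cast_ord (esym e))) /=.
    by apply: eq_bigr => i _; rewrite /= (nth_map a0).
  by exists (cast_ord e) => i _; rewrite ?cast_ordK ?cast_ordKV.
exists (fun i => c (cast_ord e i)); split=> //.
rewrite (reindex (cast_ord e)) /=.
  by apply: eq_bigr => i _; rewrite /= (nth_map a0) //= -e.
by exists (cast_ord (esym e)) => i _; rewrite ?cast_ordK ?cast_ordKV.
Qed.

Lemma presilt_exists (th : 'rV[R]_n) : inH th -> exists U : cx k n, presilt U /\ inCi U th.
Proof.
move=> /inHP[x ->]; have [Ss [c [[u c_gt0 e] hS hch]]] := chain_decomp x.
pose Us := map (two_cx k hn) Ss; pose U := cxsums Us.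
have nthU i : (i < size Us)%N -> nth (cxzero k n) Us i = two_cx k hn (nth set0 Ss i).
  by rewrite size_map => h; rewrite (nth_map set0).
have dec : cx_decomp U Us.
  split=> [i hi|]; last exact: cxiso_refl.
  have hS' : nth set0 Ss i \in Ss by rewrite mem_nth //; move: hi; rewrite size_map.
  rewrite nthU //; split; first exact: valid_two.
  by have [h1 h2 _] := hS _ hS'; apply: (@two_indec k R n hn).
exists U; split.
  split; first by apply: valid_cxsums => S; apply: valid_two.
    by apply: hom_shift_zero_cxsums => S T hS1 hT1; apply: two_shift; apply: hch.
  exists Us; split=> // i j hi hj ij; rewrite !nthU // => /two_inj.
  rewrite size_map in hi hj; have [h1 h2 _] := hS _ (mem_nth set0 hi).
  by move=> /(_ h1 h2)/eqP; rewrite nth_uniq // => /eqP.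
exists Us; split=> //.
exists (\sum_(i < size Ss) c (nth set0 Ss i) *: cxclass R (two_cx k hn (nth set0 Ss i))).
  rewrite /Us -map_comp; apply/(cone_seq_map _ set0).
  by exists (fun i => c (nth set0 Ss i)).
rewrite iota_sum e (big_nth set0) big_mkord; apply: eq_bigr => i _.
by rewrite iotaZ class_two.
Qed.

Lemma inCi_TF U (th : 'rV[R]_n) X : valid_cx U -> hom_shift_zero U U -> inCi U th -> is_mod' X ->
  (Tbar th X <-> Hom1zero U X) /\ (Fbar th X <-> Hom0zero U X).
Proof.
move=> vU hU [Us [dec [v /(cone_seq_map _ (cxzero k n))[c [hc ->]] ->]]] hX.
apply: presilt_TF => //; apply: biproduct_splits => //; last exact: cx_decomp_biproduct.
by move=> i; have [] := dec.1 i (ltn_ord i).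
Qed.

Lemma inCi_TFeq' U (th eta : 'rV[R]_n) : valid_cx U -> hom_shift_zero U U -> inCi U th -> inCi U eta ->
  TFeq' k th eta.
Proof.
move=> vU hU h1 h2; split=> X hX.
  by rewrite (inCi_TF vU hU h1 hX).1 (inCi_TF vU hU h2 hX).1.
by rewrite (inCi_TF vU hU h1 hX).2 (inCi_TF vU hU h2 hX).2.
Qed.

Lemma inCi_inH U (th : 'rV[R]_n) : inCi U th -> inH th.
Proof. by move=> [Us [_ [v _ ->]]]; apply: inH_iota. Qed.

Lemma inCi_unique U V (th eta : 'rV[R]_n) : presilt U -> presilt V -> inCi U th -> inCi V eta ->
  TFeq' k th eta -> cxiso U V.
Proof.
move=> [vU hU [Us [dU nU]]] [vV hV [Vs [dV nV]]] iU iV [hT hF].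
apply: (presilt_unique vU vV hU hV _ _ (cx_decomp_biproduct dU) (cx_decomp_biproduct dV)).
- by move=> X hX; rewrite -(inCi_TF vU hU iU hX).1 -(inCi_TF vV hV iV hX).1; apply: hT.
- by move=> X hX; rewrite -(inCi_TF vU hU iU hX).2 -(inCi_TF vV hV iV hX).2; apply: hF.
- by move=> i; apply: dU.1.
- by move=> i; apply: dV.1.
- by move=> i i' ne; apply: nU => // e; apply: ne; apply: ord_inj.
- by move=> i i' ne; apply: nV => // e; apply: ne; apply: ord_inj.
Qed.

Lemma inCi_cxiso U V (th : 'rV[R]_n) : cxiso U V -> inCi V th -> inCi U th.
Proof. by move=> e [Us [d h]]; exists Us; split=> //; apply: cx_decomp_iso d. Qed.

(** An [eta] equivalent to [th] is in H and lies in the cone of some presilting [V] with the same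
    torsion pairs, so [V] is isomorphic to [U]. Conversely, a common cone gives equivalence on
    Pi'-modules, which on H is full TF equivalence. *)
Lemma inCi_TFclass U (th eta : 'rV[R]_n) : presilt U -> inCi U th ->
  TFeq k th eta <-> inCi U eta.
Proof.
move=> pU iU; have [vU hU _] := pU; split=> [h|iU'].
  have [V [pV iV]] := presilt_exists (TFeq_inH n0 h (inCi_inH iU)).
  exact: inCi_cxiso (inCi_unique pU pV iU iV (TFeq_TFeq' h)) iV.
have [x ex] := inHP (inCi_inH iU); have [y ey] := inHP (inCi_inH iU').
have := inCi_TFeq' vU hU iU iU'; rewrite ex ey; exact: TFeq'_TFeq.
Qed.

End Existence.

Theorem theorem8p3 (k : closedFieldType) (R : realType) (n : nat)
  (hn : (2 <= n)%N) :
  [/\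
   (* H is the union of the pieces w(cone°{[P(j)]-[P(n)] | j in J}) *)
   (forall th : 'rV[R]_n,
      inH th <-> exists J w, [/\ admJ J, wordW' w & piece J w th]),
   (* each piece depends only on the coset w W'_J *)
   (forall J w w', admJ J -> wordW' w -> wordW' w' -> sameCoset R J w w' ->
      forall th : 'rV[R]_n, piece J w th <-> piece J w' th),
   (* pieces indexed by distinct (J, w W'_J) are disjoint *)
   (forall J J' w w' (th : 'rV[R]_n), admJ J -> admJ J' -> wordW' w ->
      wordW' w' -> piece J w th -> piece J' w' th ->
      J = J' /\ sameCoset R J w w'),
   (* each piece is a TF equivalence class *)
   (forall J w (th : 'rV[R]_n), admJ J -> wordW' w -> piece J w th ->
      forall eta, TFeq k th eta <-> piece J w eta) &
   [/\
   (* H is the union of the iota(C°(U)), U in 2-presilt Pi' *)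
   (forall th : 'rV[R]_n,
      inH th <-> exists U : cx k n, presilt U /\ inCi U th),
   (* these are disjoint for non-isomorphic U *)
   (forall (U V : cx k n) (th : 'rV[R]_n), presilt U -> presilt V ->
      inCi U th -> inCi V th -> cxiso U V) &
   (* each iota(C°(U)) is a TF equivalence class *)
   (forall (U : cx k n) (th : 'rV[R]_n), presilt U -> inCi U th ->
      forall eta, TFeq k th eta <-> inCi U eta)]].
Proof.
split.
- by move=> th; exact: pieces_cover.
- by move=> J w w' _ _ _; exact: piece_coset.
- by move=> J J' w w' th; exact: pieces_disjoint.
- by move=> J w th _ _; exact: piece_TFeq.
split.
- move=> th; split; first exact: presilt_exists.
  by move=> [U [_ iU]]; exact: inCi_inH iU.
- by move=> U V th pU pV iU iV; apply: (inCi_unique pU pV iU iV); split.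
by move=> U th pU iU eta; exact: inCi_TFclass.
Qed.
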